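(* Suppose Assumptions 1, 2, 3 of the context hold and let $\{x_k\}$ be generated by the approximate ZS-BCCG method described in the context for $\min_{x\in X}\{\Phi(x)=f(x)+\chi(x)\}$. Suppose the stepsizes satisfy $0<\alpha_k\le1/L_s$ for all $s\in\mathcal B$ and all $k$, and $$P_R(k)=\mathrm{Prob}\{R=k\}=\frac{\alpha_k\min_{s\in\mathcal B}\{p_s(1-L_s\alpha_k)\}}{\sum_{k=1}^T\alpha_k\min_{s\in\mathcal B}\{p_s(1-L_s\alpha_k)\}},\quad k=1,\dots,T$$ (the denominator being nonzero). Then $$\mathbb E\big[\|\mathcal P(x_R,\nabla f(x_R),\alpha_R)\|^2\big]\le\frac{2[\Phi(x_1)-\Phi^*]+6\sum_{k=1}^T\delta_k+\sum_{k=1}^T\max_{s\in\mathcal B}\big\{p_s(\frac1{L_s}+4\alpha_k)\big\}\big[\frac{2\tilde\sigma^2}{T_k}+\frac{\mu^2}2L_f^2(n+3)^3\big]}{\sum_{k=1}^T\alpha_k\min_{s\in\mathcal B}\{p_s(1-L_s\alpha_k)\}},$$ where $\tilde\sigma^2=4(n+4)[2M^2+\sigma^2+\mu^2L_f^2(n+4)^2]$ and the expectation is over all the randomness of the method.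
   Context: Notation: $n=n_1+\dots+n_b$, $\mathcal B=\{1,\dots,b\}$, $U_s\in\mathbb R^{n\times n_s}$ with $(U_1,\dots,U_b)=I_n$; $x^{(s)}=U_s^Tx$, $\nabla_sf=U_s^T\nabla f$; $\|\cdot\|$, $\|\cdot\|_s$ are Euclidean norms on $\mathbb R^n$, $\mathbb R^{n_s}$. $X=X_1\times\cdots\times X_b$, each $X_s\subseteq\mathbb R^{n_s}$ closed convex. Problem: $\Phi=f+\chi$ with $f(x)=\mathbb E_\xi[F(x,\xi)]$ (possibly nonconvex), $\xi$ a random variable, $F$ Borel measurable and defined for all $x\in\mathbb R^n$; $\chi(x)=\sum_{s=1}^b\chi_s(x^{(s)})$ with $\chi_s:\mathbb R^{n_s}\to\mathbb R$ closed convex. $\Phi^*=\min_{x\in X}\Phi(x)$. Assumption 1: $\mathbb E[F(x,\xi)]=f(x)$ and $\mathbb E[\nabla F(x,\xi)]=\nabla f(x)$ for all $x$, and $\mathbb E[\|\nabla F(x,\xi)-\nabla f(x)\|^2]\le\sigma^2$ for all $x\in X$. Assumption 2: almost surely in $\xi$, $\|\nabla F(x,\xi)-\nabla F(y,\xi)\|\le L_f\|x-y\|$ for all $x,y$, and for each $s\in\mathcal B$, $\|\nabla_sF(x+U_sh,\xi)-\nabla_sF(x,\xi)\|_s\le L_s\|h\|_s$ for all $x$ and all $h\in\mathbb R^{n_s}$ ($L_f,L_s>0$). Assumption 3: $\|\nabla f(x)\|\le M$ for all $x\in X$. Generalized gradient: $\phi_s:\mathbb R^{n_s}\to\mathbb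 R$ is differentiable and 1-strongly convex, $D_{\phi_s}(x,y)=\phi_s(x)-\phi_s(y)-\langle\nabla\phi_s(y),x-y\rangle$. For $\alpha>0$, $P_s(x^{(s)},g^{(s)},\alpha)=\arg\min_{y\in X_s}\{\langle g^{(s)},y\rangle+\frac1\alpha D_{\phi_s}(y,x^{(s)})+\chi_s(y)\}$, $\mathcal P_s(x,g,\alpha)=\frac1\alpha[x^{(s)}-P_s(x^{(s)},g^{(s)},\alpha)]$, and $\mathcal P(x,g,\alpha)=(\mathcal P_1(x,g,\alpha),\dots,\mathcal P_b(x,g,\alpha))$. Zeroth-order gradient: for $\mu>0$, $G_\mu(x,\xi,u)=\frac{F(x+\mu u,\xi)-F(x,\xi)}{\mu}u$. Procedure $\mathrm{CndG}_{X_s}(x,g,\alpha,\delta)$ ($x\in X_s$, $g\in\mathbb R^{n_s}$, $\alpha,\delta>0$): start with $u_1=x$, $t=1$. Compute a minimizer $v_{t+1}$ over $u\in X_s$ of $V(u)=\langle g+\frac1\alpha(\nabla\phi_s(u_t)-\nabla\phi_s(x)),u-u_t\rangle+\chi_s(u)-\chi_s(u_t)$. If $V(v_{t+1})\ge-\delta$, return $u_t$; otherwise set $u_{t+1}=(1-\frac2{t+1})u_t+\frac2{t+1}v_{t+1}$, $t\leftarrow t+1$ and repeat. The procedure is understood to be well defined and to terminate. Approximate ZS-BCCG method: given $x_1\in X$, $\mu>0$, iteration count $T$, stepsizes $\alpha_k>0$, batch sizes $T_k\ge1$, approximating parameters $\delta_k>0$, probabilities $p_s\in[0,1]$ with $\sum_sp_s=1$.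 Draw i.i.d. block indices $i_k$ with $\mathrm{Prob}\{i_k=s\}=p_s$ and $R\in\{1,\dots,T\}$ with probability mass function $P_R$. At step $k$ draw $u_{k,t}\sim N(0,I_n)$ and oracle samples $\xi_{k,t}$ distributed as $\xi$, $t=1,\dots,T_k$, set $\bar G_{\mu,k}^{(i_k)}=\frac1{T_k}\sum_{t=1}^{T_k}U_{i_k}^TG_\mu(x_k,\xi_{k,t},u_{k,t})$, $x_{k+1}^{(i_k)}=\mathrm{CndG}_{X_{i_k}}(x_k^{(i_k)},\bar G_{\mu,k}^{(i_k)},\alpha_k,\delta_k)$, and $x_{k+1}^{(s)}=x_k^{(s)}$ for $s\ne i_k$. Output $x_R$. All random quantities $i_k,\xi_{k,t},u_{k,t},R$ are mutually independent. *)

(* Defs.v *)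
From HB Require Import structures.
From mathcomp Require Import all_boot all_order all_algebra finmap.
From mathcomp Require Import all_classical all_reals all_analysis.

Set Implicit Arguments.
Unset Strict Implicit.
Unset Printing Implicit Defensive.

Import Order.TTheory GRing.Theory Num.Theory.
Import numFieldNormedType.Exports.

Local Open Scope classical_set_scope.
Local Open Scope ring_scope.

(* Matrices carry the product sigma-algebra of their entries, as tuples do in
   the library; over R this is the Borel sigma-algebra of R^(m * n). *)
Section measurable_matrix.
Context {d : measure_display} {T : measurableType d} (m n : nat).

Definition matrix_measurable : set (set 'M[T]_(m, n)) :=
  <<s \bigcup_(ij in [set: 'I_m * 'I_n])
        preimage_set_system setT (fun A : 'M[T]_(m, n) => A ij.1 ij.2)
          measurable >>.

Fact matrix_measurable0 : matrix_measurable set0.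
Proof. exact: sigma_algebra0. Qed.

Fact matrix_measurableC A : matrix_measurable A -> matrix_measurable (~` A).
Proof. exact: sigma_algebraC. Qed.

Fact matrix_measurable_bigcup (F : (set 'M[T]_(m, n))^nat) :
  (forall k, matrix_measurable (F k)) -> matrix_measurable (\bigcup_k F k).
Proof. exact: sigma_algebra_bigcup. Qed.

HB.instance Definition _ :=
  @isMeasurable.Build (measure_tuple_display d) 'M[T]_(m, n) matrix_measurable
    matrix_measurable0 matrix_measurableC matrix_measurable_bigcup.

End measurable_matrix.

HB.instance Definition _ (m : nat) := isPointed.Build 'I_m.+1 ord0.
HB.instance Definition _ (m : nat) :=
  @isMeasurable.Build default_measure_display 'I_m.+1 discrete_measurable
    discrete_measurable0 discrete_measurableC discrete_measurableU.

(* The norm of the library on matrices is the maximum norm (it has the same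
   topology and the same differentiable functions); the Euclidean structure is
   therefore introduced separately. *)
Section euclidean.
Context {R : realType} {m : nat}.
Implicit Types (x y g v : 'cV[R]_m) (A : set 'cV[R]_m) (h : 'cV[R]_m -> R).

Definition dotv x y : R := \sum_i x i ord0 * y i ord0.

Definition enorm x : R := Num.sqrt (dotv x x).

Definition grad h x : 'cV[R]_m := \col_i 'D_(delta_mx i ord0) h x.

Definition minimizer A h y := A y /\ forall z, A z -> h y <= h z.

Definition closed_convex_function h :=
  closed [set z : 'cV[R]_m * R | h z.1 <= z.2] /\
  convex_function (E := 'cV[R]_m) setT h.

Definition strongly_convex1 h := forall x y (t : R), 0 <= t <= 1 ->
  h (t *: x + (1 - t) *: y) <=
    t * h x + (1 - t) * h y - t * (1 - t) / 2 * enorm (x - y) ^+ 2.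

Definition bregman (phi : 'cV[R]_m -> R) x y : R :=
  phi x - phi y - dotv (grad phi y) (x - y).

(* [xget] selects an element of the set of minimizers, which is a singleton
   when X is closed, convex and nonempty, chi is closed convex and phi is
   differentiable and strongly convex. *)
Definition prox (X : set 'cV[R]_m) (phi chi : 'cV[R]_m -> R) x g (alpha : R) :
    'cV[R]_m :=
  xget 0 (minimizer X
    (fun y => dotv g y + alpha^-1 * bregman phi y x + chi y)).

End euclidean.

Section conditional_gradient.
Context {R : realType} {m : nat}.
Variables (X : set 'cV[R]_m) (phi chi : 'cV[R]_m -> R).
Variables (x g : 'cV[R]_m) (alpha delta : R).

Definition cndG_gap (ut u : 'cV[R]_m) : R :=
  dotv (g + alpha^-1 *: (grad phi ut - grad phi x)) (u - ut) + chi u - chi ut.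

(* [cndG_loop t u y]: the loop, entered at iteration t with u_t = u, terminates
   and returns y.  The minimizers v_{t+1} are arbitrary. *)
Inductive cndG_loop (t : nat) (u : 'cV[R]_m) : 'cV[R]_m -> Prop :=
| cndG_return v of minimizer X (cndG_gap u) v & - delta <= cndG_gap u v :
    cndG_loop t u u
| cndG_continue v y of minimizer X (cndG_gap u) v & cndG_gap u v < - delta
    & cndG_loop t.+1 ((1 - 2 / t.+1%:R) *: u + (2 / t.+1%:R) *: v) y :
    cndG_loop t u y.

Definition cndG (y : 'cV[R]_m) : Prop := cndG_loop 1 x y.

End conditional_gradient.

Section blocks.
Context {R : realType} {b : nat} (n_ : 'I_b.+1 -> nat).
Local Notation n := (\sum_s n_ s)%N.

(* The column blocks U_s of the identity matrix: (U_1, ..., U_b) = I_n. *)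
Definition Ublk (s : 'I_b.+1) : 'M[R]_(n, n_ s) := submxrow 1%:M s.

Definition blk (s : 'I_b.+1) (x : 'cV[R]_n) : 'cV[R]_(n_ s) := (Ublk s)^T *m x.

Definition prod_set (X : forall s, set 'cV[R]_(n_ s)) : set 'cV[R]_n :=
  [set x | forall s, X s (blk s x)].

Definition sum_blk (chi : forall s, 'cV[R]_(n_ s) -> R) (x : 'cV[R]_n) : R :=
  \sum_s chi s (blk s x).

Definition gen_grad (X : forall s, set 'cV[R]_(n_ s))
    (phi chi : forall s, 'cV[R]_(n_ s) -> R) (x g : 'cV[R]_n) (alpha : R) :
    'cV[R]_n :=
  \mxcol_s (alpha^-1 *:
    (blk s x - prox (X s) (phi s) (chi s) (blk s x) (blk s g) alpha)).

End blocks.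
Arguments Ublk {R b n_} s.
Arguments blk {R b n_} s x.

Definition min_blk {R : realType} {b : nat} (v : 'I_b.+1 -> R) : R :=
  \big[Num.min/v ord0]_s v s.
Definition max_blk {R : realType} {b : nat} (v : 'I_b.+1 -> R) : R :=
  \big[Num.max/v ord0]_s v s.

Section oracle.
Context {R : realType} {dXi : measure_display} {Xi : measurableType dXi}.
Variable Q : probability Xi R.
Local Open Scope ereal_scope.

Definition assumption1 m (X : set 'cV[R]_m) (F : 'cV[R]_m -> Xi -> R)
    (f : 'cV[R]_m -> R) (sigma : R) :=
  [/\ forall x, Q.-integrable setT (EFin \o F x) /\ 'E_Q[F x] = (f x)%:E,
      forall x, differentiable f x,
      forall x i, let dF z := grad (F ^~ z) x i ord0 in
        Q.-integrable setT (EFin \o dF) /\ 'E_Q[dF] = (grad f x i ord0)%:E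
    & forall x, X x ->
        'E_Q[fun z => (enorm (grad (F ^~ z) x - grad f x) ^+ 2)%R]
          <= (sigma ^+ 2)%:E].

Definition assumption2 b (n_ : 'I_b.+1 -> nat)
    (F : 'cV[R]_(\sum_s n_ s) -> Xi -> R) (Lf : R) (L : 'I_b.+1 -> R) :=
  {ae Q, forall z,
    [/\ forall x, differentiable (F ^~ z) x,
        forall x y, (enorm (grad (F ^~ z) x - grad (F ^~ z) y)
                       <= Lf * enorm (x - y))%R
      & forall s x (h : 'cV[R]_(n_ s)),
          (enorm (blk s (grad (F ^~ z) (x + Ublk s *m h)%R)
                    - blk s (grad (F ^~ z) x)) <= L s * enorm h)%R]}.

Definition zo_grad m (F : 'cV[R]_m -> Xi -> R) (mu : R) (x : 'cV[R]_m)
    (z : Xi) (u : 'cV[R]_m) : 'cV[R]_m :=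
  (((F (x + mu *: u) z - F x z) / mu) *: u)%R.

(* The average over the samples t = 1, ..., N. *)
Definition zo_batch m (F : 'cV[R]_m -> Xi -> R) (mu : R) (N : nat)
    (x : 'cV[R]_m) (z : nat -> Xi) (u : nat -> 'cV[R]_m) : 'cV[R]_m :=
  (N%:R^-1 *: \sum_(1 <= t < N.+1) zo_grad F mu x (z t) (u t))%R.

End oracle.

Definition assumption3 {R : realType} m (X : set 'cV[R]_m)
    (f : 'cV[R]_m -> R) (M : R) :=
  forall x, X x -> enorm (grad f x) <= M.

Section randomness.
Context {R : realType} {d : measure_display} {Omega : measurableType d}.
Variable P : probability Omega R.
Local Open Scope ereal_scope.

Definition mutually_independent (I : choiceType) (D : set I)
    (G : I -> set (set Omega)) :=
  forall J : {fset I}, [set` J] `<=` D ->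
  forall E : I -> set Omega, (forall j, j \in J -> G j (E j)) ->
    P (\bigcap_(j in [set` J]) E j) = \prod_(j <- J) P (E j).

(* The law of Z is the product of standard normal laws, that is N(0, I_m). *)
Definition std_normal m (Z : Omega -> 'cV[R]_m) :=
  forall A : 'I_m -> set R, (forall j, measurable (A j)) ->
    P [set w | forall j, A j (Z w j ord0)] = \prod_(j < m) normal_prob (0 : R) 1 (A j).

End randomness.

(* Names of the random quantities of the method: the block index i_k, the
   oracle sample xi_{k,t}, the direction u_{k,t} and the stopping index R. *)
Inductive draw :=
  Block of nat | Sample of nat & nat | Direction of nat & nat | Stop.

Definition draw_code (j : draw) : nat * nat * nat :=
  match j with
  | Block k => (0, k, 0)
  | Sample k t => (1, k, t)
  | Direction k t => (2, k, t)
  | Stop => (3, 0, 0)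
  end%N.

Definition draw_decode (c : nat * nat * nat) : draw :=
  match c with
  | (0, k, _) => Block k
  | (1, k, t) => Sample k t
  | (2, k, t) => Direction k t
  | _ => Stop
  end%N.

Lemma draw_codeK : cancel draw_code draw_decode. Proof. by case. Qed.

HB.instance Definition _ := Countable.copy draw (can_type draw_codeK).

(* The draws made at steps 1, ..., k - 1, with batch sizes N. *)
Definition drawn_before (N : nat -> nat) (k : nat) : set draw :=
  fun j => match j with
  | Block l => (1 <= l < k)%N
  | Sample l t | Direction l t => (1 <= l < k)%N && (1 <= t <= N l)%N
  | Stop => false
  end.

Section method.
Context {R : realType} {b : nat} {n_ : 'I_b.+1 -> nat}.
Local Notation n := (\sum_s n_ s)%N.
Context {dXi d : measure_display} {Xi : measurableType dXi}.
Context {Omega : measurableType d} (P : probability Omega R).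
Variables (T : nat) (N : nat -> nat).
Variable ik : nat -> {RV P >-> 'I_b.+1}.
Variable xi : nat -> nat -> {RV P >-> Xi}.
Variable u : nat -> nat -> {RV P >-> 'cV[R]_n}.
Variable stop : {RV P >-> nat}.

Definition draw_sigma (j : draw) : set (set Omega) :=
  match j with
  | Block k => g_sigma_algebra_preimage (ik k)
  | Sample k t => g_sigma_algebra_preimage (xi k t)
  | Direction k t => g_sigma_algebra_preimage (u k t)
  | Stop => g_sigma_algebra_preimage stop
  end.

Definition history (k : nat) : set (set Omega) :=
  <<s \bigcup_(j in drawn_before N k) draw_sigma j >>.

Definition bccg_draws (Q : probability Xi R) (p : 'I_b.+1 -> R)
    (PR : nat -> R) :=
  [/\ forall k s, (1 <= k <= T)%N -> P (ik k @^-1` [set s]) = (p s)%:E,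
      forall k t A, (1 <= k <= T)%N -> (1 <= t <= N k)%N -> measurable A ->
        distribution P (xi k t) A = Q A,
      forall k t, (1 <= k <= T)%N -> (1 <= t <= N k)%N -> std_normal P (u k t),
      (forall w, (1 <= stop w <= T)%N) /\
      (forall k, (1 <= k <= T)%N -> P (stop @^-1` [set k]) = (PR k)%:E)
    & mutually_independent P (drawn_before N T.+1 `|` [set Stop]) draw_sigma].

(* The iterates x_1, ..., x_{T+1}.  The step equation says
   that x_{k+1}^{(i_k)} is the result of a run of the conditional gradient
   procedure; the choice of minimizers in that run may depend on the past but on
   no other randomness, so that x_k is a function of the draws made before
   step k. *)
Definition bccg_iterates (X : forall s, set 'cV[R]_(n_ s))
    (phi chi : forall s, 'cV[R]_(n_ s) -> R) (F : 'cV[R]_n -> Xi -> R)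
    (mu : R) (alpha delta : nat -> R) (x1 : 'cV[R]_n)
    (x : nat -> Omega -> 'cV[R]_n) :=
  [/\ forall w, x 1%N w = x1,
      forall k A, (1 <= k <= T.+1)%N -> measurable A ->
        history k (x k @^-1` A)
    & forall k w, (1 <= k <= T)%N -> let i := ik k w in
        let G := zo_batch F mu (N k) (x k w)
                   (fun t => xi k t w) (fun t => u k t w) in
        cndG (X i) (phi i) (chi i) (blk i (x k w)) (blk i G)
          (alpha k) (delta k) (blk i (x k.+1 w)) /\
        forall s, s != i -> blk s (x k.+1 w) = blk s (x k w)].

End method.

(* Main.v *)
From HB Require Import structures.
Require Import Defs.
From mathcomp Require Import all_boot all_order all_algebra finmap.
From mathcomp Require Import all_classical all_reals all_analysis.
From mathcomp Require Import measurable_realfun ring lra.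

(* Every step satisfies a pathwise inequality: comparing the variational
   inequality of the exact proximal point taken at grad f (x_k) with the
   delta_k-approximate one satisfied by the conditional gradient output, and using
   Young's inequality and the block descent inequality for f,
     2 Phi(x_{k+1}) + alpha_k (1 - L_i alpha_k) |P_i(x_k, grad f(x_k), alpha_k)|^2
       <= 2 Phi(x_k) + 6 delta_k + (1 / L_i + 4 alpha_k) |U_i^T (G_k - grad f(x_k))|^2,
   where i = i_k and G_k is the averaged zeroth-order gradient.  Since i_k is
   independent of x_k and of the samples of step k, taking expectations replaces
   the i-terms by their p_s-averages, and the sum over k telescopes.

   The second moment of G_k - grad f(x_k) is estimated without Gaussian smoothing:
   each summand is <grad F(x_k, xi), u> u, which is unbiased with explicit second
   moment, plus a Taylor remainder bounded by mu L_f |u|^3 / 2, whose square is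
   integrated with the sixth moment of the Gaussian vector.  Fubini's theorem for
   independent sigma-algebras allows x_k to be frozen in this estimate. *)

Set Implicit Arguments.
Unset Strict Implicit.
Unset Printing Implicit Defensive.

Import Order.TTheory GRing.Theory Num.Theory.
Import numFieldNormedType.Exports.

Local Open Scope classical_set_scope.
Local Open Scope ring_scope.

(** * Euclidean geometry and smooth functions *)

(** The factor 2 in front of [Phi] is what makes the step sizes cancel: descent and Young leave
    [2 (L - 1 / alpha) |y - x|^2], where [x], [y] are the old and new blocks, and passing from [y]
    to the exact proximal point by the parallelogram bound costs exactly the opposite amount. Two
    obstacles shape the rest. Integrability of [Phi (x k)] is not known beforehand, so [Phi] is
    replaced by the gap [Phi - Phistar], nonnegative at feasible points; every expectation of the
    method is then an extended-real integral of a nonnegative function, and the telescoping only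
    adds. Measurability is the other one: proximal points are picked by [xget], and become
    measurable because they depend in a Lipschitz way on [g - grad phi x / alpha], while [chi]
    enters through its closed epigraph, that is, as a lower semicontinuous function. The direct
    noise estimate gives [2 (n + 2) (M^2 + sigma^2) / N k] and
    [mu^2 / 2 * Lf^2 * n (n + 2) (n + 4)]; both lie below the two terms of the stated bound. *)

Section euclidean_space.
Context {R : realType} {m : nat}.
Implicit Types (x y z v g : 'cV[R]_m) (a c t : R) (h : 'cV[R]_m -> R).

Lemma dotvC x y : dotv x y = dotv y x.
Proof. by apply: eq_bigr => i _; rewrite mulrC. Qed.

Lemma dotvDr x y z : dotv x (y + z) = dotv x y + dotv x z.
Proof. by rewrite -big_split; apply: eq_bigr => i _; rewrite !mxE mulrDr. Qed.

Lemma dotvZr a x y : dotv x (a *: y) = a * dotv x y.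
Proof. by rewrite mulr_sumr; apply: eq_bigr => i _; rewrite !mxE mulrCA. Qed.

Lemma dotvDl x y z : dotv (x + y) z = dotv x z + dotv y z.
Proof. by rewrite dotvC dotvDr !(dotvC z). Qed.

Lemma dotvZl a x y : dotv (a *: x) y = a * dotv x y.
Proof. by rewrite dotvC dotvZr dotvC. Qed.

Lemma dotvNr x y : dotv x (- y) = - dotv x y.
Proof. by rewrite -scaleN1r dotvZr mulN1r. Qed.

Lemma dotvNl x y : dotv (- x) y = - dotv x y.
Proof. by rewrite dotvC dotvNr dotvC. Qed.

Definition dotvE := (dotvDl, dotvDr, dotvNl, dotvNr, dotvZl, dotvZr).

Lemma dotv0r x : dotv x 0 = 0.
Proof. by rewrite -[0](scale0r 0) dotvZr mul0r. Qed.

Lemma dotv_ge0 x : 0 <= dotv x x.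
Proof. by apply: sumr_ge0 => i _; rewrite -expr2 sqr_ge0. Qed.

Lemma enorm_ge0 x : 0 <= enorm x. Proof. exact: sqrtr_ge0. Qed.

Lemma enorm_sqr x : enorm x ^+ 2 = dotv x x.
Proof. by rewrite sqr_sqrtr// dotv_ge0. Qed.

Lemma enormZ a x : enorm (a *: x) = `|a| * enorm x.
Proof. by rewrite /enorm dotvZl dotvZr mulrA -expr2 sqrtrM ?sqr_ge0// sqrtr_sqr. Qed.

Lemma enormN x : enorm (- x) = enorm x.
Proof. by rewrite /enorm dotvNl dotvNr opprK. Qed.

Lemma dotv_young c x y : 0 < c ->
  2 * dotv x y <= c * enorm x ^+ 2 + enorm y ^+ 2 / c.
Proof.
move=> c0; have := dotv_ge0 (c *: x - y).
rewrite !dotvE (dotvC y x) -!enorm_sqr -(ler_pM2r (x := c^-1)) ?invr_gt0// mul0r.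
rewrite -[in X in _ -> X]subr_ge0; congr (_ <= _); field.
by rewrite gt_eqF.
Qed.

Lemma enorm_sqrD_le x y :
  enorm (x + y) ^+ 2 <= 2 * enorm x ^+ 2 + 2 * enorm y ^+ 2.
Proof.
have := dotv_ge0 (x - y); rewrite !enorm_sqr !dotvE (dotvC y x); lra.
Qed.

Lemma ler_coord_enorm x i : `|x i ord0| <= enorm x.
Proof.
rewrite -sqrtr_sqr ler_sqrt ?dotv_ge0// /dotv (bigD1 i)//= -expr2 lerDl.
by apply: sumr_ge0 => j _; rewrite -expr2 sqr_ge0.
Qed.

Lemma enorm_eq0 x : enorm x = 0 -> x = 0.
Proof.
move=> x0; apply/matrixP => i j; rewrite ord1 mxE; apply/eqP.
by rewrite -normr_le0 -x0 ler_coord_enorm.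
Qed.

Lemma dotv_le_enorm x y : dotv x y <= enorm x * enorm y.
Proof.
have [/enorm_eq0 ->|x0] := eqVneq (enorm x) 0.
  by rewrite dotvC dotv0r mulr_ge0 ?enorm_ge0.
have [/enorm_eq0 ->|y0] := eqVneq (enorm y) 0.
  by rewrite dotv0r mulr_ge0 ?enorm_ge0.
have xp : 0 < enorm x by rewrite lt_neqAle eq_sym x0 enorm_ge0.
have yp : 0 < enorm y by rewrite lt_neqAle eq_sym y0 enorm_ge0.
rewrite -(ler_pM2l (x := 2)) ?ltr0n//.
apply: le_trans (dotv_young x y (divr_gt0 yp xp)) _.
by rewrite [leLHS](_ : _ = 2 * (enorm x * enorm y))//; field; rewrite x0 y0.
Qed.

Lemma enormD x y : enorm (x + y) <= enorm x + enorm y.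
Proof.
rewrite -(@ler_pXn2r _ 2) ?nnegrE ?addr_ge0 ?enorm_ge0//.
rewrite sqrrD !enorm_sqr !dotvE (dotvC y x).
by have := dotv_le_enorm x y; lra.
Qed.

Lemma enorm_le_coord x a : 0 <= a -> (forall i, `|x i ord0| <= a) ->
  enorm x <= m%:R * a.
Proof.
move=> a0 xa; rewrite -(@ler_pXn2r _ 2) ?nnegrE ?mulr_ge0 ?enorm_ge0//.
rewrite enorm_sqr (@le_trans _ _ (\sum_(i < m) a ^+ 2))//.
  by apply: ler_sum => i _; rewrite -expr2 -real_normK ?num_real// lerXn2r ?nnegrE.
rewrite sumr_const card_ord exprMn -[leLHS]mulr_natl ler_wpM2r ?sqr_ge0//.
by rewrite -natrX ler_nat; case: m => // k; rewrite leq_pmulr.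
Qed.

(** Balls of the topology are those of the maximum norm, so the Euclidean estimate is transferred by
    [enorm_le_coord]. The [+ 1] in the radius [d] keeps its denominator positive when [K] or [m] is
    0. *)
Lemma lipschitz_continuous h K :
  (forall x y, `|h x - h y| <= K * enorm (x - y)) -> continuous h.
Proof.
move=> hK x; apply/(@cvgrPdist_le _ _ _ (nbhs x)) => e e0.
set d := e / (`|K| * m%:R + 1).
have c0 : 0 < `|K| * m%:R + 1 by rewrite ltr_wpDl ?mulr_ge0.
have d0 : 0 < d by rewrite divr_gt0.
apply/nbhs_ballP; exists d => //= y [_ xy].
apply: (le_trans (hK _ _)); apply: (@le_trans _ _ (`|K| * (m%:R * d))).
  apply: le_trans (ler_wpM2r (enorm_ge0 _) (ler_norm K)) _.
  rewrite ler_wpM2l//.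
  apply: (enorm_le_coord (ltW d0)) => i; rewrite !mxE; exact/ltW/xy.
rewrite mulrA /d mulrCA ger_pMr// ler_pdivrMr// mul1r lerDl.
by rewrite ler01.
Qed.

Lemma dotv_continuous y : continuous (dotv y).
Proof.
apply: (@lipschitz_continuous _ (enorm y)) => x z.
rewrite -dotvNr -dotvDr ler_norml dotv_le_enorm andbT lerNl -dotvNl.
by rewrite -(enormN y) dotv_le_enorm.
Qed.

Lemma enorm_continuous : continuous (@enorm R m).
Proof.
apply: (@lipschitz_continuous _ 1) => x y; rewrite mul1r ler_distl.
have := enormD (x - y) y; have := enormD (y - x) x.
by rewrite !subrK -(opprB x y) enormN; lra.
Qed.

Lemma enorm_bound_sqr x a : 0 <= a -> enorm x ^+ 2 <= a * enorm x -> enorm x <= a.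
Proof.
move=> a0; have [->//|x0] := eqVneq (enorm x) 0.
by rewrite expr2 ler_pM2r// lt_neqAle eq_sym x0 enorm_ge0.
Qed.

Lemma mxE_sum_delta x : x = \sum_i x i ord0 *: delta_mx i ord0.
Proof.
rewrite [LHS]matrix_sum_delta; apply: eq_bigr => i _.
by rewrite big_ord_recl big_ord0 addr0.
Qed.

Lemma derive_grad h x v : differentiable h x -> 'D_v h x = dotv (grad h x) v.
Proof.
move=> dh; rewrite deriveE// {1}(mxE_sum_delta v) linear_sum.
apply: eq_bigr => i _; rewrite linearZ /grad mxE deriveE//.
by rewrite mulrC.
Qed.

Lemma is_derive_line h x v t : (forall y, differentiable h y) ->
  is_derive t 1 (fun s : R => h (x + s *: v)) (dotv (grad h (x + t *: v)) v).
Proof.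
move=> dh; have E : (fun r : R => r^-1 *: (h (x + (r *: (1 : R) + t) *: v)
    - h (x + t *: v))) = (fun r => r^-1 *: (h (r *: v + (x + t *: v))
    - h (x + t *: v))).
  by apply/funext => r; rewrite (_ : r *: 1 = r) ?scalerDl 1?addrCA//; exact: mulr1.
have := @diff_derivable _ _ _ _ (x + t *: v) v (dh (x + t *: v)).
rewrite -(derive_grad v (dh _)) /derivable /derive -E => d.
exact: DeriveDef d erefl.
Qed.

End euclidean_space.

Section differentiable_functions.
Context {R : realType} {m : nat}.
Implicit Types (x y v : 'cV[R]_m) (h : 'cV[R]_m -> R).

Lemma gradN h x : differentiable h x -> grad (fun z => - h z) x = - grad h x.
Proof.
move=> dh; apply/matrixP => i j; rewrite !mxE.
by rewrite deriveN//; exact: diff_derivable.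
Qed.

(** Dividing by [t] and letting [t] decrease to 0 removes the [B] term. This is the device that
    turns inequalities at convex combinations into first-order conditions, both for strong convexity
    and for proximal points. *)
Lemma le_dotv_grad h x v (A B : R) : differentiable h x ->
  (forall t, 0 < t -> t < 1 -> h (x + t *: v) - h x <= t * A + t ^+ 2 * B) ->
  dotv (grad h x) v <= A.
Proof.
move=> dh hle; rewrite -derive_grad//.
have c2 : (fun t : R => A + t * B) @ 0^'+ --> A.
  rewrite -[X in _ --> X]addr0 -[X in _ --> A + X](mul0r B).
  apply: cvg_at_right_filter; apply: cvgD; first exact: cvg_cst.
  by apply: cvgMl; exact: cvg_id.
have c1 : (fun t : R => t^-1 *: (h (t *: v + x) - h x)) @ 0^'+ --> 'D_v h x.
  by apply: cvg_dnbhs_at_right; exact: (@diff_derivable _ _ _ h x v dh).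
apply: (ler_cvg_to c1 c2).
near=> t; have t0 : 0 < t by near: t; exact: nbhs_right_gt.
rewrite (addrC _ x) -(ler_pM2l t0) mulVKf ?gt_eqF//.
apply: (le_trans (hle t t0 _)); first by near: t; exact: nbhs_right_lt.
by rewrite mulrDr expr2 mulrA.
Unshelve. all: by end_near.
Qed.

(** The difference [g] between [h] along the segment and its quadratic model has a nonpositive
    derivative, so no integral of the gradient is formed. Only the gradient increment along [v] is
    bounded, which suits global and blockwise Lipschitz constants alike. *)
Lemma le_taylor1 h x v (K : R) : (forall y, differentiable h y) ->
  (forall t, 0 <= t -> dotv (grad h (x + t *: v) - grad h x) v <= t * K) ->
  h (x + v) <= h x + dotv (grad h x) v + K / 2.
Proof.
move=> dh hK; set g := fun t : R => h (x + t *: v) -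
  (t * dotv (grad h x) v + t ^+ 2 * (K / 2)).
have dg (t : R) : is_derive t (1 : R) g (dotv (grad h (x + t *: v)) v -
    (dotv (grad h x) v + t * K)).
  have dl := is_derive_line x v t dh.
  apply: is_derive_eq.
  rewrite /GRing.scale/= !(mulr0,mulr1,addr0,mul0r,add0r).
  by lra.
have g01 : g 1 <= g 0.
  apply: (@ler0_derive1_nincr _ g 0 1) => //.
  - move=> t; rewrite in_itv/= => /andP[/ltW t0 _].
    rewrite derive1E derive_val.
    by have := hK t t0; rewrite dotvDl dotvNl; lra.
  - apply: continuous_subspaceT => t.
    by apply: differentiable_continuous; apply/derivable1_diffP.
move: g01; rewrite /g scale1r scale0r addr0 expr1n expr0n/= !mul0r mul1r; lra.
Qed.

Lemma ge_taylor1 h x v (K : R) : (forall y, differentiable h y) ->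
  (forall t, 0 <= t -> - dotv (grad h (x + t *: v) - grad h x) v <= t * K) ->
  h x + dotv (grad h x) v - K / 2 <= h (x + v).
Proof.
move=> dh hK; have := @le_taylor1 (fun z => - h z) x v K.
rewrite gradN// dotvNl => H.
suff : - h (x + v) <= - h x + - dotv (grad h x) v + K / 2 by lra.
apply: H => [y|t t0]; first exact: differentiableN.
by rewrite !gradN// -opprD dotvNl; exact: hK.
Qed.

(** In the defect [t * (1 - t) / 2 * enorm (y - x) ^+ 2], the part of order [t] lowers the slope and
    the part of order [t ^+ 2] is the harmless [B] of [le_dotv_grad]. *)
Lemma strongly_convex1_above_tangent h x y : strongly_convex1 h ->
  differentiable h x ->
  h x + dotv (grad h x) (y - x) + enorm (y - x) ^+ 2 / 2 <= h y.
Proof.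
move=> sc dh; have := @le_dotv_grad h x (y - x) (h y - h x - enorm (y - x) ^+ 2 / 2)
  (enorm (y - x) ^+ 2 / 2) dh.
suff H : forall t, 0 < t -> t < 1 -> h (x + t *: (y - x)) - h x <=
    t * (h y - h x - enorm (y - x) ^+ 2 / 2) + t ^+ 2 * (enorm (y - x) ^+ 2 / 2).
  by move=> /(_ H); lra.
move=> t t0 t1; have t01 : 0 <= t <= 1 by rewrite !ltW.
have := sc y x t t01.
have -> : t *: y + (1 - t) *: x = x + t *: (y - x).
  by rewrite scalerBl scale1r scalerBr addrCA.
set e := enorm _ ^+ 2; nra.
Qed.

Lemma strongly_convex1_monotone h x y : strongly_convex1 h ->
  (forall z, differentiable h z) ->
  enorm (y - x) ^+ 2 <= dotv (grad h y - grad h x) (y - x).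
Proof.
move=> sc dh.
have := strongly_convex1_above_tangent y sc (dh x).
have := strongly_convex1_above_tangent x sc (dh y).
rewrite -(opprB y x) dotvNr enormN dotvDl dotvNl; lra.
Qed.

End differentiable_functions.

(** * Proximal points and the conditional gradient procedure *)

Section weierstrass.
Context {R : realType}.

(** The sets of points of [K] where [h] is at most [h z], for [z] in [K], have the finite
    intersection property: among finitely many [z], the one with the smallest value lies in all of
    them. A point common to all these sets is a minimizer. *)
Lemma lower_semicontinuous_compact_min (T : ptopologicalType) (K : set T)
    (h : T -> R) : compact K -> K !=set0 ->
  (forall c, closed [set y | h y <= c]) ->
  exists2 y, K y & forall z, K z -> h y <= h z.
Proof.
rewrite compact_In0 => cK [x0 Kx0] ch.
have [|D DK|y yP] := cK T K (fun z => K `&` [set y | h y <= h z]).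
- by exists (fun z => [set y | h y <= h z]).
- have [[i iD]|Dn] := pselect (exists i, i \in D); last first.
    by exists x0 => j /= jD; case: Dn; exists j.
  pose i0 : D := FSetSub iD.
  have [j _ jmin] := @Order.TotalTheory.arg_minP _ _ D i0 xpredT (h \o val) isT.
  exists (val j) => k /= kD; split; first by apply/set_mem/DK; exact: fsvalP.
  exact: (jmin (FSetSub kD) isT).
- by exists y => [|z Kz]; [case: (yP x0 Kx0)|case: (yP z Kz)].
Qed.

Lemma trmx_continuous m n : continuous (@trmx R m n).
Proof.
move=> M s /= /nbhs_ballP[e e0 es]; apply/nbhs_ballP; exists e => //= N [_ MN].
by apply: es; split=> // i j; rewrite !mxE.
Qed.

(** [A] is the continuous image under transposition of a closed bounded set of row vectors, for
    which compactness is known. *)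
Lemma cV_bounded_closed_compact m (A : set 'cV[R]_m) x r :
  closed A -> (forall y, A y -> enorm (y - x) <= r) -> compact A.
Proof.
move=> cA Ar; set B := @trmx R 1 m @^-1` A.
have -> : A = @trmx R 1 m @` B.
  apply/seteqP; split => [y Ay|_ [y By <-]//]; exists y^T; rewrite ?trmxK//.
  by rewrite /B /= trmxK.
apply: continuous_compact; first by apply: continuous_subspaceT; exact: trmx_continuous.
apply: bounded_closed_compact; last first.
  by apply: preimage_closed => // y _; exact: trmx_continuous.
exists (r + enorm x); split; first exact: num_real.
move=> M rM y By /=; rewrite [leLHS]/Num.Def.normr/= mx_normrE; apply/bigmax_leP; split.
  by apply: le_trans (ltW rM); rewrite addr_ge0 ?enorm_ge0// (le_trans _ (Ar _ By))// enorm_ge0.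
move=> [i j] _ /=; apply: le_trans (ltW rM); rewrite (ord1 i).
have -> : y ord0 j = (y^T - x) j ord0 + x j ord0 by rewrite !mxE subrK.
by rewrite (le_trans (ler_normD _ _))// lerD// (le_trans (ler_coord_enorm _ _))// Ar.
Qed.

End weierstrass.

Section convexity.
Context {R : realType} {m : nat}.
Implicit Types (x y : 'cV[R]_m) (A : set 'cV[R]_m) (h : 'cV[R]_m -> R) (t : R).

Lemma convex_setP A x y t : convex_set (M := 'cV[R]_m) A -> A x -> A y ->
  0 <= t <= 1 -> A (t *: x + (1 - t) *: y).
Proof.
move=> cA Ax Ay /andP[t0 t1].
by have := cA x y (Itv01 t0 t1) (mem_set Ax) (mem_set Ay); rewrite inE.
Qed.

Lemma convex_functionP h x y t : convex_function (E := 'cV[R]_m) setT h ->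
  0 <= t <= 1 -> h (t *: x + (1 - t) *: y) <= t * h x + (1 - t) * h y.
Proof.
move=> ch /andP[t0 t1].
exact: (ch (Itv01 t0 t1) x y (in_setT _) (in_setT _)).
Qed.

(** The sublevel set is the preimage of the epigraph under the continuous map
    [y |-> (y, c - q y)]. *)
Lemma closed_epigraph_sublevel h (q : 'cV[R]_m -> R) c :
  closed [set z : 'cV[R]_m * R | h z.1 <= z.2] -> continuous q ->
  closed [set y | q y + h y <= c].
Proof.
move=> ch cq; pose k y := (y, c - q y).
have -> : [set y | q y + h y <= c] = k @^-1` [set z | h z.1 <= z.2].
  by apply/seteqP; split => y /=; rewrite lerBrDl.
have ccq : continuous (fun y => c - q y).
  by move=> y; apply: continuousB; [exact: cst_continuous|exact: cq].
apply: preimage_closed => // y _; apply: (@cvg_pair _ _ _ _ (nbhs y) (nbhs (c - q y))); first exact: nbhs_filter.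
  exact: cvg_id.
exact: ccq.
Qed.

End convexity.

Section proximal_map.
Context {R : realType} {m : nat}.
Variables (X : set 'cV[R]_m) (phi chi : 'cV[R]_m -> R).
Hypotheses (closedX : closed X) (convexX : convex_set (M := 'cV[R]_m) X).
Hypothesis chiP : closed_convex_function chi.
Hypotheses (dphi : forall y, differentiable phi y) (scphi : strongly_convex1 phi).
Implicit Types (x y z g : 'cV[R]_m) (alpha : R).

Let obj x g alpha y := dotv g y + alpha^-1 * bregman phi y x + chi y.

(** By [xgetPex] some minimizer suffices. Two compact minimizations give one: the minimum over the
    unit ball around a feasible [x0] yields, through strong convexity, a radius [rho] beyond which
    the objective is at least its value at [x0]; the minimum over the ball of radius [rho] is then
    global. *)
Lemma prox_minimizer x g alpha : X !=set0 -> 0 < alpha ->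
  minimizer X (obj x g alpha) (prox X phi chi x g alpha).
Proof.
move=> [x0 Xx0] a0; apply: xgetPex.
have objsl c : closed [set y | obj x g alpha y <= c].
  apply: (closed_epigraph_sublevel chiP.1) => y; apply: continuousD.
    exact: dotv_continuous.
  apply: continuousM; first exact: cst_continuous.
  apply: continuousB; last first.
    apply: continuous_comp; last exact: dotv_continuous.
    by apply: continuousB; [exact: cvg_id|exact: cst_continuous].
  apply: continuousB; last exact: cst_continuous.
  exact: differentiable_continuous.
have objsc y z t : 0 <= t <= 1 ->
    obj x g alpha (t *: y + (1 - t) *: z) <=
    t * obj x g alpha y + (1 - t) * obj x g alpha z
    - alpha^-1 * (t * (1 - t) / 2 * enorm (y - z) ^+ 2).
  move=> t01; have ai : 0 <= alpha^-1 by rewrite invr_ge0 ltW.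
  have := ler_wpM2l ai (scphi y z t01).
  have := convex_functionP y z chiP.2 t01.
  rewrite /obj /bregman.
  rewrite !(dotvDr, dotvZr, dotvNr); move: (alpha^-1) => a; lra.
pose K r := X `&` [set y | enorm (y - x0) <= r].
have compK r : compact (K r).
  apply: (@cV_bounded_closed_compact _ _ _ x0 r) => [|y []//].
  apply: closedI => //; apply: (@preimage_closed _ _ (fun y => enorm (y - x0)) [set s | s <= r]).
    move=> z _; apply: (@continuous_comp _ _ _ (fun y => y - x0)).
      by apply: continuousB; [exact: cvg_id|exact: cst_continuous].
    exact: enorm_continuous.
  exact: closed_le.
have K1x0 : K 1 x0 by split=> //=; rewrite subrr /enorm dotv0r sqrtr0.
have [y1 Ky1 miny1] := lower_semicontinuous_compact_min (compK 1)
  (ex_intro _ x0 K1x0) objsl.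
set E0 := obj x g alpha x0 - obj x g alpha y1.
have E0ge0 : 0 <= E0 by rewrite subr_ge0; exact: miny1.
(* For [r >= rho] one has [E0 <= (r - 1) / (2 * alpha)]: the quadratic growth beats the largest
   decrease seen on the unit ball. *)
set rho := 1 + 2 * alpha * E0.
have rho1 : 1 <= rho by rewrite lerDl !mulr_ge0// ltW.
have Krx0 : K rho x0.
  by split=> //=; rewrite subrr /enorm dotv0r sqrtr0 (le_trans ler01).
have [y2 Ky2 miny2] := lower_semicontinuous_compact_min (compK rho)
  (ex_intro _ x0 Krx0) objsl.
exists y2; split=> [|z Xz]; first by case: Ky2.
have [zr|rz] := leP (enorm (z - x0)) rho; first by apply: miny2; split.
apply: (le_trans (miny2 _ Krx0)).
set r := enorm (z - x0) in rz.
have r1 : 1 < r by exact: le_lt_trans rz.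
have r0 : 0 < r by exact: lt_trans r1.
have t01 : 0 <= r^-1 <= 1 by rewrite invr_ge0 ltW//= invf_le1// ltW.
(* The distant point [z] is pulled back along the segment to distance 1 from [x0], where [y1] is a
   known lower bound; multiplying the resulting inequality by [r] isolates the value at [z]. *)
have /miny1 : K 1 (r^-1 *: z + (1 - r^-1) *: x0).
  split; first exact: convex_setP.
  rewrite /= (_ : _ - x0 = r^-1 *: (z - x0)).
    by rewrite enormZ gtr0_norm ?invr_gt0// mulVf// gt_eqF.
  by rewrite scalerBl scale1r scalerBr addrCA addrAC subrr add0r.
move=> /le_trans/(_ (objsc _ _ _ t01))/(ler_wpM2l (ltW r0)).
rewrite -/r; set c := alpha^-1 * _; set Cz := obj x g alpha z.
set C0 := obj x g alpha x0; set C1 := obj x g alpha y1.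
have -> : r * (r^-1 * Cz + (1 - r^-1) * C0 - c) =
    Cz + (r - 1) * C0 - alpha^-1 * (r - 1) / 2 * r.
  by rewrite /c; field; rewrite !gt_eqF.
have : r * E0 <= alpha^-1 * (r - 1) / 2 * r.
  rewrite mulrC ler_pM2r// -(ler_pM2l (x := 2 * alpha)) ?mulr_gt0//.
  rewrite [leRHS](_ : _ = r - 1); last by field; rewrite gt_eqF.
  by rewrite lerBrDl ltW.
rewrite -[X in _ -> _ -> _ <= X]/Cz /E0 -/C0 -/C1; lra.
Qed.

(** Minimality is compared with [y + t *: (z - y)], convexity of [chi] absorbs the nonsmooth part,
    and [le_dotv_grad] is applied to [- phi]. The conclusion uses the gap of the conditional
    gradient procedure, so that exact and approximate optimality can be added. *)
Lemma prox_variational x g alpha y z : 0 < alpha ->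
  minimizer X (obj x g alpha) y -> X z ->
  0 <= cndG_gap phi chi x g alpha y z.
Proof.
move=> a0 [Xy ymin] Xz; rewrite /cndG_gap.
set A := alpha * (dotv g (z - y) + chi z - chi y) - dotv (grad phi x) (z - y).
have : - dotv (grad phi y) (z - y) <= A.
  rewrite -dotvNl -gradN//; apply: (@le_dotv_grad _ _ _ _ _ A 0).
    exact: differentiableN.
  move=> t t0 t1; have t01 : 0 <= t <= 1 by rewrite !ltW.
  have E : t *: z + (1 - t) *: y = y + t *: (z - y).
    by rewrite scalerBl scale1r scalerBr addrCA.
  have := ymin _ (convex_setP convexX Xz Xy t01).
  have := convex_functionP z y chiP.2 t01.
  rewrite E /obj /bregman mulr0 addr0 /A => cle.
  rewrite !(dotvDr, dotvNr, dotvZr) -(ler_pM2l a0) !(mulrDr alpha).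
  by rewrite !mulVKf ?gt_eqF//; move: (ler_wpM2l (ltW a0) cle) => c1 c2; lra.
have ai : 0 <= alpha^-1 by rewrite invr_ge0 ltW.
move=> /(ler_wpM2l ai); rewrite /A (mulrBr alpha^-1) mulKf ?gt_eqF// => H.
by rewrite dotvDl dotvZl dotvDl dotvNl; lra.
Qed.

End proximal_map.

Section proximal_step.
Context {R : realType} {m : nat}.
Variables (X : set 'cV[R]_m) (phi chi : 'cV[R]_m -> R).
Hypotheses (closedX : closed X) (convexX : convex_set (M := 'cV[R]_m) X).
Hypothesis chiP : closed_convex_function chi.
Hypotheses (dphi : forall y, differentiable phi y) (scphi : strongly_convex1 phi).
Implicit Types (x y z g c : 'cV[R]_m) (alpha delta : R).

(** The two variational inequalities are tested at each other's solution and added; strong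
    monotonicity of [grad phi] bounds the result from below and Cauchy-Schwarz from above. It serves
    the measurability of the proximal map. *)
Lemma prox_lipschitz x g x' g' alpha : X !=set0 -> 0 < alpha ->
  enorm (prox X phi chi x g alpha - prox X phi chi x' g' alpha) <=
  alpha * enorm ((g - alpha^-1 *: grad phi x) - (g' - alpha^-1 *: grad phi x')).
Proof.
move=> X0 a0; have ai : 0 < alpha^-1 by rewrite invr_gt0.
have ymin := prox_minimizer closedX convexX chiP dphi scphi x g X0 a0.
have y'min := prox_minimizer closedX convexX chiP dphi scphi x' g' X0 a0.
have := prox_variational convexX chiP dphi a0 ymin y'min.1.
have := prox_variational convexX chiP dphi a0 y'min ymin.1.
move: (prox _ _ _ x g _) (prox _ _ _ x' g' _) => y y'.
set c := g - _; set c' := g' - _; rewrite /cndG_gap => V1 V2.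
apply: enorm_bound_sqr; first by rewrite mulr_ge0 ?enorm_ge0 ?ltW.
have := strongly_convex1_monotone y' y scphi dphi.
move=> /(ler_wpM2l (ltW ai)) mon.
rewrite -(ler_pM2l ai) -mulrA mulKf ?gt_eqF// (le_trans mon)//.
rewrite -(opprB c' c) enormN; apply: (le_trans _ (dotv_le_enorm _ _)).
move: V1 V2; rewrite /c /c' => {mon c c'}.
move: (grad phi x) (grad phi x') (grad phi y) (grad phi y') => p p' q q'.
by rewrite !(dotvDl, dotvDr, dotvNl, dotvNr, dotvZl); lra.
Qed.

(** On exit the test at the minimizer [v] bounds the gap at every feasible point; feasibility is
    preserved because every update is a convex combination. *)
Lemma cndG_loopP x g alpha delta t u y : (0 < t)%N -> X u ->
  cndG_loop X phi chi x g alpha delta t u y ->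
  X y /\ forall z, X z -> - delta <= cndG_gap phi chi x g alpha y z.
Proof.
move=> t0 Xu H; elim: H t0 Xu => [{}t {}u v [Xv vmin] vd t0 Xu|
    {}t {}u v {}y [Xv vmin] vd _ IH t0 Xu].
  by split=> // z Xz; rewrite (le_trans vd)// vmin.
apply: IH => //.
(* The rewriting gives the shape of [convex_setP]; the weight [a] is at most 1 because the loop is
   entered at [t >= 1]. *)
set a : R := 2 / t.+1%:R; have -> : a *: v = (1 - (1 - a)) *: v.
  by rewrite subKr.
apply: convex_setP => //; rewrite subr_ge0 lerBlDr lerDl /a.
by rewrite divr_ge0// andbT ler_pdivrMr// mul1r ler_nat ltnS.
Qed.

(** The gap of [y] is tested at the exact proximal point [z] and at the old point [x]. Of the
    [6 * delta], 2 come from the test at [x] (doubled) and 4 from the distance between [y] and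
    [z]. *)
Lemma cndG_descent (L f0 f1 : R) x gf g y alpha delta : X x ->
  0 < L -> 0 < alpha -> alpha <= 1 / L -> 0 <= delta ->
  cndG X phi chi x g alpha delta y ->
  f1 <= f0 + dotv gf (y - x) + L / 2 * enorm (y - x) ^+ 2 ->
  2 * (f1 + chi y) + alpha * (1 - L * alpha) *
    enorm (alpha^-1 *: (x - prox X phi chi x gf alpha)) ^+ 2 <=
  2 * (f0 + chi x) + 6 * delta + (1 / L + 4 * alpha) * enorm (g - gf) ^+ 2.
Proof.
move=> Xx L0 a0 aL d0 /(cndG_loopP (ltn0Sn _) Xx)[Xy gapy] f01.
have ai : 0 < alpha^-1 by rewrite invr_gt0.
have zmin := prox_minimizer closedX convexX chiP dphi scphi x gf (ex_intro _ x Xx) a0.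
have := prox_variational convexX chiP dphi a0 zmin Xy.
move: zmin; move: (prox _ _ _ x gf _) => z [Xz _] V2.
have V1 := gapy _ Xz; have V0 := gapy _ Xx.
have m1 := strongly_convex1_monotone x y scphi dphi.
have m2 := strongly_convex1_monotone z y scphi dphi.
set D := enorm (g - gf) ^+ 2.
have Lal : 0 <= 1 - L * alpha by rewrite subr_ge0 mulrC -ler_pdivlMr.
have D0 : 0 <= D by rewrite sqr_ge0.
set a := alpha^-1 in ai V0 V1 V2 *.
have aal : alpha * a = 1 by rewrite mulfV ?gt_eqF.
(* Adding the inequalities of [y] and [z] cancels [chi]; Young with weight [alpha] gives back half
   of the left-hand side, hence the factor 2 on [delta]. *)
have e2 : a * enorm (y - z) ^+ 2 <= 2 * delta + alpha * D.
  have := dotv_young (g - gf) (z - y) a0.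
  rewrite -(opprB y z) enormN -/D -/a => yng.
  have := ler_wpM2l (ltW ai) m2; move: V1 V2 yng.
  rewrite /cndG_gap -/a; move: (grad phi x) (grad phi y) (grad phi z) => p q q'.
  by rewrite !(dotvDl, dotvDr, dotvNl, dotvNr, dotvZl); lra.
have xz : enorm (x - z) ^+ 2 <= 2 * enorm (y - x) ^+ 2 + 2 * enorm (y - z) ^+ 2.
  by rewrite -(enormN (y - x)) opprB -{1}(subrK y x) -addrA enorm_sqrD_le.
(* The Young weight [1 / L] matches the quadratic term of the descent inequality, so that together
   they contribute [2 * L * enorm (y - x) ^+ 2]. *)
have yd : - 2 * dotv (g - gf) (y - x) <= L * enorm (y - x) ^+ 2 + D / L.
  have Li : 0 < L^-1 by rewrite invr_gt0.
  have := dotv_young (- (g - gf)) (y - x) Li.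
  by rewrite dotvNl enormN invrK -/D; lra.
have chid : chi y <= chi x + delta - dotv g (y - x) - a * enorm (y - x) ^+ 2.
  have := ler_wpM2l (ltW ai) m1; move: V0.
  by rewrite /cndG_gap -/a !(dotvDl, dotvDr, dotvNl, dotvNr, dotvZl); lra.
rewrite enormZ exprMn gtr0_norm//.
have -> : alpha * (1 - L * alpha) * (a ^+ 2 * enorm (x - z) ^+ 2) =
    (a - L) * enorm (x - z) ^+ 2.
  by rewrite /a; field; rewrite gt_eqF.
have aL0 : 0 <= a - L.
  have -> : a - L = a * (1 - L * alpha) by rewrite /a; field; rewrite gt_eqF.
  by rewrite mulr_ge0// ltW.
have := ler_wpM2l aL0 xz.
(* This term is dropped from [2 * (a - L) * enorm (y - z) ^+ 2]. The next one raises the coefficient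
   [2 * alpha] of [D] produced by [e2] to the stated [4 * alpha]. *)
have : L * enorm (y - z) ^+ 2 >= 0 by rewrite mulr_ge0 ?sqr_ge0 ?ltW.
have : alpha * D >= 0 by rewrite mulr_ge0// ltW.
have dgf : dotv (g - gf) (y - x) = dotv g (y - x) - dotv gf (y - x).
  by rewrite dotvDl dotvNl.
move: e2 yd chid f01; rewrite dgf div1r (mulrC D).
move: (enorm (y - z) ^+ 2) (enorm (y - x) ^+ 2) (enorm (x - z) ^+ 2) => e d c.
move: (dotv g _) (dotv gf _) (L^-1) => dg df Li; lra.
Qed.

End proximal_step.

(** * Block decomposition of vectors and of the separable term *)

Section block_coordinates.
Context {R : realType} {b : nat} (n_ : 'I_b.+1 -> nat).
Local Notation n := (\sum_s n_ s)%N.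
Implicit Types (x y v : 'cV[R]_n) (s i : 'I_b.+1).

Lemma blkD s x y : blk s (x + y) = blk s x + blk s y.
Proof. exact: mulmxDr. Qed.

Lemma blkN s x : blk s (- x) = - blk s x.
Proof. exact: mulmxN. Qed.

Lemma blkE s x : blk s x = submxcol x s.
Proof. by rewrite /blk /Ublk tr_submxrow trmx1 submxcol_mul mul1mx. Qed.

Lemma blk_mxcol s (v_ : forall s, 'cV[R]_(n_ s)) : blk s (\mxcol_s v_ s) = v_ s.
Proof. by rewrite blkE mxcolK. Qed.

Lemma dotvE_mul m (x y : 'cV[R]_m) : dotv x y = (x^T *m y) ord0 ord0.
Proof. by rewrite !mxE; apply: eq_bigr => i _; rewrite !mxE. Qed.

Lemma dotv_Ublk x s h : dotv x (Ublk s *m h) = dotv (blk s x) h.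
Proof. by rewrite !dotvE_mul /blk trmx_mul trmxK mulmxA. Qed.

Lemma sum_Ublk_blk x : x = \sum_s Ublk s *m blk s x.
Proof.
rewrite -[LHS]mul1mx -[X in X *m _](submxrowK (1%:M : 'M[R]_n)).
rewrite -[X in _ *m X]submxcolK mul_mxrow_mxcol.
by apply: eq_bigr => s _; rewrite blkE.
Qed.

Lemma dotv_blk x y : dotv x y = \sum_s dotv (blk s x) (blk s y).
Proof.
rewrite {1}(sum_Ublk_blk y); under [RHS]eq_bigr do rewrite -dotv_Ublk.
by rewrite (big_morph _ (dotvDr x) (dotv0r x)).
Qed.

Lemma enorm_blk x : enorm x ^+ 2 = \sum_s enorm (blk s x) ^+ 2.
Proof. by rewrite enorm_sqr dotv_blk; apply: eq_bigr => s _; rewrite enorm_sqr. Qed.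

Lemma blk_update i x y : (forall s, s != i -> blk s y = blk s x) ->
  y = x + Ublk i *m (blk i y - blk i x).
Proof.
move=> yx; apply/eqP; rewrite addrC -subr_eq; apply/eqP.
rewrite [LHS]sum_Ublk_blk [LHS](bigD1 i)//= blkD blkN [X in _ + X]big1 ?addr0// => s si.
by rewrite blkD blkN yx// subrr mulmx0.
Qed.

Lemma sum_blk_update (chi : forall s, 'cV[R]_(n_ s) -> R) i x y :
  (forall s, s != i -> blk s y = blk s x) ->
  sum_blk chi y - sum_blk chi x = chi i (blk i y) - chi i (blk i x).
Proof.
move=> yx; rewrite /sum_blk [X in X - _](bigD1 i)//= [X in _ - X](bigD1 i)//=.
rewrite (eq_bigr (fun s => chi s (blk s x))) => [|s si]; last by rewrite yx.
by rewrite opprD addrACA subrr addr0.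
Qed.

End block_coordinates.

(** * Independence and expectations *)

Section independence.
Context {R : realType} {d : measure_display} {Omega : measurableType d}.
Variable P : probability Omega R.
Local Open Scope ereal_scope.
Implicit Types (A B : set Omega) (S : set (set Omega)).

Definition independent S1 S2 := forall A B, <<s S1 >> A -> <<s S2 >> B ->
  P (A `&` B) = P A * P B.

Lemma independent_sub S1 S2 S1' S2' : S1' `<=` <<s S1 >> -> S2' `<=` <<s S2 >> ->
  independent S1 S2 -> independent S1' S2'.
Proof.
move=> s1 s2 iS A B SA SB; apply: iS.
  by apply: (smallest_sub _ s1) SA; exact: smallest_sigma_algebra.
by apply: (smallest_sub _ s2) SB; exact: smallest_sigma_algebra.
Qed.

Lemma g_sigma_algebra_measurable S : S `<=` measurable -> <<s S >> `<=` measurable.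
Proof. by apply: smallest_sub; exact: sigma_algebra_measurable. Qed.

(** For fixed [B], both sides are finite measures in [A] (the restriction of [P] to [B] and a
    multiple of [P]), so agreement on a pi-system extends to the generated sigma-algebra. *)
Lemma pi_system_independent_l S B : S `<=` measurable -> setI_closed S -> S setT ->
  measurable B -> (forall A, S A -> P (A `&` B) = P A * P B) ->
  forall A, <<s S >> A -> P (A `&` B) = P A * P B.
Proof.
move=> Sm SI ST mB SB A SA.
have PB0 : (0 <= fine (P B))%R by exact: fine_ge0.
pose m2 := mscale (NngNum PB0) P.
have m2E C : P C * P B = m2 C.
  by rewrite /m2 /mscale/= fineK ?fin_num_measure// muleC.
rewrite m2E.
apply: (g_sigma_algebra_measure_unique S Sm (fun=> setT) _ _ (mrestr P mB) m2) => //.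
- by rewrite bigcup_const//; exists 0%N.
- by move=> C SC; exact: etrans (SB C SC) (m2E C).
- move=> k; apply: (@le_lt_trans _ _ 1); last exact: ltry.
  by apply: probability_le1; exact: measurableI.
Qed.

Lemma pi_system_independent S1 S2 : S1 `<=` measurable -> S2 `<=` measurable ->
  setI_closed S1 -> setI_closed S2 -> S1 setT -> S2 setT ->
  (forall A B, S1 A -> S2 B -> P (A `&` B) = P A * P B) -> independent S1 S2.
Proof.
move=> m1 m2 I1 I2 T1 T2 S12 A B SA SB.
have mA := g_sigma_algebra_measurable m1 SA.
rewrite setIC muleC; apply: (pi_system_independent_l m2) => // C SC.
rewrite setIC muleC; apply: (pi_system_independent_l m1) => //.
  exact: m2.
by move=> E SE; exact: S12.
Qed.

(** The grouping principle: finite intersections of events from the members of a group form a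
    pi-system generating the sigma-algebra of the group, and on two such pi-systems the product
    formula is the hypothesis. *)
Lemma mutually_independent_groups (I : choiceType) (D D1 D2 : set I)
    (G : I -> set (set Omega)) :
  mutually_independent P D G -> (forall j, D j -> sigma_algebra setT (G j)) ->
  (forall j, D j -> G j `<=` measurable) ->
  D1 `<=` D -> D2 `<=` D -> D1 `&` D2 = set0 ->
  independent (\bigcup_(j in D1) G j) (\bigcup_(j in D2) G j).
Proof.
move=> ind sG mG D1D D2D D12.
pose cyl (D' : set I) := [set A | exists (J : {fset I}) (E : I -> set Omega),
  [/\ [set` J] `<=` D', forall j, j \in J -> G j (E j) &
      A = \bigcap_(j in [set` J]) E j]].
have cylG (D' : set I) : D' `<=` D -> \bigcup_(j in D') G j `<=` <<s cyl D' >>.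
  move=> D'D A [j D'j GA]; apply: sub_sigma_algebra.
  exists [fset j]%fset, (fun=> A); split.
  - by move=> k /=; rewrite inE => /eqP ->.
  - by move=> k; rewrite inE => /eqP ->.
  - by apply/seteqP; split => [w Aw k|w /(_ j)]//=; apply; rewrite /= inE.
have cylm (D' : set I) : D' `<=` D -> cyl D' `<=` measurable.
  move=> D'D _ [J [E [JD' GE ->]]].
  apply: fin_bigcap_measurable => // j jJ.
  exact: (mG _ (D'D _ (JD' _ jJ))) (GE _ jJ).
have cylT (D' : set I) : cyl D' setT.
  exists fset0, (fun=> setT); split => //.
  by apply/seteqP; split.
have cylI (D' : set I) : D' `<=` D -> setI_closed (cyl D').
  move=> D'D _ _ [J [E [JD' GE ->]]] [K [F [KD' GF ->]]].
  (* Padding with [setT] lets both families be indexed by the union of [J] and [K]. *)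
  pose H j := (if j \in J then E j else setT) `&` (if j \in K then F j else setT).
  exists (J `|` K)%fset, H; split.
  - by move=> j /=; rewrite inE => /orP[/JD'|/KD'].
  - move=> j; rewrite inE => JKj.
    have Dj : D j by case/orP: JKj => [/JD'|/KD'] /D'D.
    have sGj := sG _ Dj.
    have GT : G j setT by case: sGj => G0 GC _; rewrite -setC0 -setTD; exact: GC.
    have GI : setI_closed (G j).
      move=> A B; rewrite -(measurable_g_measurableTypeE sGj).
      exact: measurableI.
    by apply: GI; case: ifPn => // ?; [exact: GE|exact: GF].
  - apply/seteqP; split => [w [Ew Fw] j _|w Hw].
      by split; case: ifPn => // ?; [exact: Ew|exact: Fw].
    split => j /= jJ.
      by have := Hw j; rewrite /= inE jJ /H jJ => /(_ isT)[].
    by have := Hw j; rewrite /= inE jJ orbT /H jJ => /(_ isT)[].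
apply: (@independent_sub (cyl D1) (cyl D2)); [exact: cylG|exact: cylG|].
apply: pi_system_independent; do ?[exact: cylm|exact: cylI|exact: cylT].
move=> _ _ [J [E [JD1 GE ->]]] [K [F [KD2 GF ->]]].
have dJK j : j \in J -> j \notin K.
  move=> jJ; apply/negP => jK.
  by have : (D1 `&` D2) j by [split; [exact: JD1|exact: KD2]]; rewrite D12.
(* As [J] and [K] are disjoint, the two families glue into one, to which mutual independence applies
   once. *)
pose H j := if j \in J then E j else F j.
have HF j : j \in K -> H j = F j.
  by move=> jK; rewrite /H; case: ifPn => // /dJK; rewrite jK.
have -> : \bigcap_(j in [set` J]) E j `&` \bigcap_(j in [set` K]) F j =
    \bigcap_(j in [set` (J `|` K)%fset]) H j.
  apply/seteqP; split => [w [Ew Fw] j|w Hw].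
    rewrite /= inE /H; case: ifPn => [jJ _|_ /= jK]; [exact: Ew|exact: Fw].
  split => j /= jJ.
    by have := Hw j; rewrite /= inE /H jJ => /(_ isT).
  by have := Hw j; rewrite /= inE HF// jJ orbT => /(_ isT).
rewrite ind => [|j /=|j]; last 2 first.
- by rewrite inE => /orP[/JD1/D1D|/KD2/D2D].
- by rewrite inE /H; case: ifPn => [jJ _|_ /=]; [exact: GE|exact: GF].
rewrite (perm_big (J ++ K)) ?big_cat/=; last first.
  apply: uniq_perm => [||j]; rewrite ?fset_uniq ?mem_cat ?inE//.
  rewrite cat_uniq !fset_uniq andbT/=; apply/hasPn => j jK.
  by apply/negP => /dJK; rewrite jK.
rewrite !ind//; do ?[by move=> j /JD1/D1D|by move=> j /KD2/D2D].
congr (_ * _).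
  by apply: eq_big_seq => j jJ; rewrite /H jJ.
by apply: eq_big_seq => j jK; rewrite HF.
Qed.

End independence.

Section independent_fubini.
Context {R : realType} {d : measure_display} {Omega : measurableType d}.
Variable P : probability Omega R.
Local Open Scope ereal_scope.

Lemma measurable_g_sigma_algebraType (S : set (set Omega)) d' (T : measurableType d')
    (f : Omega -> T) : S `<=` measurable ->
  measurable_fun setT (f : g_sigma_algebraType S -> T) -> measurable_fun setT f.
Proof.
move=> Sm mf _ A mA; apply: (g_sigma_algebra_measurable Sm).
exact: mf.
Qed.

Definition independent_fun d1 d2 (T1 : measurableType d1) (T2 : measurableType d2)
    (Y : Omega -> T1) (Z : Omega -> T2) := forall A B, measurable A -> measurable B ->
  P (Y @^-1` A `&` Z @^-1` B) = P (Y @^-1` A) * P (Z @^-1` B).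

Lemma independent_fun_sigma (S1 S2 : set (set Omega)) d1 d2
    (T1 : measurableType d1) (T2 : measurableType d2)
    (Y : Omega -> T1) (Z : Omega -> T2) : independent P S1 S2 ->
  measurable_fun setT (Y : g_sigma_algebraType S1 -> T1) ->
  measurable_fun setT (Z : g_sigma_algebraType S2 -> T2) ->
  independent_fun Y Z.
Proof.
move=> iS mY mZ A B mA mB; apply: iS; rewrite -(setTI (_ @^-1` _)).
  exact: mY.
exact: mZ.
Qed.

Lemma independent_fun_comp d1 d2 d1' d2' (T1 : measurableType d1)
    (T2 : measurableType d2) (T1' : measurableType d1') (T2' : measurableType d2')
    (Y : Omega -> T1) (Z : Omega -> T2) (f : T1 -> T1') (g : T2 -> T2') :
  measurable_fun setT f -> measurable_fun setT g -> independent_fun Y Z ->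
  independent_fun (f \o Y) (g \o Z).
Proof.
move=> mf mg YZ A B mA mB; apply: (YZ (f @^-1` A) (g @^-1` B)).
  by rewrite -(setTI (_ @^-1` _)); exact: mf.
by rewrite -(setTI (_ @^-1` _)); exact: mg.
Qed.

Section fubini.
Context d1 d2 (T1 : measurableType d1) (T2 : measurableType d2).
Variables (Y : Omega -> T1) (Z : Omega -> T2).
Hypotheses (mY : measurable_fun setT Y) (mZ : measurable_fun setT Z).
Hypothesis YZ : independent_fun Y Z.

Let YZpair w : T1 * T2 := (Y w, Z w).
Let mYZpair : measurable_fun setT YZpair.
Proof. exact: measurable_fun_pair. Qed.

Let Y' : {mfun Omega >-> T1} := HB.pack Y (isMeasurableFun.Build _ _ _ _ _ mY).
Let Z' : {mfun Omega >-> T2} := HB.pack Z (isMeasurableFun.Build _ _ _ _ _ mZ).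
Let YZ' : {mfun Omega >-> (T1 * T2)%type} :=
  HB.pack YZpair (isMeasurableFun.Build _ _ _ _ _ mYZpair).

(** Independence says that the law of the pair is the product of the laws; Tonelli is applied there
    and pulled back to [Omega]. *)
Lemma independent_fubini (h : T1 * T2 -> \bar R) : measurable_fun setT h ->
  (forall z, 0 <= h z) ->
  \int[P]_w h (Y w, Z w) = \int[P]_w \int[P]_w' h (Y w, Z w').
Proof.
move=> mh h0.
have prodE A : measurable A -> (distribution P Y' \x distribution P Z') A =
    distribution P YZ' A.
  by apply: product_measure_unique => B C mB mC; exact: YZ.
transitivity (\int[distribution P YZ']_z h z).
  by rewrite ge0_integral_distribution.
transitivity (\int[(distribution P Y' \x distribution P Z')]_z h z).
  by apply: eq_measure_integral => A mA _; exact/esym/prodE.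
rewrite fubini_tonelli1// ge0_integral_distribution//; last 2 first.
- exact: measurable_fun_fubini_tonelli_F.
- by move=> y; exact: integral_ge0.
apply: eq_integral => w _ /=; rewrite /fubini_F ge0_integral_distribution//.
exact: measurableT_comp.
Qed.

Lemma independent_integral_le (h : T1 * T2 -> \bar R) c : measurable_fun setT h ->
  (forall z, 0 <= h z) -> (forall w, \int[P]_w' h (Y w, Z w') <= c) ->
  \int[P]_w h (Y w, Z w) <= c.
Proof.
move=> mh h0 hc; rewrite independent_fubini//.
(* The bound [hc] gives this at any point of [Omega], which is nonempty since it has probability
   1. *)
have c0 : 0 <= c.
  have [w _] : [set: Omega] !=set0.
    by apply/set0P/eqP => W0; have := probability_setT P; rewrite W0 measure0 => /eqP;
      rewrite eqe eq_sym oner_eq0.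
  by apply: le_trans (hc w); exact: integral_ge0.
apply: (@le_trans _ _ (\int[P]_w (cst c w))); last first.
  by rewrite integral_cst//= probability_setT mule1.
apply: ge0_le_integral => //.
- by move=> w _; exact: integral_ge0.
- have -> : (fun w => \int[P]_w' h (Y w, Z w')) =
      fubini_F (distribution P Z') h \o Y.
    apply/funext => w; rewrite /= /fubini_F ge0_integral_distribution//.
    exact: measurableT_comp.
  apply: measurableT_comp mY => //; exact: measurable_fun_fubini_tonelli_F.
Qed.

End fubini.

End independent_fubini.

Section independent_product_integral.
Context {R : realType} {d : measure_display} {Omega : measurableType d}.
Variable P : probability Omega R.

Lemma ge0_integral_indep_mul (X Y : Omega -> R) :
  measurable_fun setT X -> measurable_fun setT Y ->
  (forall w, 0 <= X w) -> (forall w, 0 <= Y w) -> independent_fun P X Y ->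
  (\int[P]_w (X w * Y w)%:E = (\int[P]_w (X w)%:E) * (\int[P]_w (Y w)%:E))%E.
Proof.
(* The absolute values make [h] nonnegative on the whole plane, as Tonelli requires, without
   changing it on the range of [(X, Y)]. *)
move=> mX mY X0 Y0 XY; pose h (z : R * R) := (`|z.1| * `|z.2|)%:E.
have mh : measurable_fun setT h.
  by apply/measurable_EFinP; apply: measurable_funM; apply: measurableT_comp.
transitivity (\int[P]_w h (X w, Y w))%E.
  by apply: eq_integral => w _; rewrite /h/= !ger0_norm.
rewrite (independent_fubini mX mY XY mh); last by move=> z; rewrite lee_fin mulr_ge0.
transitivity (\int[P]_w ((X w)%:E * \int[P]_w' (Y w')%:E))%E.
  apply: eq_integral => w _; rewrite -ge0_integralZl//=.
  - by apply: eq_integral => w' _; rewrite /h/= !ger0_norm.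
  - exact/measurable_EFinP.
  - by move=> w' _; rewrite lee_fin.
  - by rewrite lee_fin.
rewrite ge0_integralZr//=.
- exact/measurable_EFinP.
- by move=> w _; rewrite lee_fin.
- by apply: integral_ge0 => w _; rewrite lee_fin.
Qed.

End independent_product_integral.

Section has_mean.
Context {R : realType} {d : measure_display} {Omega : measurableType d}.
Variable P : probability Omega R.
Implicit Types (X Y : Omega -> R) (c a : R).

(** Bundling integrability with a real value keeps moment computations in [R], where [ring] and
    [lra] apply. *)
Definition has_mean X c :=
  P.-integrable setT (EFin \o X) /\ (\int[P]_w (X w)%:E = c%:E)%E.

Lemma has_mean_measurable X c : has_mean X c -> measurable_fun setT X.
Proof. by case=> iX _; apply/measurable_EFinP; exact: (measurable_int _ iX). Qed.

Lemma has_mean_cst c : has_mean (cst c) c.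
Proof.
split; first exact: finite_measure_integrable_cst.
by rewrite -[LHS]/(\int[P]_w (cst c%:E w))%E integral_cst//= -[RHS]mule1; congr (_ * _)%E; exact: probability_setT.
Qed.

Lemma has_meanD X Y a c : has_mean X a -> has_mean Y c ->
  has_mean (fun w => X w + Y w) (a + c).
Proof.
move=> [iX X1] [iY Y1]; split; first exact: (integrableD measurableT iX iY).
by rewrite EFinD -X1 -Y1; exact: (integralD measurableT iX iY).
Qed.

Lemma has_meanZ X a c : has_mean X c -> has_mean (fun w => a * X w) (a * c).
Proof.
move=> [iX X1]; split; first exact: (integrableZl measurableT a iX).
by rewrite EFinM -X1; exact: (integralZl measurableT iX a).
Qed.

Lemma has_meanB X Y a c : has_mean X a -> has_mean Y c ->
  has_mean (fun w => X w - Y w) (a - c).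
Proof.
move=> hX /(has_meanZ (-1)); rewrite mulN1r => /(has_meanD hX).
by under eq_fun do rewrite mulN1r.
Qed.

Lemma has_mean_sum (I : Type) (r : seq I) (p : pred I) (X : I -> Omega -> R)
    (c : I -> R) : (forall i, p i -> has_mean (X i) (c i)) ->
  has_mean (fun w => \sum_(i <- r | p i) X i w) (\sum_(i <- r | p i) c i).
Proof.
move=> hX; elim: r => [|i r IH].
  by rewrite big_nil; under eq_fun do rewrite big_nil; exact: has_mean_cst.
rewrite big_cons; under eq_fun do rewrite big_cons.
by case: ifPn => // /hX /has_meanD; exact.
Qed.

Lemma has_mean_unique X a c : has_mean X a -> has_mean X c -> a = c.
Proof. by move=> [_ X1] [_]; rewrite X1 => -[]. Qed.

Lemma has_mean_le X Y a c : has_mean X a -> has_mean Y c ->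
  {ae P, forall w, X w <= Y w} -> a <= c.
Proof.
move=> [iX X1] [iY Y1] XY; rewrite -lee_fin -X1 -Y1.
have mX := measurable_int _ iX; have mY := measurable_int _ iY.
case: XY => N [mN N0 XYN].
rewrite (negligible_integral mN)// [leRHS](negligible_integral mN)//.
have mTN : measurable (setT `\` N) by exact: measurableD.
apply: (le_integral mTN).
- exact: (integrableS measurableT mTN (@subsetT _ _) iX).
- exact: (integrableS measurableT mTN (@subsetT _ _) iY).
- move=> w; rewrite inE => -[_ Nw]; rewrite lee_fin.
  by apply: contrapT => XYw; apply: Nw; apply: XYN.
Qed.

Lemma ge0_has_mean X : measurable_fun setT X -> (forall w, 0 <= X w) ->
  (\int[P]_w (X w)%:E < +oo)%E -> exists c, has_mean X c.
Proof.
move=> mX X0 Xoo; have iX : P.-integrable setT (EFin \o X).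
  apply/integrableP; split; first exact/measurable_EFinP.
  by under eq_integral do rewrite /= ger0_norm//.
exists (fine (\int[P]_w (X w)%:E)); split => //.
by rewrite fineK// ge0_fin_numE// integral_ge0// => w _; rewrite lee_fin.
Qed.

Lemma has_mean_dominated X Y c : measurable_fun setT X -> has_mean Y c ->
  (forall w, `|X w| <= Y w) -> exists a, has_mean X a.
Proof.
move=> mX [iY _] XY; have iX : P.-integrable setT (EFin \o X).
  apply: le_integrable iY => //; first exact/measurable_EFinP.
  by move=> w _; rewrite /= lee_fin (le_trans (XY w))// ler_norm.
exists (fine (\int[P]_w (X w)%:E)); split => //.
by rewrite fineK//; exact: integrable_fin_num.
Qed.

(** The product is dominated by [X ^+ 2 + Y ^+ 2]. *)
Lemma has_mean_sqr_mul X Y a c : measurable_fun setT X -> measurable_fun setT Y ->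
  has_mean (fun w => X w ^+ 2) a -> has_mean (fun w => Y w ^+ 2) c ->
  exists e, has_mean (fun w => X w * Y w) e.
Proof.
move=> mX mY hX hY.
apply: (has_mean_dominated _ (has_meanD hX hY)); first exact: measurable_funM.
move=> w; rewrite ler_norml -subr_ge0 opprK; apply/andP; split.
  by have := sqr_ge0 (X w + Y w); have := sqr_ge0 (X w); have := sqr_ge0 (Y w); lra.
by have := sqr_ge0 (X w - Y w); have := sqr_ge0 (X w); have := sqr_ge0 (Y w); lra.
Qed.

Let ge0_has_mean_mul X Y a c : independent_fun P X Y ->
  (forall w, 0 <= X w) -> (forall w, 0 <= Y w) ->
  has_mean X a -> has_mean Y c -> has_mean (fun w => X w * Y w) (a * c).
Proof.
move=> XY X0 Y0 hX hY; have [iX X1] := hX; have [iY Y1] := hY.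
have mX := has_mean_measurable hX; have mY := has_mean_measurable hY.
have XY1 : (\int[P]_w (X w * Y w)%:E = (a * c)%:E)%E.
  by rewrite ge0_integral_indep_mul// X1 Y1.
split=> //; apply/integrableP; split.
  by apply/measurable_EFinP; exact: measurable_funM.
under eq_integral do rewrite /= ger0_norm ?mulr_ge0//.
by rewrite XY1 ltry.
Qed.

Let split_mean Z e : has_mean Z e ->
  exists e1 e2, [/\ e = e1 - e2, has_mean (fun w => Num.max (Z w) 0) e1
                & has_mean (fun w => Num.max (- Z w) 0) e2].
Proof.
move=> hZ; have mZ := has_mean_measurable hZ.
have hN : has_mean (fun w => `|Z w|) (fine (\int[P]_w `|Z w|%:E)%E).
  have iN : P.-integrable setT (EFin \o (fun w => `|Z w|)).
    by case: hZ => /integrable_abse.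
  by split; rewrite // fineK//; exact: integrable_fin_num.
have [e1 he1] : exists e1, has_mean (fun w => Num.max (Z w) 0) e1.
  apply: (has_mean_dominated _ hN) => [|w].
    by apply: measurable_maxr => //; exact: measurable_cst.
  by case: (leP (Z w) 0) => ?; rewrite ?normr0.
have [e2 he2] : exists e2, has_mean (fun w => Num.max (- Z w) 0) e2.
  apply: (has_mean_dominated _ hN) => [|w].
    by apply: measurable_maxr; [exact: measurableT_comp|exact: measurable_cst].
  by case: (leP (- Z w) 0) => ?; rewrite ?normr0// normrN.
exists e1, e2; split=> //; apply: (has_mean_unique hZ).
have -> : Z = (fun w => Num.max (Z w) 0 - Num.max (- Z w) 0); last exact: has_meanB.
apply/funext => w.
case: (leP (Z w) 0) => z1; case: (leP (- Z w) 0) => z2; lra.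
Qed.

(** Splitting both variables into positive and negative parts reduces the signed case to four
    nonnegative products; the parts remain independent, being functions of [X] and of [Y]. *)
Lemma has_mean_indep_mul X Y a c : independent_fun P X Y ->
  has_mean X a -> has_mean Y c -> has_mean (fun w => X w * Y w) (a * c).
Proof.
move=> XY hX hY.
have mpos : measurable_fun setT (fun x : R => Num.max x 0).
  by apply: measurable_maxr => //; exact: measurable_cst.
have mneg : measurable_fun setT (fun x : R => Num.max (- x) 0).
  by apply: measurable_maxr; last exact: measurable_cst.
have indep (f g : R -> R) : measurable_fun setT f -> measurable_fun setT g ->
    independent_fun P (f \o X) (g \o Y).
  by move=> mf mg; exact: independent_fun_comp.
have [a1 [a2 [-> hX1 hX2]]] := split_mean hX.
have [c1 [c2 [-> hY1 hY2]]] := split_mean hY.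
have -> : (a1 - a2) * (c1 - c2) = (a1 * c1 + a2 * c2) - (a1 * c2 + a2 * c1) by ring.
pose p Z (w : Omega) : R := Num.max (Z w) 0; pose m Z (w : Omega) : R := Num.max (- Z w) 0.
have pm Z w : Z w = p Z w - m Z w.
  rewrite /p /m; case: (leP (Z w) 0) => z1; case: (leP (- Z w) 0) => z2; lra.
have -> : (fun w => X w * Y w) = (fun w => (p X w * p Y w + m X w * m Y w)
    - (p X w * m Y w + m X w * p Y w)).
  by apply/funext => w; rewrite (pm X) (pm Y); ring.
have pm0 (x : R) : 0 <= Num.max x 0 by rewrite le_max lexx orbT.
apply: has_meanB; apply: has_meanD.
- exact: (ge0_has_mean_mul (indep _ _ mpos mpos) (fun=> pm0 _) (fun=> pm0 _) hX1 hY1).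
- exact: (ge0_has_mean_mul (indep _ _ mneg mneg) (fun=> pm0 _) (fun=> pm0 _) hX2 hY2).
- exact: (ge0_has_mean_mul (indep _ _ mpos mneg) (fun=> pm0 _) (fun=> pm0 _) hX1 hY2).
- exact: (ge0_has_mean_mul (indep _ _ mneg mpos) (fun=> pm0 _) (fun=> pm0 _) hX2 hY1).
Qed.

End has_mean.

(** * Moments of Gaussian vectors *)

Section standard_normal_moments.
Context {R : realType}.
Local Notation mu := (@lebesgue_measure R).
Local Notation gauss := (normal_prob (0 : R) 1).
Local Notation pdf := (normal_pdf (0 : R) 1).

(** The Radon-Nikodym derivative of the normal law agrees almost everywhere with the explicit
    density, both having the same integral over every measurable set. *)
Lemma ge0_integral_normal_prob (f : R -> \bar R) : measurable_fun setT f ->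
  (forall x, (0 <= f x)%E) ->
  (\int[gauss]_x f x = \int[mu]_x (f x * (pdf x)%:E))%E.
Proof.
move=> mf f0.
have dom : gauss `<< mu by exact: normal_prob_dominates.
rewrite -(Radon_Nikodym_SigmaFinite.change_of_variables dom f0 measurableT mf).
have mpdf : measurable_fun setT (EFin \o pdf).
  by apply/measurable_EFinP; exact: measurable_normal_pdf.
have mRN := measurable_int _ (Radon_Nikodym_SigmaFinite.f_integrable dom).
apply: ae_eq_integral => //; do ?exact: emeasurable_funM.
apply: ae_eqe_mul2l; apply: integral_ae_eq => //.
  exact: Radon_Nikodym_SigmaFinite.f_integrable.
by move=> A _ mA; rewrite -Radon_Nikodym_SigmaFinite.f_integral.
Qed.

Let pdfE x : pdf x = normal_peak 1 * expR (- x ^+ 2 / 2).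
Proof.
rewrite normal_pdfE ?oner_neq0// /normal_fun subr0 expr1n.
by congr (_ * expR (_ / _)).
Qed.

Let pdf_ge0 x : 0 <= pdf x. Proof. exact: normal_pdf_ge0. Qed.

Let is_derive_pdf (x : R) : is_derive x (1 : R) (pdf : R -> R) (- (x * pdf x)).
Proof.
pose q (y : R) : R := - y ^+ 2 / 2.
have dq : is_derive x (1 : R) q (- x).
  by apply: is_derive_eq; rewrite /GRing.scale/=; field.
have dc : is_derive x (1 : R) (expR \o q) (expR (q x) * - x).
  exact: is_derive1_comp.
have -> : (pdf : R -> R) = (fun y => normal_peak 1 * (expR \o q) y).
  by apply/funext => y; rewrite pdfE.
apply: is_derive_eq.
by rewrite /GRing.scale/=; ring.
Qed.

(** The integration by parts behind the moment recursion, written as an explicit antiderivative. *)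
Let derivable_moment k (x : R) :
  is_derive x (1 : R) (fun y : R => - (y ^+ k.+1 * pdf y))
    (x ^+ k.+2 * pdf x - k.+1%:R * x ^+ k * pdf x).
Proof.
have := is_derive_pdf x; move: (pdf : R -> R) => g dg.
pose m (y : R) : R := y ^+ k.+1.
have dm : is_derive x (1 : R) m (k.+1%:R * x ^+ k).
  have -> : m = id ^+ k.+1 by rewrite fctE.
  by apply: is_derive_eq; rewrite /GRing.scale/= mulr1.
have -> : (fun y => - (y ^+ k.+1 * g y)) = - (m * g) by [].
by apply: is_derive_eq; rewrite /GRing.scale/= /m !exprS; ring.
Qed.

Let pdf_tail k : (x ^+ k * pdf x) @[x --> +oo] --> (0 : R).
Proof.
set C : R := normal_peak 1 * (k.+1`!%:R * 2 ^+ k.+1).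
have C0 : 0 <= C by rewrite !mulr_ge0 ?normal_peak_ge0 ?exprn_ge0.
have bound x : 1 <= x -> x ^+ k * pdf x <= C / x.
  move=> x1; have x0 : 0 < x by exact: lt_le_trans x1.
  rewrite pdfE mulNr expRN /C mulrCA -[leRHS]mulrA ler_wpM2l ?normal_peak_ge0//.
  rewrite ler_pdivrMr ?expR_gt0//.
  have y0 : 0 <= x ^+ 2 / 2 by rewrite divr_ge0 ?exprn_ge0 ?ltW.
  apply: (@le_trans _ _ (k.+1`!%:R * 2 ^+ k.+1 / x *
      ((x ^+ 2 / 2) ^+ k.+1 / k.+1`!%:R))).
    rewrite expr_div_n.
    have -> : k.+1`!%:R * 2 ^+ k.+1 / x * ((x ^+ 2) ^+ k.+1 / 2 ^+ k.+1 / k.+1`!%:R)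
       = x ^+ k * (x ^+ k * x).
      have -> : (x ^+ 2) ^+ k.+1 = x * (x * (x ^+ k * x ^+ k)).
        by rewrite exprS expr2 exprMn; ring.
      have p2 : (2 : R) ^+ k.+1 != 0 by rewrite expf_neq0.
      have fk : (k.+1`!)%:R != 0 :> R by rewrite pnatr_eq0 -lt0n fact_gt0.
      by field; rewrite p2 fk gt_eqF.
    by rewrite ler_peMr ?exprn_ge0 ?(ltW x0)// mulr_ege1 ?exprn_ege1.
  rewrite ler_wpM2l ?divr_ge0 ?mulr_ge0 ?exprn_ge0 ?(ltW x0)//.
  by apply: le_trans (expR_ge1Dxn k y0); rewrite lerDr.
apply/cvgrPdist_le => e e0; near=> x.
have x1 : 1 <= x by near: x; apply: nbhs_pinfty_ge; rewrite num_real.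
have x0 : 0 < x by exact: lt_le_trans x1.
rewrite sub0r normrN ger0_norm ?mulr_ge0 ?exprn_ge0 ?(ltW x0)//.
apply: (le_trans (bound x x1)); rewrite ler_pdivrMr// mulrC -ler_pdivrMr//.
Unshelve. all: by end_near.
Qed.

Let half_moment k := (\int[mu]_(x in `[0%R, +oo[) (x ^+ k * pdf x)%:E)%E.

Let continuous_moment k : continuous (fun x : R => x ^+ k * pdf x).
Proof.
move=> x; apply: cvgM; first exact: exprn_continuous.
by apply: continuous_normal_pdf; exact: oner_neq0.
Qed.

(** The recursion is proved in the extended reals, before any moment is known to be finite. The
    integrand [f] changes sign only at [c], so the half-line is cut there and each piece involves
    only nonnegative integrals. *)
Let half_momentS k : half_moment k.+2 = ((k.+1%:R)%:E * half_moment k)%E.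
Proof.
set c : R := Num.sqrt k.+1%:R.
have c0 : 0 < c by rewrite sqrtr_gt0.
have c2 : c ^+ 2 = k.+1%:R by rewrite sqr_sqrtr.
pose f (x : R) := x ^+ k.+2 * pdf x - k.+1%:R * x ^+ k * pdf x.
pose F (x : R) := - (x ^+ k.+1 * pdf x).
have fE x : f x = (x ^+ 2 - c ^+ 2) * (x ^+ k * pdf x).
  by rewrite /f c2 !exprS; ring.
have cf : continuous f.
  move=> x; have -> : f = (fun x => x ^+ k.+2 * pdf x - k.+1%:R * (x ^+ k * pdf x)).
    by apply/funext => y; rewrite /f mulrA.
  apply: cvgB; first exact: continuous_moment.
  by apply: cvgM; [exact: cvg_cst|exact: continuous_moment].
have dF x : derivable F x 1 by apply: (@ex_derive _ _ _ _ _ _ _ (derivable_moment k x)).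
have cF : continuous F.
  by move=> x; apply: differentiable_continuous; apply/derivable1_diffP.
have F'f x : derive1 F x = f x by rewrite derive1E; have dm := derivable_moment k x; exact: (@derive_val _ _ _ _ _ _ _ dm).
have mg j (D : set R) : measurable D ->
    measurable_fun D (fun x : R => (x ^+ j * pdf x)%:E).
  move=> mD; apply/measurable_EFinP/measurable_funTS.
  exact: continuous_measurable_fun.
have split_half j : half_moment j =
    (\int[mu]_(x in `[0%R, c]) (x ^+ j * pdf x)%:E +
     \int[mu]_(x in `[c, +oo[) (x ^+ j * pdf x)%:E)%E.
  rewrite -integral_itv_bndo_bndc; last exact: mg.
  rewrite -ge0_integral_setU//=.
  - congr (integral _ _ _); apply/seteqP; split => x /=; rewrite !in_itv/= !andbT.
      by move=> x0; case: (ltP x c) => xc; [left; rewrite x0|right].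
    by move=> [/andP[]//|cx]; exact: le_trans (ltW c0) cx.
  - by apply: mg; exact: measurableU.
  - move=> x /=; rewrite !in_itv/= !andbT lee_fin => xx.
    rewrite mulr_ge0 ?exprn_ge0//.
    by case: xx => [/andP[]//|]; apply: le_trans; exact: ltW.
  - apply/disj_setPS => x [] /=; rewrite !in_itv/= andbT => /andP[_].
    by rewrite ltNge => /negP.
set C : R := c ^+ k.+1 * pdf c.
have g0 j x : 0 <= x -> 0 <= x ^+ j * pdf x.
  by move=> x0; rewrite mulr_ge0 ?exprn_ge0.
have lo : (\int[mu]_(x in `[0%R, c]) (k.+1%:R * (x ^+ k * pdf x))%:E =
    \int[mu]_(x in `[0%R, c]) (x ^+ k.+2 * pdf x)%:E + C%:E)%E.
  have <- : (\int[mu]_(x in `[0%R, c]) (- f x)%:E = C%:E)%E.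
    rewrite (@continuous_FTC2 _ _ (fun x => - F x))//.
    - by rewrite /F !opprK expr0n/= mul0r sube0.
    - by apply: continuous_subspaceT => x; apply: cvgN; exact: cf.
    - split.
      + by move=> x _; exact: derivableN.
      + by apply: cvg_at_right_filter; apply: cvgN; exact: cF.
      + by apply: cvg_at_left_filter; apply: cvgN; exact: cF.
    - by move=> x _; rewrite derive1N// F'f.
  rewrite -ge0_integralD//=.
  - apply: eq_integral => x _; rewrite -EFinD; congr EFin.
    by rewrite fE c2 !exprS; ring.
  - by move=> x; rewrite /= in_itv/= lee_fin => /andP[x0 _]; exact: g0.
  - exact: mg.
  - move=> x; rewrite /= in_itv/= lee_fin => /andP[x0 xc].
    rewrite fE -mulNr mulr_ge0 ?g0// opprB subr_ge0.
    by rewrite lerXn2r ?nnegrE// ltW.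
  - apply/measurable_EFinP/measurable_funTS; apply: measurableT_comp => //.
    exact: continuous_measurable_fun.
have hi : (\int[mu]_(x in `[c, +oo[) (x ^+ k.+2 * pdf x)%:E =
    \int[mu]_(x in `[c, +oo[) (k.+1%:R * (x ^+ k * pdf x))%:E + C%:E)%E.
  have f0 x : c <= x -> 0 <= f x.
    move=> cx; have x0 : 0 <= x by exact: le_trans (ltW c0) cx.
    rewrite fE mulr_ge0 ?g0// subr_ge0.
    by rewrite lerXn2r ?nnegrE// ltW.
  have <- : (\int[mu]_(x in `[c, +oo[) (f x)%:E = C%:E)%E.
    rewrite (@ge0_continuous_FTC2y _ _ F _ 0)//.
    - by rewrite /F EFinN oppeK add0e.
    - exact: continuous_subspaceT.
    - by rewrite -oppr0; apply: cvgN; exact: pdf_tail.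
    - by apply: cvg_at_right_filter; exact: cF.
  rewrite -ge0_integralD//=.
  - apply: eq_integral => x _; rewrite -EFinD; congr EFin.
    by rewrite fE c2 !exprS; ring.
  - move=> x; rewrite /= in_itv/= andbT lee_fin => cx.
    by rewrite mulr_ge0// g0// (le_trans (ltW c0)).
  - apply/measurable_EFinP/measurable_funTS; apply: measurable_funM => //.
    exact: continuous_measurable_fun.
  - by move=> x; rewrite /= in_itv/= andbT lee_fin; exact: f0.
  - by apply/measurable_EFinP/measurable_funTS; exact: continuous_measurable_fun.
have scale (D : set R) : measurable D -> D `<=` [set x | 0 <= x] ->
    (\int[mu]_(x in D) (k.+1%:R * (x ^+ k * pdf x))%:E =
    (k.+1%:R)%:E * \int[mu]_(x in D) (x ^+ k * pdf x)%:E)%E.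
  move=> mD D0; rewrite -ge0_integralZl//=; first exact: mg.
  by move=> x /D0 /= x0; rewrite lee_fin g0.
(* The boundary value [C] at [c] is gained on the right piece and lost on the left one; regrouping
   cancels it without subtraction. *)
rewrite !split_half hi addeCA addeC -lo !scale//.
- have i0 (D : set R) : D `<=` [set x | 0 <= x] ->
      (0 <= \int[mu]_(x in D) (x ^+ k * pdf x)%:E)%E.
    by move=> D0; apply: integral_ge0 => x /D0 /= x0; rewrite lee_fin g0.
  rewrite [RHS](ge0_muleDr _ (i0 _ _) (i0 _ _))//.
    by move=> x /=; rewrite in_itv/= => /andP[].
  by move=> x /=; rewrite in_itv/= andbT; apply: le_trans; exact: ltW.
- by move=> x /=; rewrite in_itv/= andbT; apply: le_trans; exact: ltW.
- by move=> x /=; rewrite in_itv/= => /andP[].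
Qed.

Let moment_even k : ~~ odd k ->
  (\int[gauss]_x (x ^+ k)%:E = 2%:E * half_moment k)%E.
Proof.
move=> ek; have xk0 (x : R) : 0 <= x ^+ k by rewrite exprn_even_ge0.
rewrite ge0_integral_normal_prob; last 2 first.
- by apply/measurable_EFinP; exact: exprn_measurable.
- by move=> x; rewrite lee_fin.
under eq_integral do rewrite -EFinM.
rewrite ge0_symfun_integralT.
- by rewrite -set_itvcy.
- by move=> x; rewrite mulr_ge0.
- exact: continuous_moment.
- by move=> x /=; rewrite !pdfE sqrrN [(- x) ^+ k]exprNn -signr_odd (negbTE ek) expr0 mul1r.
Qed.

(** By symmetry an even moment is twice its half moment; finiteness of the next even moment, hence
    integrability, is read off from the recursion. *)
Lemma has_mean_normalXSS k c : ~~ odd k ->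
  has_mean gauss (fun x => x ^+ k) c ->
  has_mean gauss (fun x => x ^+ k.+2) (k.+1%:R * c).
Proof.
move=> ek [_ kc].
have k2 : (\int[gauss]_x (x ^+ k.+2)%:E = (k.+1%:R * c)%:E)%E.
  rewrite moment_even ?negbK// half_momentS muleCA -moment_even// kc.
  by rewrite EFinM.
split=> //; apply/integrableP; split; first exact/measurable_EFinP.
have xk0 (x : R) : 0 <= x ^+ k.+2 by rewrite exprn_even_ge0//= negbK.
by under eq_integral do rewrite /= ger0_norm//; rewrite k2 ltry.
Qed.

Lemma has_mean_normal2 : has_mean gauss (fun x => x ^+ 2) 1.
Proof.
have h0 : has_mean gauss (fun x => x ^+ 0) 1 by exact: has_mean_cst.
by have := has_mean_normalXSS (k := 0) isT h0; rewrite mulr1.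
Qed.

Lemma has_mean_normal4 : has_mean gauss (fun x => x ^+ 4) 3.
Proof. by have := has_mean_normalXSS (k := 2) isT has_mean_normal2; rewrite mulr1. Qed.

Lemma has_mean_normal6 : has_mean gauss (fun x => x ^+ 6) 15.
Proof.
have := has_mean_normalXSS (k := 4) isT has_mean_normal4.
by rewrite (_ : 5%:R * 3 = 15)//; ring.
Qed.

(** Positive and negative parts have the same integral, [half_moment 1], by the reflection
    [x |-> - x]. *)
Lemma has_mean_normal1 : has_mean gauss idfun 0.
Proof.
have mpos : measurable_fun setT (fun x : R => Num.max x 0).
  by apply: measurable_maxr => //; exact: measurable_cst.
have mneg : measurable_fun setT (fun x : R => Num.max (- x) 0).
  by apply: measurable_maxr; last exact: measurable_cst.
have max0 (x : R) : 0 <= Num.max x 0 by rewrite le_max lexx orbT.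
have E1 : (\int[gauss]_x (Num.max x 0)%:E = half_moment 1)%E.
  rewrite ge0_integral_normal_prob; last 2 first.
  - exact/measurable_EFinP.
  - by move=> x; rewrite lee_fin.
  rewrite /half_moment [RHS]integral_mkcond; apply: eq_integral => x _.
  rewrite patchE; case: ifPn; rewrite ?inE ?notin_setE/= in_itv/= andbT => x0.
    by rewrite -EFinM expr1 max_l.
  by rewrite max_r ?mul0e//; move/negP: x0; rewrite -ltNge; exact: ltW.
have E2 : (\int[gauss]_x (Num.max (- x) 0)%:E = half_moment 1)%E.
  rewrite ge0_integral_normal_prob; last 2 first.
  - exact/measurable_EFinP.
  - by move=> x; rewrite lee_fin.
  transitivity (\int[mu]_(x in `]-oo, (- 0)%R]) (- x * pdf x)%:E)%E.
    rewrite oppr0 [RHS]integral_mkcond; apply: eq_integral => x _.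
    rewrite patchE; case: ifPn; rewrite ?inE ?notin_setE/= in_itv/= => x0.
      by rewrite -EFinM max_l// oppr_ge0.
    by rewrite max_r ?mul0e// oppr_le0; move/negP: x0; rewrite -ltNge; exact: ltW.
  rewrite (@ge0_integration_by_substitutionNy _ (fun x => - x * pdf x)).
  - by apply: eq_integral => x _ /=; rewrite opprK !pdfE sqrrN.
  - apply: continuous_subspaceT => x; apply: cvgM; first by apply: cvgN; exact: cvg_id.
    by apply: continuous_normal_pdf; exact: oner_neq0.
  - by move=> x; rewrite in_itv/= oppr0 => x0; rewrite mulr_ge0// oppr_ge0 ltW.
(* Integrability of both parts follows from domination by [1 + x ^+ 2]. *)
have hdom := has_meanD (has_mean_cst gauss 1) has_mean_normal2.
have [c1 h1] : exists c, has_mean gauss (fun x => Num.max x 0) c.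
  apply: (has_mean_dominated (P := gauss) mpos hdom _) => x /=.
  rewrite ger0_norm//; have := sqr_ge0 (x - 1); have := sqr_ge0 x.
  by case: (leP x 0); lra.
have [c2 h2] : exists c, has_mean gauss (fun x => Num.max (- x) 0) c.
  apply: (has_mean_dominated (P := gauss) mneg hdom _) => x /=.
  rewrite ger0_norm//; have := sqr_ge0 (x + 1); have := sqr_ge0 x.
  by case: (leP (- x) 0); lra.
have c12 : c1 = c2.
  by have [_ k1] := h1; have [_ k2] := h2; move: k1 k2; rewrite E1 E2 => -> [].
have := has_meanB h1 h2; rewrite c12 subrr.
have -> // : (fun x : R => Num.max x 0 - Num.max (- x) 0) = idfun.
by apply/funext => x /=; case: (leP x 0) => x1; case: (leP (- x) 0) => x2; lra.
Qed.

End standard_normal_moments.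

(** * Measurable maps into matrix spaces *)

Section matrix_measurability.
Context {d : measure_display} {T : measurableType d} {m n : nat}.

Lemma measurable_mx_coord (i : 'I_m) (j : 'I_n) :
  measurable_fun setT (fun A : 'M[T]_(m, n) => A i j).
Proof.
move=> _ B mB; rewrite setTI; apply: sub_sigma_algebra; exists (i, j) => //.
by exists B => //; rewrite setTI.
Qed.

Lemma measurable_mx d' (U : measurableType d') (f : U -> 'M[T]_(m, n)) :
  (forall i j, measurable_fun setT (fun x => f x i j)) -> measurable_fun setT f.
Proof.
move=> mf _ B; rewrite setTI.
apply: (@smallest_sub _ _ _ [set B | measurable (f @^-1` B)]).
  split => /=.
  - by rewrite preimage_set0.
  - by move=> A mA; rewrite setTD preimage_setC; exact: measurableC.
  - move=> F mF; rewrite preimage_bigcup; exact: bigcup_measurable.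
move=> C [[i j] _ /= [D mD <-]]; rewrite setTI /=.
by have := mf i j measurableT D mD; rewrite setTI.
Qed.

Lemma measurable_fun_bigsum {R : realType} d' (U : measurableType d') (I : Type)
    (r : seq I) (p : pred I) (f : I -> U -> R) :
  (forall i, p i -> measurable_fun setT (f i)) ->
  measurable_fun setT (fun x => \sum_(i <- r | p i) f i x).
Proof.
move=> mf; have -> : (fun x => \sum_(i <- r | p i) f i x) =
    (fun x => \sum_(i <- r) if p i then f i x else 0).
  by apply/funext => x; exact: (@big_mkcond _ _ _ I r p (fun i => f i x)).
apply: measurable_sum => i.
by have := mf i; case: (p i) => [/(_ isT)|_] //; exact: measurable_cst.
Qed.

End matrix_measurability.

Section transfer.
Context {R : realType} {d d' : measure_display}.
Context {Omega : measurableType d} {T : measurableType d'}.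
Variables (P : probability Omega R) (Q : probability T R).

Lemma has_mean_law (X : Omega -> T) (h : T -> R) c :
  measurable_fun setT X -> (forall A, measurable A -> P (X @^-1` A) = Q A) ->
  has_mean Q h c -> has_mean P (h \o X) c.
Proof.
move=> mX XQ hc; have [ih Ih] := hc.
have mh := measurable_int _ ih.
pose X' : {mfun Omega >-> T} := HB.pack X (isMeasurableFun.Build _ _ _ _ _ mX).
have law (g : T -> \bar R) : (\int[distribution P X']_x g x = \int[Q]_x g x)%E.
  by apply: eq_measure_integral => A mA _; exact: XQ.
have ihX : P.-integrable setT (EFin \o (h \o X)).
  apply/integrableP; split; first exact: (measurableT_comp mh mX).
  have -> : (\int[P]_x `|(EFin \o (h \o X)) x| = \int[Q]_x `|(h x)%:E|)%E.
    rewrite -(law (fun x => `|(h x)%:E|%E)) ge0_integral_distribution//.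
    exact: measurableT_comp.
  by have /integrableP[_] := ih.
split=> //; rewrite -Ih -law integral_distribution//.
Qed.

End transfer.

Section gaussian_vector.
Context {R : realType} {d : measure_display} {Omega : measurableType d} {n : nat}.
Variables (P : probability Omega R) (u : Omega -> 'cV[R]_n).
Hypotheses (mu : measurable_fun setT u) (normal_u : std_normal P u).

Let U i w := u w i ord0.

Let mU i : measurable_fun setT (U i).
Proof. exact: (measurableT_comp (measurable_mx_coord i ord0) mu). Qed.

Let S (i : 'I_n) : set (set Omega) := g_sigma_algebra_preimage (U i).

Let lawU i A : measurable A -> P (U i @^-1` A) = normal_prob (0 : R) 1 A.
Proof.
move=> mA; have := @normal_u (fun j => if j == i then A else setT).
rewrite (bigD1 i)//= eqxx big1 ?mule1 => [|j /negbTE ->]; last first.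
  exact: (@probability_setT _ _ _ (normal_prob (0 : R) 1)).
move=> <-; last by move=> j; case: ifP.
congr (P _); apply/seteqP; split => [w Aw j|w /(_ i)]; last by rewrite eqxx.
by case: eqP => // ->.
Qed.

(** The product formula defining [std_normal] concerns all coordinates at once; a subfamily is
    obtained by taking [setT] outside [J], each such factor being 1. *)
Let indU : mutually_independent P setT S.
Proof.
move=> J _ E SE.
have {}SE j : exists A : set R, measurable A /\
    (if j \in J then E j = U j @^-1` A else A = setT).
  have [/SE [A mA <-]|_] := boolP (j \in J); last by exists setT.
  by exists A; rewrite setTI.
have [A HA] := choice SE.
have mA j : measurable (A j) := (HA j).1.
transitivity (P [set w | forall j, A j (u w j ord0)]).
  congr (P _); apply/seteqP; split => [w Ew j|w Aw j /= jJ].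
    by have [_] := HA j; case: ifPn => [jJ EA|_ -> //]; have := Ew j jJ; rewrite EA.
  by have [_] := HA j; rewrite jJ => ->; exact: Aw.
rewrite normal_u// (bigID (mem J))/= [X in (_ * X)%E]big1 ?mule1 => [|j /negbTE jJ].
  rewrite -big_filter (perm_big J)/=; last first.
    apply: uniq_perm; rewrite ?fset_uniq ?filter_uniq ?index_enum_uniq// => j.
    by rewrite mem_filter mem_index_enum andbT.
  apply: eq_big_seq => j jJ; have [_] := HA j; rewrite jJ => ->.
  exact/esym/lawU.
have [_] := HA j; rewrite jJ => ->.
exact: (@probability_setT _ _ _ (normal_prob (0 : R) 1)).
Qed.

Let indep_groups (D1 D2 : set 'I_n) : D1 `&` D2 = set0 ->
  independent P (\bigcup_(j in D1) S j) (\bigcup_(j in D2) S j).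
Proof.
apply: (mutually_independent_groups indU) => // j _.
  exact: sigma_algebra_preimage (@sigma_algebra_measurable _ _).
by move=> _ [A mA <-]; exact: mU.
Qed.

Let mgroup (D : set 'I_n) i : D i ->
  measurable_fun setT (U i : g_sigma_algebraType (\bigcup_(j in D) S j) -> R).
Proof.
move=> Di _ A mA; apply: sub_sigma_algebra; exists i => //.
by exists A.
Qed.

Let has_mean_groups (D1 D2 : set 'I_n) X Y a c : D1 `&` D2 = set0 ->
  measurable_fun setT (X : g_sigma_algebraType (\bigcup_(j in D1) S j) -> R) ->
  measurable_fun setT (Y : g_sigma_algebraType (\bigcup_(j in D2) S j) -> R) ->
  has_mean P X a -> has_mean P Y c -> has_mean P (fun w => X w * Y w) (a * c).
Proof.
move=> D12 mX mY; apply: has_mean_indep_mul.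
exact: (independent_fun_sigma (indep_groups D12)).
Qed.

Let has_meanU i h c : has_mean (normal_prob (0 : R) 1) h c ->
  has_mean P (fun w => h (U i w)) c.
Proof.
move=> hc; exact: (@has_mean_law _ _ _ _ _ P (normal_prob (0 : R) 1) _ _ _ (mU i) (@lawU i) hc).
Qed.

Let disj1 i j : i != j -> [set i] `&` [set j] = set0 :> set 'I_n.
Proof. by move=> /eqP ij; apply/seteqP; split => // k [-> /ij]. Qed.

Let has_mean_mul_coord (g h : R -> R) i j a c : i != j ->
  measurable_fun setT g -> measurable_fun setT h ->
  has_mean P (fun w => g (U i w)) a -> has_mean P (fun w => h (U j w)) c ->
  has_mean P (fun w => g (U i w) * h (U j w)) (a * c).
Proof.
move=> ij mg mh; apply: (has_mean_groups (disj1 ij)).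
  by apply: measurableT_comp => //; exact: mgroup.
by apply: measurableT_comp => //; exact: mgroup.
Qed.

Lemma has_mean_gaussian_mul i j :
  has_mean P (fun w => u w i ord0 * u w j ord0) (i == j)%:R.
Proof.
case: eqVneq => [<-|ij].
  by have := has_meanU i has_mean_normal2; under eq_fun do rewrite expr2.
have h1 k := has_meanU k has_mean_normal1.
have mid : measurable_fun setT (idfun : R -> R) by exact: measurable_id.
by have := has_mean_mul_coord ij mid mid (h1 i) (h1 j); rewrite mulr0.
Qed.

(** If [j != k], one of them differs from [i] and its coordinate, occurring once, is centered. If
    [j = k], the value is the fourth moment 3 when [i = j] and a product of two variances
    otherwise. *)
Lemma has_mean_gaussian_mul_sqr i j k :
  has_mean P (fun w => (u w j ord0 * u w k ord0) * u w i ord0 ^+ 2)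
    ((j == k)%:R * (1 + 2 * (i == j)%:R)).
Proof.
have h1 l := has_meanU l has_mean_normal1.
have mid : measurable_fun setT (idfun : R -> R) by exact: measurable_id.
have h2 l := has_meanU l has_mean_normal2.
(* The value is irrelevant, since this mean is later multiplied by 0; existence comes from
   [2 * |x ^+ 3| <= x ^+ 2 + x ^+ 4]. *)
have h3 l : exists c, has_mean P (fun w => U l w ^+ 3) c.
  have hdom := has_meanD (h2 l) (has_meanU l has_mean_normal4).
  apply: (has_mean_dominated (P := P) _ hdom _).
    exact: (measurable_funX 3 (mU l)).
  move=> w; rewrite ler_norml; move: (U l w) => x.
  have := sqr_ge0 (x ^+ 2 + x); have := sqr_ge0 (x ^+ 2 - x).
  have := sqr_ge0 x; have := sqr_ge0 (x ^+ 2).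
  by rewrite !exprS expr0 !mulr1 => a1 a2 a3 a4; apply/andP; split; lra.
(* A factor that is alone in its coordinate is centered. *)
have center l1 l2 : l1 != l2 -> i != l1 ->
    has_mean P (fun w => U l1 w * (U l2 w * U i w ^+ 2)) 0.
  move=> l12 il1.
  have [c hc] : exists c, has_mean P (fun w => U l2 w * U i w ^+ 2) c.
    have [<-|il2] := eqVneq i l2.
      have [c hc] := h3 i; exists c; move: hc.
      by under eq_fun do rewrite exprS.
    rewrite eq_sym in il2; exists (0 * 1).
    exact: (has_mean_mul_coord il2 mid (exprn_measurable 2) (h1 l2) (h2 i)).
  rewrite -(mul0r c).
  apply: (@has_mean_groups [set l1] [set l2; i] (U l1)) => //; last exact: h1.
  - apply/seteqP; split => // l [-> [] /eqP]; first by rewrite (negbTE l12).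
    by rewrite eq_sym (negbTE il1).
  - exact: mgroup.
  - apply: measurable_funM; first by apply: mgroup; left.
    by apply: measurable_funX; apply: mgroup; right.
have [<-|jk] := eqVneq j k; last first.
  rewrite mul0r; have [ij|ij] := eqVneq i j.
    have ik : i != k by rewrite ij.
    rewrite eq_sym in jk; have := center _ _ jk ik.
    by congr (has_mean P _ _); apply/funext => w; rewrite /U mulrCA mulrA.
  by have := center _ _ jk ij; congr (has_mean P _ _); apply/funext => w; rewrite mulrA.
rewrite mul1r; have [->|ij] := eqVneq i j.
  have := has_meanU j has_mean_normal4.
  congr (has_mean P _ _); last by rewrite mulr1; ring.
  by apply/funext => w; rewrite /U; ring.
rewrite mulr0 addr0 -[1](mulr1 1); rewrite eq_sym in ij.
under eq_fun do rewrite -expr2.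
exact: (has_mean_mul_coord ij (exprn_measurable 2) (exprn_measurable 2) (h2 j) (h2 i)).
Qed.

(** Third moment of the chi-square law. The first three moments of the partial sums [s k] are
    computed together by induction on [k], the square of each new coordinate being independent of
    [s k] with moments 1, 3 and 15. *)
Lemma has_mean_gaussian_enorm6 :
  has_mean P (fun w => enorm (u w) ^+ 6) (n%:R * (n%:R + 2) * (n%:R + 4)).
Proof.
pose s k w := \sum_(i < n | (i < k)%N) U i w ^+ 2.
have step k : (k <= n)%N -> [/\ has_mean P (s k) k%:R,
    has_mean P (fun w => s k w ^+ 2) (k%:R * (k%:R + 2)) &
    has_mean P (fun w => s k w ^+ 3) (k%:R * (k%:R + 2) * (k%:R + 4))].
  elim: k => [_|k IH kn].
    have s0 : s 0%N = cst 0 by apply/funext => w; rewrite /s big_pred0.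
    have E j : (fun w : Omega => cst (0 : R) w ^+ j.+1) = cst 0.
      by apply/funext => w; rewrite /= expr0n.
    by rewrite s0 !mul0r !E; split; exact: has_mean_cst.
  have [h1 h2 h3] := IH (ltnW kn).
  pose k' : 'I_n := Ordinal kn; pose v w := U k' w ^+ 2.
  have sS : s k.+1 = (fun w => s k w + v w).
    apply/funext => w; rewrite /s (bigD1 k') ?ltnSn//= addrC; congr (_ + _).
    apply: eq_bigl => i; rewrite ltnS leq_eqVlt -val_eqE/=.
    by case: eqVneq => [->|]; rewrite ?ltnn ?andbF ?andbT.
  have v1 : has_mean P v 1 := has_meanU k' has_mean_normal2.
  have v2 : has_mean P (fun w => v w ^+ 2) 3.
    have := has_meanU k' has_mean_normal4; congr (has_mean P _ _).
    by apply/funext => w; rewrite /v -exprM.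
  have v3 : has_mean P (fun w => v w ^+ 3) 15.
    have := has_meanU k' has_mean_normal6; congr (has_mean P _ _).
    by apply/funext => w; rewrite /v -exprM.
  pose D := [set i : 'I_n | (i < k)%N].
  have Dk : D `&` [set k'] = set0.
    by apply/seteqP; split => // i [ik ik']; have : (i < k)%N := ik; rewrite (ik' : i = k') ltnn.
  have ms : measurable_fun setT (s k : g_sigma_algebraType (\bigcup_(j in D) S j) -> R).
    by apply: measurable_fun_bigsum => i ik; apply: measurable_funX; exact: mgroup.
  have mv : measurable_fun setT (v : g_sigma_algebraType (\bigcup_(j in [set k']) S j) -> R).
    by apply: measurable_funX; exact: mgroup.
  have sv := has_mean_groups Dk ms mv h1 v1.
  have ssv := has_mean_groups Dk (measurable_funX 2 ms) mv h2 v1.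
  have svv := has_mean_groups Dk ms (measurable_funX 2 mv) h1 v2.
  rewrite sS; split.
  - by have := has_meanD h1 v1; congr (has_mean P _ _); rewrite natr1.
  - have := has_meanD (has_meanD h2 (has_meanZ 2 sv)) v2.
    congr (has_mean P _ _); last by rewrite -natr1; ring.
    by apply/funext => w; ring.
  - have := has_meanD (has_meanD h3 (has_meanZ 3 ssv)) (has_meanD (has_meanZ 3 svv) v3).
    congr (has_mean P _ _); last by rewrite -natr1; ring.
    by apply/funext => w; ring.
have [_ _] := step n (leqnn n); congr (has_mean P _ _); apply/funext => w.
rewrite [RHS](exprM _ 2 3) enorm_sqr; congr (_ ^+ 3).
by rewrite /s /dotv; apply: eq_big => [i|i _]; rewrite ?ltn_ord// expr2.
Qed.

End gaussian_vector.

(** * Borel measurability *)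

Section borel_vectors.
Context {R : realType} {m : nat}.

Let box (p : 'cV[rat]_m * rat) : set 'cV[R]_m :=
  [set y | forall i, `|y i ord0 - ratr (p.1 i ord0)| < ratr p.2].

(** An open set is the union of the rational boxes that it contains. These are enumerated through
    [pickle], and boxes not contained in [U] are replaced by [set0]. *)
Lemma open_measurable_cV (U : set 'cV[R]_m) : open U -> measurable U.
Proof.
move=> oU; pose F k := if @choice.unpickle ('cV[rat]_m * rat)%type k is Some p then
  (if `[< box p `<=` U >] then box p else set0) else set0.
have mbox p : measurable (box p).
  have -> : box p = \bigcap_(i in [set: 'I_m])
      [set y : 'cV[R]_m | `|y i ord0 - ratr (p.1 i ord0)| < ratr p.2].
    by apply/seteqP; split => y /= yp i; [move=> _|]; exact: yp.
  apply: fin_bigcap_measurable => // i _.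
  have mi : measurable_fun setT (fun y : 'cV[R]_m => y i ord0 - ratr (p.1 i ord0)).
    by apply: measurable_funB; [exact: measurable_mx_coord|exact: measurable_cst].
  rewrite (_ : mkset _ = (fun y : 'cV[R]_m => y i ord0 - ratr (p.1 i ord0)) @^-1`
    `]- ratr p.2, ratr p.2[).
    by rewrite -[X in measurable X]setTI; exact: mi.
  by apply/seteqP; split => y /=; rewrite in_itv/= ltr_norml.
have -> : U = \bigcup_k F k.
  apply/seteqP; split => [x Ux|x [k _]]; last first.
    by rewrite /F; case: choice.unpickle => // p; case: ifPn => // /asboolP; apply.
  have /nbhs_ballP[e /= e0 eU] : nbhs x U by exact: open_nbhs_nbhs.
  have [q] := @rat_in_itvoo R 0 (e / 2) (divr_gt0 e0 (ltr0Sn _ _)).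
  rewrite in_itv/= => /andP[q0 qe].
  have /choice[c cP] i : exists c : rat, `|x i ord0 - ratr c| < ratr q.
    have [c] := @rat_in_itvoo R (x i ord0 - ratr q) (x i ord0 + ratr q)
      ltac:(rewrite ltrBlDr -addrA ltrDl addr_gt0//).
    rewrite in_itv/= => /andP[c1 c2]; exists c; rewrite ltr_norml; lra.
  pose p := (\col_i c i : 'cV[rat]_m, q).
  exists (choice.pickle p) => //; rewrite /F choice.pickleK.
  have bU : box p `<=` U.
    move=> y yp; apply: eU; split=> // i j; rewrite (ord1 j).
    have := yp i; have := cP i; rewrite /= mxE /ball/= !ltr_norml; lra.
  rewrite (asboolT bU) => i /=; rewrite mxE; exact: cP.
apply: bigcup_measurable => k _; rewrite /F.
by case: choice.unpickle => // p; case: ifPn.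
Qed.

Lemma closed_sublevel_measurable (h : 'cV[R]_m -> R) :
  (forall c, closed [set y | h y <= c]) -> measurable_fun setT h.
Proof.
move=> hc; apply: (measurability _ (RGenOInfty.measurableE R)).
move=> /= _ [_ [a ->]] <-; rewrite setTI; apply: open_measurable_cV.
have -> : h @^-1` `]a, +oo[ = ~` [set y | h y <= a].
  by apply/seteqP; split => y /=; rewrite in_itv/= andbT ltNge => /negP.
exact: closed_openC.
Qed.

Lemma continuous_measurable_cV (h : 'cV[R]_m -> R) : continuous h -> measurable_fun setT h.
Proof.
move=> ch; apply: closed_sublevel_measurable => c.
by apply: (@preimage_closed _ _ h [set s | s <= c]); [move=> ? _; exact: ch|exact: closed_le].
Qed.

(** Each partial derivative is the pointwise limit of the difference quotients with step
    [1 / (k + 1)], and these are measurable since [h] is continuous. *)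
Lemma measurable_grad (h : 'cV[R]_m -> R) : (forall x, differentiable h x) ->
  measurable_fun setT (grad h).
Proof.
move=> dh; apply: measurable_mx => i j; rewrite (ord1 j).
pose e : 'cV[R]_m := delta_mx i ord0.
pose q k (x : 'cV[R]_m) := k.+1%:R * (h (k.+1%:R^-1 *: e + x) - h x).
have mh : measurable_fun setT h.
  apply: continuous_measurable_cV => x; exact: differentiable_continuous.
apply: (@measurable_fun_cvg _ _ _ setT q) => [k|x _].
  apply: measurable_funM; first exact: measurable_cst.
  apply: measurable_funB => //; apply: (measurableT_comp mh).
  apply: measurable_mx => i' j'.
  have -> : (fun x => (k.+1%:R^-1 *: e + x) i' j') =
      (fun x : 'cV[R]_m => (k.+1%:R^-1 *: e) i' j' + x i' j').
    by apply/funext => x; rewrite mxE.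
  by apply: measurable_funD; [exact: measurable_cst|exact: measurable_mx_coord].
rewrite /grad mxE.
have c1 : (fun t : R => t^-1 *: (h (t *: e + x) - h x)) @ 0^'+ --> 'D_e h x.
  by apply: cvg_dnbhs_at_right; exact: (@diff_derivable _ _ _ h x e (dh x)).
move/cvg_at_rightP : c1 => /(_ (fun k : nat => k.+1%:R^-1)).
have -> : (fun k : nat => k.+1%:R^-1^-1 *: (h (k.+1%:R^-1 *: e + x) - h x)) = q ^~ x.
  by apply/funext => k; rewrite invrK.
apply; split=> [k|]; first by rewrite invr_gt0.
exact: cvg_harmonic.
Qed.

End borel_vectors.

(** * The averaged zeroth-order gradient *)

Section vector_sums.
Context {R : realType} {m : nat}.

Lemma coord_sum (I : Type) (r : seq I) (y : I -> 'cV[R]_m) i :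
  (\sum_(t <- r) y t) i ord0 = \sum_(t <- r) y t i ord0.
Proof. by rewrite summxE. Qed.

Lemma enorm_sqr_coord (x : 'cV[R]_m) : enorm x ^+ 2 = \sum_i x i ord0 ^+ 2.
Proof. by rewrite enorm_sqr; apply: eq_bigr => i _; rewrite expr2. Qed.

Lemma sqr_sum_le (I : Type) (r : seq I) (a : I -> R) :
  (\sum_(t <- r) a t) ^+ 2 <= (size r)%:R * \sum_(t <- r) a t ^+ 2.
Proof.
elim: r => [|t r IH]; first by rewrite !big_nil expr0n mul0r.
rewrite !big_cons /= -natr1; set s := \sum_(j <- r) a j in IH *.
set q := \sum_(j <- r) a j ^+ 2 in IH *.
have [/eqP r0|r0] := boolP (size r == 0%N).
  have s0 : s = 0 by rewrite /s (size0nil r0) big_nil.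
  have q0 : q = 0 by rewrite /q (size0nil r0) big_nil.
  by rewrite r0 s0 q0 !addr0 add0r mul1r.
have N0 : 0 < (size r)%:R :> R by rewrite ltr0n lt0n.
move: (size r)%:R N0 IH => N N0 IH.
(* AM-GM: 2 a s <= N a^2 + s^2 / N *)
have : 0 <= (N * a t - s) ^+ 2 / N by rewrite divr_ge0 ?sqr_ge0// ltW.
have -> : (N * a t - s) ^+ 2 / N = N * a t ^+ 2 - 2 * a t * s + s ^+ 2 / N.
  by field; rewrite gt_eqF.
have : s ^+ 2 / N <= q by rewrite ler_pdivrMr// mulrC.
by rewrite sqrrD mulr2n; lra.
Qed.

Lemma enorm_sum_sqr_le (I : Type) (r : seq I) (y : I -> 'cV[R]_m) :
  enorm (\sum_(t <- r) y t) ^+ 2 <= (size r)%:R * \sum_(t <- r) enorm (y t) ^+ 2.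
Proof.
rewrite enorm_sqr_coord.
under [X in _ <= _ * X]eq_bigr do rewrite enorm_sqr_coord.
rewrite exchange_big mulr_sumr; apply: ler_sum => i _.
by rewrite coord_sum sqr_sum_le.
Qed.

End vector_sums.

Section zeroth_order_expansion.
Context {R : realType} {m : nat}.
Implicit Types (h : 'cV[R]_m -> R) (x u : 'cV[R]_m).

(** The Taylor error over the step [mu *: u] is at most [Lf * mu ^+ 2 * enorm u ^+ 2 / 2]; dividing
    by [mu], multiplying by [u] and squaring produces the sixth power. *)
Lemma zeroth_order_remainder h (Lf mu : R) x u : 0 < mu ->
  (forall y, differentiable h y) ->
  (forall y z, enorm (grad h y - grad h z) <= Lf * enorm (y - z)) ->
  enorm (((h (x + mu *: u) - h x) / mu) *: u - dotv (grad h x) u *: u) ^+ 2 <=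
  (Lf * mu / 2) ^+ 2 * enorm u ^+ 6.
Proof.
move=> mu0 dh lip; set v := mu *: u.
have ev : enorm v = mu * enorm u by rewrite enormZ gtr0_norm.
have lip1 t : 0 <= t -> enorm (grad h (x + t *: v) - grad h x) * enorm v <=
    t * (Lf * enorm v ^+ 2).
  move=> t0; have := lip (x + t *: v) x.
  rewrite (addrC x) addrK enormZ ger0_norm// => /(ler_wpM2r (enorm_ge0 v)); lra.
have up := @le_taylor1 _ _ h x v (Lf * enorm v ^+ 2) dh.
have lo := @ge_taylor1 _ _ h x v (Lf * enorm v ^+ 2) dh.
have {}up : h (x + v) <= h x + dotv (grad h x) v + Lf * enorm v ^+ 2 / 2.
  by apply: up => t t0; apply: le_trans (lip1 t t0); exact: dotv_le_enorm.
have {}lo : h x + dotv (grad h x) v - Lf * enorm v ^+ 2 / 2 <= h (x + v).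
  apply: lo => t t0; apply: le_trans (lip1 t t0).
  by rewrite -dotvNl -(enormN (_ - _)) dotv_le_enorm.
rewrite -scalerBl enormZ exprMn real_normK ?num_real//.
have -> : enorm u ^+ 6 = (enorm u ^+ 2) ^+ 2 * enorm u ^+ 2.
  by rewrite -exprM -exprD.
rewrite mulrA ler_wpM2r ?sqr_ge0// -exprMn.
rewrite -[leLHS]real_normK ?num_real// -[leRHS]real_normK ?num_real//.
rewrite lerXn2r ?nnegrE//; apply: le_trans (ler_norm _).
rewrite dotvZr ev in up lo.
rewrite ler_norml -(ler_pM2l mu0) -[X in _ && X](ler_pM2l mu0).
rewrite !(mulrBr mu) mulrN (mulrCA mu _ mu^-1) divff ?gt_eqF// mulr1.
by apply/andP; split; lra.
Qed.

End zeroth_order_expansion.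

Section zeroth_order_batch.
Context {R : realType} {d dXi : measure_display}.
Context {Omega : measurableType d} {Xi : measurableType dXi} {m : nat}.
Variables (P : probability Omega R) (Q : probability Xi R).
Variables (F : 'cV[R]_m -> Xi -> R) (f : 'cV[R]_m -> R) (y : 'cV[R]_m).
Variables (mu Lf sigma M : R) (N : nat).
Variables (z : nat -> Omega -> Xi) (u : nat -> Omega -> 'cV[R]_m).

Let D (x : Xi) := grad (F ^~ x) y.
Let g := grad f y.

Hypotheses (mu0 : 0 < mu) (N0 : (0 < N)%N).
Hypothesis mF : measurable_fun setT (fun p : 'cV[R]_m * Xi => F p.1 p.2).
Hypothesis mean_D : forall i, has_mean Q (fun x => D x i ord0) (g i ord0).
Hypothesis var_D :
  (\int[Q]_x ((enorm (D x - g)) ^+ 2)%:E <= (sigma ^+ 2)%:E)%E.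
Hypothesis gM : enorm g <= M.
Hypothesis smooth : {ae Q, forall x, (forall v, differentiable (F ^~ x) v) /\
  forall v w, enorm (grad (F ^~ x) v - grad (F ^~ x) w) <= Lf * enorm (v - w)}.
Hypotheses (mz : forall t, measurable_fun setT (z t))
  (mu_ : forall t, measurable_fun setT (u t)).
Hypothesis law_z : forall t, (1 <= t <= N)%N ->
  forall A, measurable A -> P (z t @^-1` A) = Q A.
Hypothesis law_u : forall t, (1 <= t <= N)%N -> std_normal P (u t).
Let Sz t : set (set Omega) := g_sigma_algebra_preimage (z t).
Let Su t : set (set Omega) := g_sigma_algebra_preimage (u t).
Hypothesis indep_zu : forall t, (1 <= t <= N)%N -> independent P (Sz t) (Su t).
Hypothesis indep_steps : forall t t', (1 <= t <= N)%N -> (1 <= t' <= N)%N -> t != t' ->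
  independent P (Sz t `|` Su t) (Sz t' `|` Su t').

(** Each [(D_i - g_i) ^+ 2] is dominated by the integrable total variance, so [D] has a second
    moment matrix [c]. Its trace is the variance plus [enorm g ^+ 2]; of the off-diagonal entries
    only existence matters. *)
Let second_moment_D : exists c : 'I_m -> 'I_m -> R,
  (forall j k, has_mean Q (fun x => D x j ord0 * D x k ord0) (c j k)) /\
  \sum_j c j j <= M ^+ 2 + sigma ^+ 2.
Proof.
have mD i := has_mean_measurable (mean_D i).
pose V x := enorm (D x - g) ^+ 2.
have VE x : V x = \sum_i (D x i ord0 - g i ord0) ^+ 2.
  by rewrite /V enorm_sqr_coord; apply: eq_bigr => i _; rewrite !mxE.
have mV : measurable_fun setT V.
  rewrite (_ : V = (fun x => \sum_i (D x i ord0 - g i ord0) ^+ 2)); last first.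
    by apply/funext => x; rewrite VE.
  by apply: measurable_sum => i; apply: measurable_funX; exact: measurable_funB.
have [v hV] : exists v, has_mean Q V v.
  apply: (ge0_has_mean mV) => [x|]; first exact: sqr_ge0.
  exact: (le_lt_trans var_D (ltry _)).
have vs : v <= sigma ^+ 2 by rewrite -lee_fin -hV.2.
have he i : exists e, has_mean Q (fun x => (D x i ord0 - g i ord0) ^+ 2) e.
  apply: (has_mean_dominated (P := Q) _ hV _).
    by apply: measurable_funX; exact: measurable_funB.
  move=> x; rewrite ger0_norm ?sqr_ge0// VE (bigD1 i)//= lerDl.
  by apply: sumr_ge0 => j _; exact: sqr_ge0.
have [e eP] := choice he.
have ev : \sum_i e i = v.
  apply: (has_mean_unique _ hV); rewrite (funext VE).
  by apply: has_mean_sum => i _; exact: eP.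
have hsqr i : has_mean Q (fun x => D x i ord0 ^+ 2) (e i + g i ord0 ^+ 2).
  have := has_meanD (eP i) (has_meanB (has_meanZ (2 * g i ord0) (mean_D i))
    (has_mean_cst Q (g i ord0 ^+ 2))).
  congr (has_mean Q _ _); last by ring.
  by apply/funext => x /=; ring.
have hmul j k : exists c, has_mean Q (fun x => D x j ord0 * D x k ord0) c.
  exact: (has_mean_sqr_mul (mD j) (mD k) (hsqr j) (hsqr k)).
have [c cP] := choice (fun jk : 'I_m * 'I_m => hmul jk.1 jk.2).
exists (fun j k => c (j, k)); split=> [j k|]; first exact: (cP (j, k)).
rewrite (eq_bigr (fun i => e i + g i ord0 ^+ 2)) => [|i _]; last first.
  apply: (has_mean_unique (cP (i, i))); have := hsqr i.
  by under eq_fun do rewrite expr2.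
rewrite big_split/= ev -enorm_sqr_coord addrC lerD//.
by rewrite lerXn2r ?nnegrE ?enorm_ge0// (le_trans (enorm_ge0 g)).
Qed.

(* The [i]-th coordinate of the centered linear part <grad F(y, z_t), u_t> u_t. *)
Let A i t w := dotv (D (z t w)) (u t w) * u t w i ord0 - g i ord0.

Let mD j : measurable_fun setT (fun x => D x j ord0).
Proof. exact: has_mean_measurable (mean_D j). Qed.

Let indep_Du t (h : Xi -> R) (k : 'cV[R]_m -> R) : (1 <= t <= N)%N ->
  measurable_fun setT h -> measurable_fun setT k ->
  independent_fun P (h \o z t) (k \o u t).
Proof.
move=> tN mh mk; apply: (independent_fun_sigma (indep_zu tN)) => _ B mB;
  rewrite setTI; apply: sub_sigma_algebra.
  by exists (h @^-1` B); rewrite ?setTI// -[X in measurable X]setTI; exact: mh.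
by exists (k @^-1` B); rewrite ?setTI// -[X in measurable X]setTI; exact: mk.
Qed.

Let mean_z t h c : (1 <= t <= N)%N -> has_mean Q h c -> has_mean P (h \o z t) c.
Proof. by move=> tN; apply: has_mean_law; [exact: mz|exact: law_z]. Qed.

Let mu_i t i : measurable_fun setT (fun w => u t w i ord0).
Proof. exact: (measurableT_comp (measurable_mx_coord i ord0) (mu_ t)). Qed.

(** Sample and direction are independent and [u_j u_i] has mean [(i == j)], so the linear part is
    unbiased for [g]. *)
Let mean_A i t : (1 <= t <= N)%N -> has_mean P (A i t) 0.
Proof.
move=> tN; have -> : A i t = (fun w => (\sum_j D (z t w) j ord0 *
    (u t w j ord0 * u t w i ord0)) - g i ord0).
  by apply/funext => w; rewrite /A mulr_suml; congr (_ - _); apply: eq_bigr => j _;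
    rewrite mulrA.
have g0 : (\sum_j g j ord0 * (j == i)%:R) - g i ord0 = 0.
  rewrite (bigD1 i)//= eqxx mulr1 big1 ?addr0 ?subrr// => j /negbTE ->.
  by rewrite mulr0.
rewrite -[X in has_mean _ _ X]g0; apply: has_meanB; last exact: has_mean_cst.
apply: has_mean_sum => j _; apply: has_mean_indep_mul.
- apply: (indep_Du (h := fun x => D x j ord0) (k := fun v => v j ord0 * v i ord0) tN) => //.
  by apply: measurable_funM; exact: measurable_mx_coord.
- exact: (mean_z tN (mean_D j)).
- exact: (has_mean_gaussian_mul (mu_ t) (law_u tN)).
Qed.

(** Expanding the square and inserting the fourth moments leaves the diagonal of [c] weighted by
    [1 + 2 * (i == j)]. Summing over [i] gives [m + 2] times the trace. *)
Let mean_A_sqr : exists a : 'I_m -> R,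
  (forall i t, (1 <= t <= N)%N -> has_mean P (fun w => A i t w ^+ 2) (a i)) /\
  \sum_i a i <= (m%:R + 2) * (M ^+ 2 + sigma ^+ 2).
Proof.
have [c [cP cs]] := second_moment_D.
exists (fun i => (\sum_j c j j * (1 + 2 * (i == j)%:R)) - g i ord0 ^+ 2).
split=> [i t tN|].
  have hB : has_mean P (fun w => \sum_j \sum_k (D (z t w) j ord0 * D (z t w) k ord0) *
      (u t w j ord0 * u t w k ord0 * u t w i ord0 ^+ 2))
      (\sum_j \sum_k c j k * ((j == k)%:R * (1 + 2 * (i == j)%:R))).
    apply: has_mean_sum => j _; apply: has_mean_sum => k _.
    apply: has_mean_indep_mul.
    - apply: (indep_Du (h := fun x => D x j ord0 * D x k ord0)
        (k := fun v => v j ord0 * v k ord0 * v i ord0 ^+ 2) tN).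
        exact: measurable_funM.
      apply: measurable_funM; last by apply: measurable_funX; exact: measurable_mx_coord.
      by apply: measurable_funM; exact: measurable_mx_coord.
    - exact: (mean_z tN (cP j k)).
    - exact: (has_mean_gaussian_mul_sqr (mu_ t) (law_u tN)).
  have := has_meanB hB (has_meanD (has_meanZ (2 * g i ord0) (mean_A i tN))
    (has_mean_cst P (g i ord0 ^+ 2))).
  congr (has_mean P _ _); last first.
    rewrite mulr0 add0r; congr (_ - _); apply: eq_bigr => j _.
    rewrite (bigD1 j)//= eqxx mul1r big1 ?addr0// => k kj.
    by rewrite eq_sym (negbTE kj) mul0r mulr0.
  apply/funext => w /=; rewrite /A.
  have -> : \sum_j \sum_k D (z t w) j ord0 * D (z t w) k ord0 *
      (u t w j ord0 * u t w k ord0 * u t w i ord0 ^+ 2) =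
      dotv (D (z t w)) (u t w) ^+ 2 * u t w i ord0 ^+ 2.
    rewrite [dotv _ _ ^+ 2]expr2 /dotv 2![in RHS]mulr_suml; apply: eq_bigr => j _.
    rewrite [in RHS]mulr_sumr [in RHS]mulr_suml; apply: eq_bigr => k _; ring.
  ring.
rewrite big_split/= sumrN exchange_big/=.
have -> : \sum_j \sum_i c j j * (1 + 2 * (i == j)%:R) = \sum_j (m%:R + 2) * c j j.
  apply: eq_bigr => j _; rewrite -mulr_sumr mulrC big_split/= sumr_const card_ord.
  rewrite -mulr_sumr (bigD1 j)//= eqxx big1 ?addr0 ?mulr1// => i /negbTE ->.
  by [].
rewrite -mulr_sumr lerBlDr ler_wpDr ?sumr_ge0// => [i _|]; first exact: sqr_ge0.
by rewrite ler_wpM2l.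
Qed.

Let mean_A_cross i t t' : (1 <= t <= N)%N -> (1 <= t' <= N)%N -> t != t' ->
  has_mean P (fun w => A i t w * A i t' w) 0.
Proof.
move=> tN t'N tt'; rewrite -[0](mulr0 0).
have mA s : measurable_fun setT (A i s : g_sigma_algebraType (Sz s `|` Su s) -> R).
  have mui j : measurable_fun setT
      ((fun w => u s w j ord0) : g_sigma_algebraType (Sz s `|` Su s) -> R).
    move=> _ B mB; rewrite setTI; apply: sub_sigma_algebra; right.
    exists ((fun v : 'cV[R]_m => v j ord0) @^-1` B); rewrite ?setTI//.
    by rewrite -[X in measurable X]setTI; exact: measurable_mx_coord.
  have mDj j : measurable_fun setT
      ((fun w => D (z s w) j ord0) : g_sigma_algebraType (Sz s `|` Su s) -> R).
    move=> _ B mB; rewrite setTI; apply: sub_sigma_algebra; left.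
    exists ((fun x => D x j ord0) @^-1` B); rewrite ?setTI//.
    by rewrite -[X in measurable X]setTI; exact: mD.
  apply: measurable_funB; last exact: measurable_cst.
  apply: measurable_funM => //; apply: measurable_sum => j.
  exact: measurable_funM.
by apply: has_mean_indep_mul; [exact: (independent_fun_sigma (indep_steps tN t'N tt'))|
  exact: mean_A|exact: mean_A].
Qed.

Let r := index_iota 1 N.+1.
Let rN t : t \in r -> (1 <= t <= N)%N. Proof. by rewrite mem_index_iota. Qed.
Let sr : size r = N. Proof. by rewrite size_iota subn1. Qed.

(** Different samples are independent and centered, so the cross terms vanish and the sum grows like
    [N] instead of [N ^+ 2]; averaging later turns this into [1 / N]. *)
Let mean_sum_A_sqr : exists2 s, has_mean P (fun w => \sum_i (\sum_(t <- r) A i t w) ^+ 2) s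
  & s <= N%:R * ((m%:R + 2) * (M ^+ 2 + sigma ^+ 2)).
Proof.
have [a [aP as_]] := mean_A_sqr.
exists (\sum_i \sum_(t <- r) \sum_(t' <- r) (t == t')%:R * a i); last first.
  apply: (@le_trans _ _ (N%:R * \sum_i a i)); last by rewrite ler_wpM2l.
  rewrite mulr_sumr; apply: ler_sum => i _.
  rewrite (@eq_big_seq _ _ _ _ _ _ (fun=> a i)) => [|t tr].
    by rewrite big_const_seq count_predT sr iter_addr addr0 mulr_natl.
  rewrite (bigD1_seq t)//= ?iota_uniq// eqxx mul1r big1 ?addr0// => t'.
  by rewrite eq_sym => /negbTE ->; rewrite mul0r.
apply: has_mean_sum => i _.
have -> : (fun w => (\sum_(t <- r) A i t w) ^+ 2) =
    (fun w => \sum_(t <- r) \sum_(t' <- r) A i t w * A i t' w).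
  by apply/funext => w; rewrite expr2 mulr_suml; apply: eq_bigr => t _; rewrite mulr_sumr.
(* Membership in [r] is written into the sums because the moments are known only for [1 <= t <= N],
   and [has_mean_sum] hands its predicate to each term. *)
have -> : (fun w => \sum_(t <- r) \sum_(t' <- r) A i t w * A i t' w) =
    (fun w => \sum_(t <- r | t \in r) \sum_(t' <- r | t' \in r) A i t w * A i t' w).
  apply/funext => w; rewrite [LHS]big_seq; apply: eq_bigr => t _.
  by rewrite [LHS]big_seq.
rewrite big_seq; apply: has_mean_sum => t /rN tN.
rewrite big_seq; apply: has_mean_sum => t' /rN t'N.
have [<-|tt'] := eqVneq t t'; last by rewrite mul0r; exact: mean_A_cross.
by rewrite mul1r; have := aP i t tN; under eq_fun do rewrite expr2.
Qed.

Let mean_enorm6 : has_mean P (fun w => \sum_(t <- r) enorm (u t w) ^+ 6)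
  (N%:R * (m%:R * (m%:R + 2) * (m%:R + 4))).
Proof.
have -> : (fun w => \sum_(t <- r) enorm (u t w) ^+ 6) =
    (fun w => \sum_(t <- r | t \in r) enorm (u t w) ^+ 6).
  by apply/funext => w; rewrite [LHS]big_seq.
have -> : N%:R * (m%:R * (m%:R + 2) * (m%:R + 4)) =
    \sum_(t <- r | t \in r) (m%:R * (m%:R + 2) * (m%:R + 4)) :> R.
  by rewrite -big_seq big_const_seq count_predT sr iter_addr addr0 mulr_natl.
apply: has_mean_sum => t /rN tN.
exact: (has_mean_gaussian_enorm6 (mu_ t) (law_u tN)).
Qed.

Let G w := zo_batch F mu N y (fun t => z t w) (fun t => u t w).

(** The error is the average of the centered linear parts plus that of the Taylor remainders. The
    first square stays unexpanded, to profit from independence; the second is bounded termwise by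
    Cauchy-Schwarz. *)
Let batch_le w : (forall t, (1 <= t <= N)%N ->
    (forall v, differentiable (F ^~ (z t w)) v) /\
    forall v v', enorm (grad (F ^~ (z t w)) v - grad (F ^~ (z t w)) v') <=
      Lf * enorm (v - v')) ->
  enorm (G w - g) ^+ 2 <=
    2 * N%:R^-1 ^+ 2 * (\sum_i (\sum_(t <- r) A i t w) ^+ 2) +
    2 * (Lf * mu / 2) ^+ 2 * N%:R^-1 * (\sum_(t <- r) enorm (u t w) ^+ 6).
Proof.
move=> good; have Npos : 0 < N%:R :> R by rewrite ltr0n.
pose a t := dotv (D (z t w)) (u t w) *: u t w - g.
pose e t := zo_grad F mu y (z t w) (u t w) - dotv (D (z t w)) (u t w) *: u t w.
have -> : G w - g = N%:R^-1 *: (\sum_(t <- r) a t) + N%:R^-1 *: (\sum_(t <- r) e t).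
  rewrite -scalerDr -big_split/=.
  rewrite (eq_bigr (fun t => zo_grad F mu y (z t w) (u t w) - g)); last first.
    by move=> t _; rewrite /a /e addrC addrA subrK.
  rewrite sumrB big_const_seq count_predT sr iter_addr addr0 scalerBr.
  by rewrite -[g *+ N]scaler_nat scalerA mulVf ?scale1r// gt_eqF.
apply: (le_trans (enorm_sqrD_le _ _)).
have nz (v : 'cV[R]_m) : enorm (N%:R^-1 *: v) ^+ 2 = N%:R^-1 ^+ 2 * enorm v ^+ 2.
  by rewrite enormZ exprMn real_normK ?num_real.
rewrite !nz; apply: lerD; rewrite -!(mulrA 2) ler_wpM2l//.
  rewrite ler_wpM2l ?sqr_ge0// enorm_sqr_coord.
  rewrite le_eqVlt; apply/orP; left; apply/eqP; apply: eq_bigr => i _.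
  rewrite coord_sum; congr (_ ^+ 2); apply: eq_bigr => t _.
  by rewrite /a /A !mxE.
apply: (le_trans (ler_wpM2l _ (enorm_sum_sqr_le _ _))); first exact: sqr_ge0.
rewrite sr mulrA [X in X * _ <= _](_ : _ = N%:R^-1); last first.
  by rewrite expr2 -mulrA mulVf ?mulr1// gt_eqF.
rewrite [leRHS](_ : _ = N%:R^-1 * ((Lf * mu / 2) ^+ 2 *
  \sum_(t <- r) enorm (u t w) ^+ 6)); last by ring.
rewrite ler_wpM2l ?invr_ge0// mulr_sumr.
rewrite big_seq [leRHS]big_seq.
apply: ler_sum => t /rN tN; have [dF lip] := good t tN.
exact: zeroth_order_remainder.
Qed.

Lemma zo_batch_error : (\int[P]_w (enorm (G w - g) ^+ 2)%:E <=
  (2 * ((m%:R + 2) * (M ^+ 2 + sigma ^+ 2)) / N%:R +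
   mu ^+ 2 / 2 * Lf ^+ 2 * (m%:R * (m%:R + 2) * (m%:R + 4)))%:E)%E.
Proof.
have Npos : 0 < N%:R :> R by rewrite ltr0n.
have [s hs sle] := mean_sum_A_sqr.
have hbound := has_meanD (has_meanZ (2 * N%:R^-1 ^+ 2) hs)
  (has_meanZ (2 * (Lf * mu / 2) ^+ 2 * N%:R^-1) mean_enorm6).
have mG : measurable_fun setT (fun w => enorm (G w - g) ^+ 2).
  have -> : (fun w => enorm (G w - g) ^+ 2) =
      (fun w => \sum_i (N%:R^-1 * (\sum_(t <- r) (F (y + mu *: u t w) (z t w) -
         F y (z t w)) / mu * u t w i ord0) - g i ord0) ^+ 2).
    apply/funext => w; rewrite enorm_sqr_coord; apply: eq_bigr => i _.
    rewrite /G /zo_batch !mxE coord_sum; congr ((_ * _ - _) ^+ 2).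
    by apply: eq_bigr => t _; rewrite /zo_grad !mxE.
  apply: measurable_sum => i; apply: measurable_funX; apply: measurable_funB => //.
  apply: measurable_funM => //; apply: measurable_sum => t.
  apply: measurable_funM => //; apply: measurable_funM => //.
  have mpert : measurable_fun setT (fun w => (y + mu *: u t w, z t w)).
    apply: measurable_fun_pair; last exact: mz.
    apply: measurable_mx => k l; rewrite (ord1 l).
    have -> : (fun w => (y + mu *: u t w) k ord0) = (fun w => y k ord0 + mu * u t w k ord0).
      by apply/funext => w; rewrite !mxE.
    by apply: measurable_funD => //; exact: measurable_funM.
  have mbase : measurable_fun setT (fun w => (y, z t w)).
    by apply: measurable_fun_pair; last exact: mz.
  exact: (measurable_funB (measurableT_comp mF mpert) (measurableT_comp mF mbase)).
apply: (@le_trans _ _ (\int[P]_w (2 * N%:R^-1 ^+ 2 * (\sum_i (\sum_(t <- r) A i t w) ^+ 2) +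
    2 * (Lf * mu / 2) ^+ 2 * N%:R^-1 * (\sum_(t <- r) enorm (u t w) ^+ 6))%:E)%E).
  apply: ae_ge0_le_integral => //.
  - by move=> w _; rewrite lee_fin sqr_ge0.
  - exact/measurable_EFinP.
  - move=> w _; rewrite lee_fin.
    have s1 : 0 <= \sum_i (\sum_(t <- r) A i t w) ^+ 2.
      by apply: sumr_ge0 => i _; exact: sqr_ge0.
    have s2 : 0 <= \sum_(t <- r) enorm (u t w) ^+ 6.
      by apply: sumr_ge0 => t _; rewrite exprn_ge0// enorm_ge0.
    apply: addr_ge0; apply: mulr_ge0 => //.
    by rewrite divr_ge0// mulr_ge0// sqr_ge0.
  - by apply/measurable_EFinP; exact: (has_mean_measurable hbound).
  (* Smoothness holds almost surely for [Q]; the exceptional set is pulled back by [z t], whose law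
     is [Q]. *)
  - have goodt t : (1 <= t <= N)%N -> {ae P, forall w,
        (forall v, differentiable (F ^~ (z t w)) v) /\
        forall v v', enorm (grad (F ^~ (z t w)) v - grad (F ^~ (z t w)) v') <=
        Lf * enorm (v - v')}.
      move=> tN; case: smooth => B [mB B0 goodB]; exists (z t @^-1` B); split.
      + by rewrite -[X in measurable X]setTI; exact: mz.
      + by apply: etrans (law_z tN mB) _.
      + by move=> w /= bad; exact: goodB.
    have : {ae P, forall w t, (1 <= t <= N)%N ->
        (forall v, differentiable (F ^~ (z t w)) v) /\
        forall v v', enorm (grad (F ^~ (z t w)) v - grad (F ^~ (z t w)) v') <=
        Lf * enorm (v - v')}.
      have H t : {ae P, forall w, (1 <= t <= N)%N ->
          (forall v, differentiable (F ^~ (z t w)) v) /\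
          forall v v', enorm (grad (F ^~ (z t w)) v - grad (F ^~ (z t w)) v') <=
          Lf * enorm (v - v')}.
        have [tN|tN] := boolP (1 <= t <= N)%N; last exact: aeW.
        by apply: filterS (goodt t tN) => w.
      exact/ae_foralln.
    by apply: filterS => w goodw _; rewrite lee_fin; exact: batch_le.
rewrite hbound.2 lee_fin lerD//.
  apply: (@le_trans _ _ _ _ _ (ler_wpM2l _ sle)); first by rewrite mulr_ge0 ?sqr_ge0.
  by rewrite le_eqVlt; apply/orP; left; apply/eqP; field; rewrite gt_eqF.
by rewrite le_eqVlt; apply/orP; left; apply/eqP; field; rewrite gt_eqF.
Qed.

End zeroth_order_batch.

(** * The method *)

Section random_index.
Context {R : realType} {d d' : measure_display} {Omega : measurableType d}.
Context {I : measurableType d'}.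
Variables (P : probability Omega R) (i_ : Omega -> I) (r : seq I).
Variable Y : I -> Omega -> R.
Hypotheses (r_uniq : uniq r) (i_r : forall w, i_ w \in r).
Hypotheses (measurable_set1 : forall i : I, measurable [set i]).
Hypotheses (m_i : measurable_fun setT i_).
Hypothesis mY : forall i, i \in r -> measurable_fun setT (Y i).

(** [Y] is controlled only for indices in [r]; extension by 0 makes every term of the sum
    measurable. *)
Let Z i w : R := if i \in r then Y i w else 0.

Let sum_indexed w : Y (i_ w) w = \sum_(i <- r) \1_(i_ @^-1` [set i]) w * Z i w.
Proof.
rewrite (bigD1_seq (i_ w))//= big1 ?addr0.
  by rewrite /Z i_r indicE mem_set ?mul1r.
by move=> i /eqP ine; rewrite indicE memNset ?mul0r// => /= e; exact: ine.
Qed.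

Let mZ i : measurable_fun setT (Z i).
Proof.
rewrite /Z; have [/mY//|ir] := boolP (i \in r).
exact: measurable_cst.
Qed.

Let m_preimage i : measurable (i_ @^-1` [set i]).
Proof. by rewrite -[X in measurable X]setTI; exact: m_i. Qed.

Lemma measurable_random_index : measurable_fun setT (fun w => Y (i_ w) w).
Proof.
under eq_fun do rewrite sum_indexed.
by apply: measurable_sum => i; apply: measurable_funM.
Qed.

(** The integral is split over the events on which the index takes a given value, and independence
    factors each term. It is used for the block index and for the stopping index. *)
Lemma ge0_integral_random_index (q : I -> R) :
  (forall i, i \in r -> P (i_ @^-1` [set i]) = (q i)%:E) ->
  (forall i w, i \in r -> 0 <= Y i w) ->
  (forall i, i \in r -> independent_fun P i_ (Y i)) ->
  (\int[P]_w (Y (i_ w) w)%:E = \sum_(i <- r) (q i)%:E * \int[P]_w (Y i w)%:E)%E.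
Proof.
move=> Pq Y0 iY.
have Z0 i w : 0 <= Z i w by rewrite /Z; case: ifPn => // /Y0.
under eq_integral do rewrite sum_indexed -sumEFin.
rewrite ge0_integral_sum//; last 2 first.
- by move=> i; apply/measurable_EFinP; apply: measurable_funM.
- by move=> i w _; rewrite lee_fin mulr_ge0.
rewrite big_seq_cond [RHS]big_seq_cond; apply: eq_bigr => i /andP[ir _].
rewrite ge0_integral_indep_mul//.
- rewrite integral_indic// setIT /Z ir; congr (_ * _)%E; exact: Pq.
- have -> : \1_(i_ @^-1` [set i]) = (\1_[set i] : I -> R) \o i_ by [].
  rewrite /Z ir; apply: (independent_fun_comp (g := id)) (iY _ ir) => //.
Qed.

End random_index.

Section block_smoothness.
Context {R : realType} {b : nat} {n_ : 'I_b.+1 -> nat}.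
Local Notation n := (\sum_s n_ s)%N.
Context {dXi : measure_display} {Xi : measurableType dXi} (Q : probability Xi R).
Variables (F : 'cV[R]_n -> Xi -> R) (f : 'cV[R]_n -> R).
Variables (Lf : R) (L : 'I_b.+1 -> R).
Hypothesis mean_F : forall x, has_mean Q (F x) (f x).
Hypothesis mean_gradF : forall x i,
  has_mean Q (fun z => grad (F ^~ z) x i ord0) (grad f x i ord0).
Hypothesis smooth : assumption2 Q F Lf L.

(* The block descent inequality holds for almost every F(., z); taking
   expectations transfers it to f without differentiating under the integral. *)
Lemma block_descent s x (h : 'cV[R]_(n_ s)) :
  f (x + Ublk s *m h) <=
  f x + dotv (blk s (grad f x)) h + L s / 2 * enorm h ^+ 2.
Proof.
pose v := Ublk s *m h.
have hR : has_mean Q (fun z => F x z + dotv (grad (F ^~ z) x) v +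
    L s / 2 * enorm h ^+ 2) (f x + dotv (grad f x) v + L s / 2 * enorm h ^+ 2).
  apply: has_meanD; last exact: has_mean_cst.
  apply: has_meanD; first exact: mean_F.
  apply: has_mean_sum => i _; rewrite mulrC.
  by under eq_fun do rewrite mulrC; exact: has_meanZ.
rewrite -dotv_Ublk; apply: (has_mean_le (mean_F _) hR).
apply: filterS smooth => z [dF _ lip].
rewrite [L s / 2 * _]mulrAC; apply: le_taylor1 => // t t0.
rewrite dotv_Ublk (le_trans (dotv_le_enorm _ _))// blkD blkN.
have := lip s x (t *: h); rewrite -scalemxAr enormZ ger0_norm//.
by move=> /(ler_wpM2r (enorm_ge0 h)); rewrite -/v; lra.
Qed.

End block_smoothness.

Section block_measurability.
Context {R : realType} {b : nat} {n_ : 'I_b.+1 -> nat}.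
Local Notation n := (\sum_s n_ s)%N.

Lemma measurable_blk s : measurable_fun setT (@blk R b n_ s).
Proof.
apply: measurable_mx => i j; rewrite (ord1 j).
have -> : (fun x : 'cV[R]_n => blk s x i ord0) =
    (fun x => \sum_k (Ublk s)^T i k * x k ord0) by apply/funext => x; rewrite mxE.
apply: measurable_sum => k; apply: measurable_funM; first exact: measurable_cst.
exact: measurable_mx_coord.
Qed.

Lemma measurable_enorm m : measurable_fun setT (@enorm R m).
Proof. by apply: continuous_measurable_cV; exact: enorm_continuous. Qed.

Lemma measurable_sum_blk (chi : forall s, 'cV[R]_(n_ s) -> R) :
  (forall s, closed_convex_function (chi s)) -> measurable_fun setT (sum_blk chi).
Proof.
move=> chiP; apply: measurable_sum => s.
have mchi : measurable_fun setT (chi s).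
  apply: closed_sublevel_measurable => c.
  have := @closed_epigraph_sublevel _ _ _ _ c (chiP s).1 (@cst_continuous _ _ (0 : R)).
  by congr closed; apply/seteqP; split => y /=; rewrite add0r.
exact: (measurableT_comp mchi (@measurable_blk s)).
Qed.

(** The map is a Lipschitz function of one vector parameter, composed with a measurable expression
    in [x], [g] and [grad phi x]. *)
Lemma measurable_prox_sqr m (X : set 'cV[R]_m) (phi chi : 'cV[R]_m -> R) (alpha : R) :
  closed X -> convex_set (M := 'cV[R]_m) X -> X !=set0 ->
  closed_convex_function chi -> (forall y, differentiable phi y) ->
  strongly_convex1 phi -> 0 < alpha ->
  measurable_fun setT (fun xg : 'cV[R]_m * 'cV[R]_m => prox X phi chi xg.1 xg.2 alpha).
Proof.
move=> cX cvX X0 chiP dphi sc a0.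
(* The base point is frozen at 0 and the shift is chosen so that the parameter
   [g - grad phi x / alpha] equals [c]. *)
pose psi c := prox X phi chi 0 (c + alpha^-1 *: grad phi 0) alpha.
(* The proximal point depends on (x, g) only through g - grad phi x / alpha. *)
have psiE x g : prox X phi chi x g alpha = psi (g - alpha^-1 *: grad phi x).
  apply/eqP; rewrite -subr_eq0; apply/eqP/enorm_eq0/eqP.
  rewrite eq_le enorm_ge0 andbT.
  apply: (le_trans (prox_lipschitz cX cvX chiP dphi sc _ _ _ _ X0 a0)).
  by rewrite addrK subrr /enorm dotv0r sqrtr0 mulr0.
have mpsi : measurable_fun setT psi.
  apply: measurable_mx => i j; rewrite (ord1 j); apply: continuous_measurable_cV.
  apply: (@lipschitz_continuous _ _ _ alpha) => c c'.
  have -> : psi c i ord0 - psi c' i ord0 = (psi c - psi c') i ord0 by rewrite !mxE.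
  apply: (le_trans (ler_coord_enorm _ _)).
  apply: (le_trans (prox_lipschitz cX cvX chiP dphi sc _ _ _ _ X0 a0)).
  by rewrite !addrK.
under eq_fun do rewrite psiE.
apply: (measurableT_comp mpsi); apply: measurable_mx => i j; rewrite (ord1 j).
have mgphi := measurable_grad dphi.
have -> : (fun xg : 'cV[R]_m * 'cV[R]_m => (xg.2 - alpha^-1 *: grad phi xg.1) i ord0) =
    (fun xg => xg.2 i ord0 - alpha^-1 * grad phi xg.1 i ord0).
  by apply/funext => xg; rewrite !mxE.
have mi : measurable_fun setT (fun v : 'cV[R]_m => v i ord0).
  exact: measurable_mx_coord.
apply: measurable_funB; first exact: (measurableT_comp mi measurable_snd).
apply: measurable_funM; first exact: measurable_cst.
exact: (measurableT_comp (measurableT_comp mi mgphi) measurable_fst).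
Qed.

End block_measurability.

(** * Expected one-step descent of the method, telescoping and random output *)

Section bccg.
Context {R : realType} {b : nat} {n_ : 'I_b.+1 -> nat}.
Local Notation n := (\sum_s n_ s)%N.
Context {dXi d : measure_display} {Xi : measurableType dXi}.
Context {Omega : measurableType d}.
Variables (Q : probability Xi R) (P : probability Omega R).
Unset Implicit Arguments.
Variables (X : forall s, set 'cV[R]_(n_ s)).
Variables (F : 'cV[R]_n -> Xi -> R) (f : 'cV[R]_n -> R).
Variables (chi phi : forall s, 'cV[R]_(n_ s) -> R) (Phistar : R).
Variables (sigma M Lf : R) (L : 'I_b.+1 -> R).
Variables (x1 : 'cV[R]_n) (mu : R) (T : nat) (alpha delta : nat -> R).
Variables (N : nat -> nat) (p : 'I_b.+1 -> R).
Variables (ik : nat -> {RV P >-> 'I_b.+1}) (xi : nat -> nat -> {RV P >-> Xi}).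
Variables (u : nat -> nat -> {RV P >-> 'cV[R]_n}) (stop : {RV P >-> nat}).
Variable x : nat -> Omega -> 'cV[R]_n.
Set Implicit Arguments.

Let Phi y := f y + sum_blk chi y.
Let gap y := Phi y - Phistar.
Let weight k s := p s * (1 - L s * alpha k).
Let coef k s := p s * (1 / L s + 4 * alpha k).
Let den := \sum_(1 <= k < T.+1) alpha k * min_blk (weight k).
Let PR k := alpha k * min_blk (weight k) / den.
Let sigmat2 := 4 * (n%:R + 4) *
  (2 * M ^+ 2 + sigma ^+ 2 + mu ^+ 2 * Lf ^+ 2 * (n%:R + 4) ^+ 2).
Let noise k := 2 * sigmat2 / (N k)%:R + mu ^+ 2 / 2 * Lf ^+ 2 * (n%:R + 3) ^+ 3.

Hypothesis XP : forall s, closed (X s) /\ convex_set (M := 'cV[R]_(n_ s)) (X s).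
Hypothesis chiP : forall s, closed_convex_function (chi s).
Hypothesis phiP : forall s, (forall y, differentiable (phi s) y) /\
  strongly_convex1 (phi s).
Hypothesis mF : measurable_fun setT (fun z : 'cV[R]_n * Xi => F z.1 z.2).
Hypothesis PhiP : exists2 y, minimizer (prod_set X) Phi y & Phi y = Phistar.
Hypothesis L0 : forall s, 0 < L s.
Hypothesis A1 : assumption1 Q (prod_set X) F f sigma.
Hypothesis A2 : assumption2 Q F Lf L.
Hypothesis A3 : assumption3 (prod_set X) f M.
Hypotheses (Xx1 : prod_set X x1) (mu0 : 0 < mu).
Hypothesis Ndelta : forall k, (1 <= k <= T)%N -> (1 <= N k)%N /\ 0 < delta k.
Hypotheses (p01 : forall s, 0 <= p s <= 1).
Hypothesis alphaP : forall s k, (1 <= k <= T)%N -> 0 < alpha k /\ alpha k <= 1 / L s.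
Hypothesis den0 : den != 0.
Hypothesis draws : bccg_draws T N ik xi u stop Q p PR.
Hypothesis iterates : bccg_iterates T N ik xi u stop X phi chi F mu alpha delta x1 x.

Let mean_F y : has_mean Q (F y) (f y).
Proof.
case: A1 => /(_ y)[iF EF] _ _ _; split => //.
by move: EF; rewrite unlock.
Qed.

Let df y : differentiable f y. Proof. by case: A1. Qed.

Let mean_gradF y i : has_mean Q (fun z => grad (F ^~ z) y i ord0) (grad f y i ord0).
Proof.
case: A1 => _ _ /(_ y i)[iF EF] _; split => //.
by move: EF; rewrite unlock.
Qed.

Let alpha0 k : (1 <= k <= T)%N -> 0 < alpha k.
Proof. by move=> kT; have [] := alphaP ord0 kT. Qed.

Let G k (y : 'cV[R]_n) w :=
  zo_batch F mu (N k) y (fun t => xi k t w) (fun t => u k t w).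

(** Only block [i] moves, so [cndG_descent] applied to that block, with [f0] and [f1] the full
    values of [f], becomes a statement on [Phi]. Feasibility is proved along with it, as the
    induction in [feasible] needs it. *)
Let iterate_step k w : (1 <= k <= T)%N -> prod_set X (x k w) ->
  let i := ik k w in
  prod_set X (x k.+1 w) /\
  2 * gap (x k.+1 w) + alpha k * (1 - L i * alpha k) *
    enorm (blk i (gen_grad X phi chi (x k w) (grad f (x k w)) (alpha k))) ^+ 2 <=
  2 * gap (x k w) + 6 * delta k + (1 / L i + 4 * alpha k) *
    enorm (blk i (G k (x k w) w - grad f (x k w))) ^+ 2.
Proof.
move=> kT Xk i; case: iterates => _ _ /(_ k w kT)[run same].
have [cX cvX] := XP i; have [dphi sc] := phiP i.
have [ak aL] := alphaP i kT; have [_ dk] := Ndelta kT.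
have {}same s : s != i -> blk s (x k.+1 w) = blk s (x k w) by exact: same.
have Xi1 := (cndG_loopP cvX (ltn0Sn _) (Xk i) run).1.
split=> [s|].
  by have [->//|si] := eqVneq s i; rewrite same.
have := block_descent mean_F mean_gradF A2 (x k w) (blk i (x k.+1 w) - blk i (x k w)).
rewrite -(blk_update same) => fdec.
have := cndG_descent cX cvX (chiP i) dphi sc (Xk i) (L0 i) ak aL (ltW dk) run fdec.
have chik := sum_blk_update chi same.
rewrite /gap /Phi /gen_grad blk_mxcol blkD blkN.
move: chik; set D := enorm (_ - blk _ (grad f _)) ^+ 2.
set E := enorm (_ *: _) ^+ 2; lra.
Qed.

Let feasible k w : (1 <= k <= T.+1)%N -> prod_set X (x k w).
Proof.
elim: k => // -[_ _|k IH kT]; first by case: iterates => ->.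
exact: (iterate_step (k := k.+1) kT (IH (leqW kT))).1.
Qed.

Let gap_ge0 k w : (1 <= k <= T.+1)%N -> 0 <= gap (x k w).
Proof.
move=> kT; rewrite subr_ge0; case: PhiP => y [_ miny] <-.
exact/miny/feasible.
Qed.

Let mPhi : measurable_fun setT gap.
Proof.
apply: measurable_funB; last exact: measurable_cst.
apply: measurable_funD; last exact: measurable_sum_blk.
by apply: continuous_measurable_cV => y; exact: differentiable_continuous.
Qed.

Let mgradf : measurable_fun setT (grad f). Proof. exact: measurable_grad. Qed.

Let PP k y := enorm (gen_grad X phi chi y (grad f y) (alpha k)) ^+ 2.
Let PPs k s y := enorm (blk s (gen_grad X phi chi y (grad f y) (alpha k))) ^+ 2.

Let PP_blk k y : PP k y = \sum_s PPs k s y.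
Proof. exact: enorm_blk. Qed.

Let mPPs k s : (1 <= k <= T)%N -> measurable_fun setT (PPs k s).
Proof.
move=> kT; have [cX cvX] := XP s; have [dphi sc] := phiP s.
have X0 : X s !=set0 by exists (blk s x1); exact: Xx1.
have mprox := measurable_prox_sqr cX cvX X0 (chiP s) dphi sc (alpha0 kT).
have mb := @measurable_blk R b n_ s.
have mp : measurable_fun setT (fun y : 'cV[R]_n => (blk s y, blk s (grad f y))).
  by apply: measurable_fun_pair => //; exact: (measurableT_comp mb mgradf).
apply: measurable_funX; apply: (measurableT_comp (@measurable_enorm R (n_ s))).
have -> : (fun y => blk s (gen_grad X phi chi y (grad f y) (alpha k))) =
  (fun y => (alpha k)^-1 *: (blk s y - prox (X s) (phi s) (chi s) (blk s y)
     (blk s (grad f y)) (alpha k))) by apply/funext => y; rewrite blk_mxcol.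
apply: measurable_mx => i j; rewrite (ord1 j).
have mi : measurable_fun setT (fun v : 'cV[R]_(n_ s) => v i ord0).
  exact: measurable_mx_coord.
have -> : (fun y => ((alpha k)^-1 *: (blk s y - prox (X s) (phi s) (chi s) (blk s y)
     (blk s (grad f y)) (alpha k))) i ord0) = (fun y => (alpha k)^-1 *
   (blk s y i ord0 - prox (X s) (phi s) (chi s) (blk s y)
     (blk s (grad f y)) (alpha k) i ord0)).
  by apply/funext => y; rewrite mxE [X in _ * X]mxE; congr (_ * (_ + _)); rewrite mxE.
apply: measurable_funM; first exact: measurable_cst.
apply: measurable_funB; first exact: (measurableT_comp mi mb).
exact: (measurableT_comp (measurableT_comp mi mprox) mp).
Qed.

Let draw_sigmaP := draw_sigma ik xi u stop.

Let drawn := drawn_before N T.+1 `|` [set Stop].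

Let sigma_algebra_draw j : sigma_algebra setT (draw_sigmaP j).
Proof.
by case: j => [k|k t|k t|]; apply: sigma_algebra_preimage; exact: sigma_algebra_measurable.
Qed.

Let draw_measurable j : draw_sigmaP j `<=` measurable.
Proof.
by case: j => [k|k t|k t|] _ [B mB <-]; rewrite setTI -[X in measurable X]setTI;
  apply: measurable_funP.
Qed.

Let draws_independent D1 D2 : D1 `<=` drawn -> D2 `<=` drawn -> D1 `&` D2 = set0 ->
  independent P (\bigcup_(j in D1) draw_sigmaP j) (\bigcup_(j in D2) draw_sigmaP j).
Proof.
case: draws => _ _ _ _ ind.
by apply: (mutually_independent_groups ind) => j _;
  [exact: sigma_algebra_draw|exact: draw_measurable].
Qed.

Let gen (D : set draw) := \bigcup_(j in D) draw_sigmaP j.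

Let gen_measurable D : gen D `<=` measurable.
Proof. by move=> A [j _]; exact: draw_measurable. Qed.

Let drawn_beforeS k l : (k <= l)%N -> drawn_before N k `<=` drawn_before N l.
Proof.
move=> kl [j|j t|j t|] //=.
- by move=> /andP[-> /leq_trans]; exact.
- by move=> /andP[/andP[-> /leq_trans/(_ kl) ->]].
- by move=> /andP[/andP[-> /leq_trans/(_ kl) ->]].
Qed.

Let sub_drawn k : (k <= T.+1)%N -> drawn_before N k `<=` drawn.
Proof. by move=> kT j kj; left; exact: drawn_beforeS kj. Qed.

Let m_x (D : set draw) k : (1 <= k <= T.+1)%N -> drawn_before N k `<=` D ->
  measurable_fun setT (x k : g_sigma_algebraType (gen D) -> 'cV[R]_n).
Proof.
move=> kT kD _ A mA; rewrite setTI.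
case: iterates => _ /(_ k A kT mA) hist _.
apply: (smallest_sub _ _ hist); first exact: smallest_sigma_algebra.
by move=> B [j kj jB]; apply: sub_sigma_algebra; exists j => //; exact: kD.
Qed.

Let m_draw (D : set draw) d' (U : measurableType d') (Z : Omega -> U) j : D j ->
  g_sigma_algebra_preimage Z `<=` draw_sigmaP j ->
  measurable_fun setT (Z : g_sigma_algebraType (gen D) -> U).
Proof.
move=> Dj Zj _ A mA; apply: sub_sigma_algebra; exists j => //; apply: Zj.
by exists A.
Qed.

(* The draws of step k other than the block index. *)
Let batch k : set draw := fun j => match j with
  | Sample l t | Direction l t => (l == k) && (1 <= t <= N k)%N
  | _ => false end.

Let batch_drawn k : (1 <= k <= T)%N -> batch k `<=` drawn.
Proof. by move=> kT [l|l t|l t|]//= /andP[/eqP -> tN]; left; rewrite /= ltnS kT tN. Qed.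

Let m_x' k : (1 <= k <= T.+1)%N -> measurable_fun setT (x k).
Proof.
move=> kT; apply: (measurable_g_sigma_algebraType (@gen_measurable (drawn_before N k))).
exact: m_x.
Qed.

(** The iterate [Y] and the sample point [W] are separate so that the lemma applies both on a
    product space, with the two projections, and on [Omega] with a sub-sigma-algebra. Only the draws
    with [1 <= t <= N k] are known to be measurable for the latter. *)
Let mG d' (U : measurableType d') k (Y : U -> 'cV[R]_n) (W : U -> Omega) :
  measurable_fun setT Y ->
  (forall t, (1 <= t <= N k)%N -> measurable_fun setT (xi k t \o W)) ->
  (forall t, (1 <= t <= N k)%N -> measurable_fun setT (u k t \o W)) ->
  measurable_fun setT (fun v => G k (Y v) (W v) - grad f (Y v)).
Proof.
move=> mY mxi mu_; apply: measurable_mx => i j; rewrite (ord1 j).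
have mi : measurable_fun setT (fun v : 'cV[R]_n => v i ord0).
  exact: measurable_mx_coord.
have -> : (fun v => (G k (Y v) (W v) - grad f (Y v)) i ord0) =
  (fun v => (N k)%:R^-1 * (\sum_(1 <= t < (N k).+1 | (1 <= t <= N k)%N)
    ((F (Y v + mu *: u k t (W v)) (xi k t (W v)) - F (Y v) (xi k t (W v))) / mu *
      u k t (W v) i ord0)) - grad f (Y v) i ord0).
  apply/funext => v; rewrite !mxE coord_sum; congr (_ * _ - _).
  rewrite big_seq_cond [RHS]big_seq_cond; apply: eq_big => t.
    by rewrite mem_index_iota ltnS andbT andbb.
  by rewrite !mxE.
apply: measurable_funB; last exact: (measurableT_comp (measurableT_comp mi mgradf) mY).
apply: measurable_funM; first exact: measurable_cst.
apply: measurable_fun_bigsum => t tN.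
have mut := mu_ t tN; have mxt := mxi t tN.
apply: measurable_funM; last exact: (measurableT_comp mi mut).
apply: measurable_funM; last exact: measurable_cst.
have mbase : measurable_fun setT (fun v => (Y v, xi k t (W v))).
  exact: measurable_fun_pair.
have mpert : measurable_fun setT (fun v => (Y v + mu *: u k t (W v), xi k t (W v))).
  apply: measurable_fun_pair => //; apply: measurable_mx => i' j'; rewrite (ord1 j').
  have mi' : measurable_fun setT (fun v : 'cV[R]_n => v i' ord0).
    exact: measurable_mx_coord.
  have -> : (fun v => (Y v + mu *: u k t (W v)) i' ord0) =
      (fun v => Y v i' ord0 + mu * u k t (W v) i' ord0).
    by apply/funext => v; rewrite !mxE.
  apply: measurable_funD; first exact: (measurableT_comp mi' mY).
  by apply: measurable_funM; [exact: measurable_cst|exact: (measurableT_comp mi' mut)].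
exact: (measurable_funB (measurableT_comp mF mpert) (measurableT_comp mF mbase)).
Qed.

Let gen_sub (D : set draw) j : D j -> draw_sigmaP j `<=` <<s gen D >>.
Proof. by move=> Dj A jA; apply: sub_sigma_algebra; exists j. Qed.

Let batch_error_frozen k y : (1 <= k <= T)%N -> prod_set X y ->
  (\int[P]_w (enorm (G k y w - grad f y) ^+ 2)%:E <= (noise k)%:E)%E.
Proof.
move=> kT Xy; have [Nk _] := Ndelta kT.
case: A1 => _ _ _ /(_ y Xy); rewrite unlock => var.
case: (draws) => _ law_xi law_u _ _.
have good : {ae Q, forall z, (forall v, differentiable (F ^~ z) v) /\
    forall v w, enorm (grad (F ^~ z) v - grad (F ^~ z) w) <= Lf * enorm (v - w)}.
  by apply: filterS A2 => z [dF lip _].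
have tdrawn t : (1 <= t <= N k)%N -> drawn (Sample k t) /\ drawn (Direction k t).
  by move=> tN; split; left; rewrite /= ltnS kT tN.
apply: le_trans (zo_batch_error mu0 Nk mF (mean_gradF y) var (A3 Xy) good
  (z := fun t => xi k t) (u := fun t => u k t) _ _ _ _ _ _) _.
- by move=> t; exact: measurable_funP.
- by move=> t; exact: measurable_funP.
- by move=> t tN A mA; have := law_xi k t A kT tN mA.
- by move=> t tN; exact: law_u.
- move=> t tN; have [ds dd] := tdrawn t tN.
  apply: (@independent_sub _ _ _ _ (gen [set Sample k t]) (gen [set Direction k t])).
  + exact: (@gen_sub [set Sample k t] (Sample k t)).
  + exact: (@gen_sub [set Direction k t] (Direction k t)).
  + apply: draws_independent; [by move=> j ->|by move=> j ->|].
    by apply/seteqP; split => // j [->].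
- move=> t t' tN t'N tt'; have [ds dd] := tdrawn t tN; have [ds' dd'] := tdrawn t' t'N.
  pose D s := [set Sample k s; Direction k s].
  apply: (@independent_sub _ _ _ _ (gen (D t)) (gen (D t'))).
  + move=> A [A1'|A2']; [apply: (@gen_sub (D t) (Sample k t)) A1'|
      apply: (@gen_sub (D t) (Direction k t)) A2']; [by left|by right].
  + move=> A [A1'|A2']; [apply: (@gen_sub (D t') (Sample k t')) A1'|
      apply: (@gen_sub (D t') (Direction k t')) A2']; [by left|by right].
  + apply: draws_independent; [by move=> j [] ->|by move=> j [] ->|].
    by apply/seteqP; split => // j [] [] -> [] // [e]; rewrite e eqxx in tt'.
(* What remains is [(n + 2) * (M ^+ 2 + sigma ^+ 2) <= sigmat2] and
   [n * (n + 2) * (n + 4) <= (n + 3) ^+ 3]. *)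
rewrite lee_fin; apply: lerD.
  rewrite ler_wpM2r ?invr_ge0// ler_wpM2l// /sigmat2.
  have n0 : 0 <= n%:R :> R by [].
  have M2 := sqr_ge0 M; have s2 := sqr_ge0 sigma.
  have : 0 <= mu ^+ 2 * Lf ^+ 2 * (n%:R + 4) ^+ 2.
    by apply: mulr_ge0; rewrite ?sqr_ge0//; apply: mulr_ge0; rewrite sqr_ge0.
  move: (M ^+ 2) (sigma ^+ 2) (mu ^+ 2 * Lf ^+ 2 * (n%:R + 4) ^+ 2) M2 s2 n0.
  move: (n%:R : R) => m a c e a0 c0 m0 e0; nra.
rewrite ler_wpM2l//.
  by apply: mulr_ge0; rewrite ?sqr_ge0// divr_ge0// sqr_ge0.
have : 0 <= n%:R :> R by []; move: (n%:R : R) => m m0.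
rewrite !exprS expr0 mulr1; nra.
Qed.

Let batch_error k : (1 <= k <= T)%N ->
  (\int[P]_w (enorm (G k (x k w) w - grad f (x k w)) ^+ 2)%:E <= (noise k)%:E)%E.
Proof.
move=> kT; have kT' : (1 <= k <= T.+1)%N by case/andP: kT => -> /leqW.
have mtv t : (1 <= t <= N k)%N ->
    measurable_fun setT (xi k t : g_sigma_algebraType (gen (batch k)) -> Xi) /\
    measurable_fun setT (u k t : g_sigma_algebraType (gen (batch k)) -> 'cV[R]_n).
  move=> tN; split; first by apply: (m_draw (j := Sample k t)); rewrite /= ?eqxx.
  by apply: (m_draw (j := Direction k t)); rewrite /= ?eqxx.
(* The identity, viewed as a map into [Omega] with the sigma-algebra of the samples of step [k],
   represents the whole batch as one random element independent of [x k]. *)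
pose W : Omega -> g_sigma_algebraType (gen (batch k)) := fun w => w.
have mW : measurable_fun setT W.
  by move=> _ A mA; rewrite setTI; exact: (g_sigma_algebra_measurable (@gen_measurable (batch k)) mA).
have iXW : independent_fun P (x k) W.
  apply: (@independent_fun_sigma _ _ _ _ (gen (drawn_before N k)) (gen (batch k))).
  - apply: draws_independent; [exact: sub_drawn (andP kT').2|exact: batch_drawn|].
    apply/seteqP; split => // -[l|l t|l t|] [] //= /andP[/andP[_ lk] _] /andP[/eqP lk' _];
      by move: lk; rewrite lk' ltnn.
  - exact: m_x.
  - by move=> _ A mA; rewrite setTI.
pose h (v : 'cV[R]_n * g_sigma_algebraType (gen (batch k))) :=
  (enorm (G k v.1 v.2 - grad f v.1) ^+ 2)%:E.
have mh : measurable_fun setT h.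
  apply/measurable_EFinP; apply: measurable_funX.
  apply: (measurableT_comp (@measurable_enorm R n)).
  apply: mG; first exact: measurable_fst.
    by move=> t tN; exact: (measurableT_comp (mtv t tN).1 measurable_snd).
  by move=> t tN; exact: (measurableT_comp (mtv t tN).2 measurable_snd).
apply: (independent_integral_le (m_x' kT') mW iXW mh).
  by move=> v; rewrite lee_fin sqr_ge0.
by move=> w; exact/batch_error_frozen/feasible.
Qed.

Let slack_ge0 k s : (1 <= k <= T)%N -> 0 <= 1 - L s * alpha k.
Proof.
by move=> kT; have [_ aL] := alphaP s kT; rewrite subr_ge0 mulrC -ler_pdivlMr.
Qed.

Let weight_ge0 k s : (1 <= k <= T)%N -> 0 <= weight k s.
Proof.
by move=> kT; apply: mulr_ge0; [case/andP: (p01 s)|exact: slack_ge0].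
Qed.

Let coef_ge0 k s : (1 <= k <= T)%N -> 0 <= coef k s.
Proof.
move=> kT; have /andP[p0 _] := p01 s; apply: mulr_ge0 => //.
by rewrite addr_ge0 ?divr_ge0 ?mulr_ge0// ltW// alpha0.
Qed.

Let min_weight_ge0 k : (1 <= k <= T)%N -> 0 <= min_blk (weight k).
Proof. by move=> kT; apply: le_bigmin => [|s _]; exact: weight_ge0. Qed.

Let max_coef_ge0 k : (1 <= k <= T)%N -> 0 <= max_blk (coef k).
Proof. by move=> kT; apply: le_trans (coef_ge0 ord0 kT) _; exact: le_bigmax. Qed.

Let den_gt0 : 0 < den.
Proof.
rewrite lt_def den0/= /den big_seq_cond; apply: sumr_ge0 => k.
rewrite andbT mem_index_iota ltnS => kT.
by rewrite mulr_ge0 ?min_weight_ge0// ltW// alpha0.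
Qed.

(** [Block k] belongs neither to the draws before step [k] nor to the batch of step [k], so the
    index is independent of each [Y s] and averages out with weights [p s]. *)
Let block_index k (Y : 'I_b.+1 -> Omega -> R) : (1 <= k <= T)%N ->
  (forall s, measurable_fun setT
     (Y s : g_sigma_algebraType (gen (drawn_before N k `|` batch k)) -> R)) ->
  (forall s w, 0 <= Y s w) ->
  measurable_fun setT (fun w => Y (ik k w) w) /\
  (\int[P]_w (Y (ik k w) w)%:E = \int[P]_w (\sum_s p s * Y s w)%:E)%E.
Proof.
move=> kT mY Y0.
have mY' s : measurable_fun setT (Y s).
  exact: (measurable_g_sigma_algebraType (@gen_measurable _) (mY s)).
have ur : uniq (index_enum 'I_b.+1) by exact: index_enum_uniq.
have inr w : ik k w \in index_enum 'I_b.+1 by exact: mem_index_enum.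
have m1 (i : 'I_b.+1) : measurable [set i] by [].
have mik : measurable_fun setT (ik k) by exact: measurable_funP.
split.
  exact: (measurable_random_index (I := 'I_b.+1) ur inr m1 mik (fun s _ => mY' s)).
rewrite (ge0_integral_random_index (I := 'I_b.+1) ur inr m1 mik
  (fun s _ => mY' s) (q := p))//.
- under [RHS]eq_integral do rewrite -sumEFin.
  rewrite ge0_integral_sum//; last 2 first.
  + by move=> s; apply/measurable_EFinP; apply: measurable_funM.
  + by move=> s w _; rewrite lee_fin mulr_ge0//; case/andP: (p01 s).
  apply: eq_bigr => s _; under [RHS]eq_integral do rewrite EFinM.
  rewrite ge0_integralZl//; first exact/measurable_EFinP.
    by move=> w _; rewrite lee_fin.
  by rewrite lee_fin; case/andP: (p01 s).
- by move=> s _; case: draws => /(_ k s kT).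
- move=> s _; apply: (@independent_fun_sigma _ _ _ _ (gen [set Block k])
    (gen (drawn_before N k `|` batch k))) => //.
    apply: draws_independent.
    + by move=> j ->; left.
    + move=> j [|]; last exact: batch_drawn.
      by apply: sub_drawn; rewrite ltnW// ltnS; case/andP: kT.
    + by apply/seteqP; split => // j [-> []//=]; rewrite ltnn andbF.
  exact: (m_draw (j := Block k)).
Qed.

Let E k : \bar R := (\int[P]_w (2 * gap (x k w))%:E)%E.
Let a k : R := alpha k * min_blk (weight k).
Let I k : \bar R := (\int[P]_w (PP k (x k w))%:E)%E.

Let a_ge0 k : (1 <= k <= T)%N -> 0 <= a k.
Proof. by move=> kT; rewrite mulr_ge0 ?min_weight_ge0// ltW// alpha0. Qed.

Let mPP k : (1 <= k <= T)%N -> measurable_fun setT (PP k).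
Proof.
move=> kT; have -> : PP k = (fun y => \sum_s PPs k s y).
  by apply/funext => y; exact: PP_blk.
by apply: measurable_sum => s; exact: mPPs.
Qed.

Let mgap k : (1 <= k <= T.+1)%N -> measurable_fun setT (fun w => 2 * gap (x k w)).
Proof.
move=> kT; apply: measurable_funM; first exact: measurable_cst.
exact: (measurableT_comp mPhi (m_x' kT)).
Qed.

(** The pathwise inequality is integrated with all terms on the side where they are nonnegative,
    since [E k] might be infinite a priori. *)
Let one_step k : (1 <= k <= T)%N ->
  (E k.+1 + (a k)%:E * I k <=
   E k + (6 * delta k + max_blk (coef k) * noise k)%:E)%E.
Proof.
move=> kT; have kT' : (1 <= k <= T.+1)%N by case/andP: kT => -> /leqW.
have kS : (1 <= k.+1 <= T.+1)%N by rewrite ltnS; case/andP: kT.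
have [_ dk] := Ndelta kT.
pose D := drawn_before N k `|` batch k.
pose Delta w := G k (x k w) w - grad f (x k w).
pose YA s w := alpha k * (1 - L s * alpha k) * PPs k s (x k w).
pose YB s w := (1 / L s + 4 * alpha k) * enorm (blk s (Delta w)) ^+ 2.
have mxD : measurable_fun setT (x k : g_sigma_algebraType (gen D) -> 'cV[R]_n).
  by apply: m_x => // j; left.
have mDeltaD : measurable_fun setT (Delta : g_sigma_algebraType (gen D) -> 'cV[R]_n).
  apply: (@mG _ (g_sigma_algebraType (gen D)) k (x k) id mxD) => t tN.
    by apply: (m_draw (j := Sample k t)) => //; right; rewrite /= eqxx.
  by apply: (m_draw (j := Direction k t)) => //; right; rewrite /= eqxx.
have mDelta : measurable_fun setT Delta.
  exact: (measurable_g_sigma_algebraType (@gen_measurable D) mDeltaD).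
have mYAD s : measurable_fun setT (YA s : g_sigma_algebraType (gen D) -> R).
  apply: measurable_funM; first exact: measurable_cst.
  exact: (measurableT_comp (mPPs s kT) mxD).
have mYBD s : measurable_fun setT (YB s : g_sigma_algebraType (gen D) -> R).
  apply: measurable_funM; first exact: measurable_cst.
  apply: measurable_funX; apply: (measurableT_comp (@measurable_enorm R (n_ s))).
  exact: (measurableT_comp (@measurable_blk R b n_ s) mDeltaD).
have mYA s := measurable_g_sigma_algebraType (@gen_measurable D) (mYAD s).
have mYB s := measurable_g_sigma_algebraType (@gen_measurable D) (mYBD s).
have YA0 s w : 0 <= YA s w.
  apply: mulr_ge0; last exact: sqr_ge0.
  by rewrite mulr_ge0 ?slack_ge0// ltW// alpha0.
have YB0 s w : 0 <= YB s w.
  apply: mulr_ge0; last exact: sqr_ge0.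
  by rewrite addr_ge0 ?divr_ge0 ?mulr_ge0// ltW// alpha0.
have [mA eA] := block_index kT mYAD YA0.
have [mB eB] := block_index kT mYBD YB0.
have gap0 l w : (1 <= l <= T.+1)%N -> 0 <= 2 * gap (x l w).
  by move=> lT; rewrite mulr_ge0// gap_ge0.
(* After averaging, every block weight is replaced by the minimum, and the blocks add up to the full
   squared norm. *)
have lower : ((a k)%:E * I k <= \int[P]_w (YA (ik k w) w)%:E)%E.
  rewrite eA -ge0_integralZl//; last 3 first.
  - by apply/measurable_EFinP; exact: (measurableT_comp (mPP kT) (m_x' kT')).
  - by move=> w _; rewrite lee_fin sqr_ge0.
  - by rewrite lee_fin a_ge0.
  apply: ge0_le_integral => //.
  - by move=> w _; rewrite -EFinM lee_fin mulr_ge0 ?a_ge0// sqr_ge0.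
  - apply/measurable_EFinP; apply: measurable_funM => //.
    exact: (measurableT_comp (mPP kT) (m_x' kT')).
  - apply/measurable_EFinP; apply: measurable_sum => s.
    by apply: measurable_funM => //; exact: mYA.
  - move=> w _; rewrite -EFinM lee_fin PP_blk mulr_sumr; apply: ler_sum => s _.
    rewrite /YA mulrA ler_wpM2r ?sqr_ge0// /a mulrCA ler_wpM2l ?(ltW (alpha0 kT))//.
    exact: bigmin_le.
(* Symmetrically, the maximum coefficient is pulled out and the block errors add up to the error of
   the full batch gradient. *)
have upper : (\int[P]_w (YB (ik k w) w)%:E <= (max_blk (coef k) * noise k)%:E)%E.
  rewrite eB EFinM.
  apply: (@le_trans _ _ ((max_blk (coef k))%:E * \int[P]_w (enorm (Delta w) ^+ 2)%:E)%E).
    have mD2 : measurable_fun setT (fun w => enorm (Delta w) ^+ 2).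
      by apply: measurable_funX; exact: (measurableT_comp (@measurable_enorm R n)).
    rewrite -ge0_integralZl//; last 3 first.
    - exact/measurable_EFinP.
    - by move=> w _; rewrite lee_fin sqr_ge0.
    - by rewrite lee_fin max_coef_ge0.
    apply: ge0_le_integral => //.
    - move=> w _; rewrite lee_fin; apply: sumr_ge0 => s _; apply: mulr_ge0 => //.
      by case/andP: (p01 s).
    - apply/measurable_EFinP; apply: measurable_sum => s.
      by apply: measurable_funM => //; exact: mYB.
    - by apply/measurable_EFinP; apply: measurable_funM.
    - move=> w _; rewrite -EFinM lee_fin enorm_blk mulr_sumr; apply: ler_sum => s _.
      rewrite /YB mulrA ler_wpM2r ?sqr_ge0//.
      exact: (le_bigmax _ _ s).
  by rewrite lee_wpmul2l ?lee_fin ?max_coef_ge0// batch_error.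
apply: le_trans (leeD2l _ lower) _.
rewrite [X in (_ <= _ + X)%E]EFinD [leRHS]addeA.
have Eupper := leeD2l (E k + (6 * delta k)%:E) upper.
apply: (le_trans _ Eupper) => {Eupper}.
have d6 : 0 <= 6 * delta k by rewrite mulr_ge0// ltW.
have -> : (6 * delta k)%:E = (\int[P]_w (cst (6 * delta k)%:E w))%E.
  by rewrite integral_cst//= probability_setT mule1.
have mE l : (1 <= l <= T.+1)%N -> measurable_fun setT (fun w => (2 * gap (x l w))%:E).
  by move=> lT; exact/measurable_EFinP/mgap.
have mAE : measurable_fun setT (fun w => (YA (ik k w) w)%:E) by exact/measurable_EFinP.
have mBE : measurable_fun setT (fun w => (YB (ik k w) w)%:E) by exact/measurable_EFinP.
have mEc : measurable_fun setT (fun w => (2 * gap (x k w))%:E + cst (6 * delta k)%:E w)%E.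
  by apply: emeasurable_funD; [exact: mE|exact: measurable_cst].
have E0 l : (1 <= l <= T.+1)%N -> forall w, setT w -> (0 <= (2 * gap (x l w))%:E)%E.
  by move=> lT w _; rewrite lee_fin gap0.
have EA0 w : setT w -> (0 <= (YA (ik k w) w)%:E)%E by rewrite lee_fin.
have EB0 w : setT w -> (0 <= (YB (ik k w) w)%:E)%E by rewrite lee_fin.
have Ec0 (w : Omega) : setT w -> (0 <= cst (6 * delta k)%:E w)%E by rewrite lee_fin.
have Egc0 w : setT w -> (0 <= (2 * gap (x k w))%:E + cst (6 * delta k)%:E w)%E.
  by move=> _; rewrite adde_ge0 ?E0 ?Ec0.
rewrite /E -(ge0_integralD P measurableT (E0 _ kS) (mE _ kS) EA0 mAE).
rewrite -(ge0_integralD P measurableT (E0 _ kT') (mE _ kT') Ec0 (measurable_cst _)).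
rewrite -(ge0_integralD P measurableT Egc0 mEc EB0 mBE).
apply: ge0_le_integral => //.
- by move=> w _; rewrite -EFinD lee_fin addr_ge0 ?gap0.
- by apply: emeasurable_funD => //; exact: mE.
- exact: emeasurable_funD.
- move=> w _; rewrite -!EFinD lee_fin.
  exact: (iterate_step kT (feasible w kT')).2.
Qed.

(** The starting term [E 1] is the integral of a constant, hence finite; the later ones are carried
    on the left and never subtracted. *)
Let telescope m : (m <= T)%N ->
  (E m.+1 + \sum_(1 <= k < m.+1) (a k)%:E * I k <=
   (2 * (Phi x1 - Phistar) + \sum_(1 <= k < m.+1)
      (6 * delta k + max_blk (coef k) * noise k))%:E)%E.
Proof.
elim: m => [_|m IH mT].
  rewrite !big_geq// adde0 addr0 /E.
  have -> : (fun w => (2 * gap (x 1%N w))%:E) = cst (2 * gap x1)%:E.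
    by apply/funext => w; case: iterates => ->.
  by rewrite integral_cst//= probability_setT mule1.
pose S l := (\sum_(1 <= k < l.+1) (a k)%:E * I k)%E.
have SE : (S m.+1 = S m + (a m.+1)%:E * I m.+1)%E by rewrite /S big_nat_recr.
rewrite -/(S m.+1) SE [in leRHS]big_nat_recr//= [X in (_ <= X%:E)%E]addrA EFinD.
have step := one_step (k := m.+1) mT.
apply: (@le_trans _ _ (E m.+1 + S m +
    (6 * delta m.+1 + max_blk (coef m.+1) * noise m.+1)%:E)%E).
  by rewrite addeCA [leRHS]addeAC [leRHS]addeC leeD2l.
exact: leeD2r (IH (ltnW mT)).
Qed.

(** The stopping index is independent of each [x k], so the expectation at the output is the
    [PR]-weighted sum of the [I k]; as [PR k = a k / den], this is the telescoped sum divided by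
    [den]. *)
Lemma bccg_bound :
  (\int[P]_w (enorm (gen_grad X phi chi (x (stop w) w)
       (grad f (x (stop w) w)) (alpha (stop w))) ^+ 2)%:E
   <= ((2 * (Phi x1 - Phistar) + 6 * (\sum_(1 <= k < T.+1) delta k)
        + \sum_(1 <= k < T.+1) max_blk (coef k) * noise k) / den)%:E)%E.
Proof.
have rT k : k \in index_iota 1 T.+1 -> (1 <= k <= T)%N by rewrite mem_index_iota ltnS.
have rT' k : k \in index_iota 1 T.+1 -> (1 <= k <= T.+1)%N.
  by move=> /rT/andP[-> /leqW].
case: (draws) => _ _ _ [stopT law_stop] _.
have stop_r w : stop w \in index_iota 1 T.+1 by rewrite mem_index_iota ltnS.
have m1 (k : nat) : measurable [set k] by [].
have ms : measurable_fun setT stop by exact: measurable_funP.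
have mY k : k \in index_iota 1 T.+1 -> measurable_fun setT (fun w => PP k (x k w)).
  by move=> kr; exact: (measurableT_comp (mPP (rT k kr)) (m_x' (rT' k kr))).
rewrite (ge0_integral_random_index (I := nat) (Y := fun k w => PP k (x k w))
  (iota_uniq _ _) stop_r m1 ms mY (q := PR)); first last.
- move=> k kr; apply: (@independent_fun_sigma _ _ _ _ (gen [set Stop])
    (gen (drawn_before N k))) => //.
  + apply: draws_independent.
    * by move=> j ->; right.
    * by apply: sub_drawn; case/andP: (rT' k kr).
    * by apply/seteqP; split => // j [->].
  + exact: (m_draw (j := Stop)).
  + apply: (measurableT_comp (mPP (rT k kr))); apply: m_x => //; exact: rT'.
- by move=> k w _; exact: sqr_ge0.
- by move=> k kr; exact: law_stop (rT k kr).
have -> : (\sum_(1 <= k < T.+1) (PR k)%:E * I k =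
    (den^-1)%:E * \sum_(1 <= k < T.+1) (a k)%:E * I k)%E.
  rewrite big_seq_cond [in RHS]big_seq_cond ge0_sume_distrr.
    by apply: eq_bigr => k _; rewrite muleA -EFinM mulrC.
  move=> k /andP[/rT kT _]; rewrite mule_ge0 ?lee_fin ?a_ge0//.
  by apply: integral_ge0 => w _; rewrite lee_fin sqr_ge0.
rewrite [leRHS]EFinM [leRHS]muleC lee_wpmul2l//.
  by rewrite lee_fin invr_ge0 ltW.
rewrite -addrA mulr_sumr -big_split/=.
(* The final gap [E T.+1] is nonnegative and is dropped. *)
apply: le_trans (telescope (leqnn T)); rewrite leeDr//.
apply: integral_ge0 => w _; rewrite lee_fin mulr_ge0// gap_ge0//.
by rewrite leqnn.
Qed.

End bccg.

Theorem theorem7 (R : realType) (b : nat) (n_ : 'I_b.+1 -> nat)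
    (n := (\sum_s n_ s)%N)
    (dXi : measure_display) (Xi : measurableType dXi) (Q : probability Xi R)
    (d : measure_display) (Omega : measurableType d) (P : probability Omega R)
    (* the problem *)
    (X : forall s, set 'cV[R]_(n_ s))
    (F : 'cV[R]_n -> Xi -> R) (f : 'cV[R]_n -> R)
    (chi phi : forall s, 'cV[R]_(n_ s) -> R)
    (Phi := fun x => f x + sum_blk chi x) (Phistar : R)
    (sigma M Lf : R) (L : 'I_b.+1 -> R)
    (* the parameters of the method *)
    (x1 : 'cV[R]_n) (mu : R) (T : nat) (alpha delta : nat -> R)
    (N : nat -> nat) (p : 'I_b.+1 -> R)
    (den := \sum_(1 <= k < T.+1)
              alpha k * min_blk (fun s => p s * (1 - L s * alpha k)))
    (PR := fun k =>
       alpha k * min_blk (fun s => p s * (1 - L s * alpha k)) / den)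
    (sigmat2 := 4 * (n%:R + 4) *
       (2 * M ^+ 2 + sigma ^+ 2 + mu ^+ 2 * Lf ^+ 2 * (n%:R + 4) ^+ 2))
    (* the random quantities *)
    (ik : nat -> {RV P >-> 'I_b.+1}) (xi : nat -> nat -> {RV P >-> Xi})
    (u : nat -> nat -> {RV P >-> 'cV[R]_n}) (stop : {RV P >-> nat})
    (x : nat -> Omega -> 'cV[R]_n) :
  (forall s, closed (X s) /\ convex_set (M := 'cV[R]_(n_ s)) (X s)) ->
  (forall s, closed_convex_function (chi s)) ->
  (forall s, (forall y, differentiable (phi s) y) /\
             strongly_convex1 (phi s)) ->
  measurable_fun setT (fun z : 'cV[R]_n * Xi => F z.1 z.2) ->
  (exists2 y, minimizer (prod_set X) Phi y & Phi y = Phistar) ->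
  0 < Lf -> (forall s, 0 < L s) ->
  assumption1 Q (prod_set X) F f sigma ->
  assumption2 Q F Lf L ->
  assumption3 (prod_set X) f M ->
  prod_set X x1 -> 0 < mu ->
  (forall k, (1 <= k <= T)%N -> (1 <= N k)%N /\ 0 < delta k) ->
  (forall s, 0 <= p s <= 1) -> \sum_s p s = 1 ->
  (forall s k, (1 <= k <= T)%N -> 0 < alpha k /\ alpha k <= 1 / L s) ->
  den != 0 ->
  bccg_draws T N ik xi u stop Q p PR ->
  bccg_iterates T N ik xi u stop X phi chi F mu alpha delta x1 x ->
  ('E_P[fun w => (enorm (gen_grad X phi chi (x (stop w) w)
          (grad f (x (stop w) w)) (alpha (stop w))) ^+ 2)%R]
   <= ((2 * (Phi x1 - Phistar) + 6 * (\sum_(1 <= k < T.+1) delta k)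
        + \sum_(1 <= k < T.+1)
            max_blk (fun s => p s * (1 / L s + 4 * alpha k)) *
            (2 * sigmat2 / (N k)%:R
             + mu ^+ 2 / 2 * Lf ^+ 2 * (n%:R + 3) ^+ 3))
       / den)%:E)%E.
Proof.
move=> XP chiP phiP mF PhiP _ L0 A1 A2 A3 Xx1 mu0 Ndelta p01 _ alphaP den0 draws iterates.
rewrite unlock.
exact: (bccg_bound XP chiP phiP mF PhiP L0 A1 A2 A3 Xx1 mu0 Ndelta p01 alphaP
  den0 draws iterates).
Qed.
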